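(* Let $\omega\in(0,1]$, $R\in(0,1/2]$, let $F$ be as in the context, and assume the slow-decay hypothesis: there exist $M_F\in[1,\infty)$ and $a>0$ such that $\|F(p,q,t)\|_{R;\mathbb{R}^+}\le M_Fe^{-at}$ for all $t\in\mathbb{R}^+$. Consider $H(p,q,\eta,t)=\omega pq+\eta+F(p,q,t)$. Then there exist $0<\hat R_*<\hat R_0\le R^4$ and a family of canonical transformations $\mathcal{M}_{\mathcal S}:\mathcal{D}_{\hat R_*}\to\mathcal{D}_{\hat R_0}$, parametrised by $t\in\mathbb{R}^+$ (leaving $t$ unchanged) and analytic on $\mathcal{D}_{\hat R_*}$ for all $t\in\mathbb{R}^+$, transforming $H$ into the strong Moser normal form $$\hat H^{(\infty)}(\hat p^{(\infty)},\hat q^{(\infty)},\hat\eta^{(\infty)},t)=\omega\,\hat p^{(\infty)}\hat q^{(\infty)}+\hat\eta^{(\infty)}.$$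
   Context: Notation: $\mathbb{R}^+:=[0,\infty)$. For $\rho>0$, $\mathcal{Q}_\rho:=\{(p,q)\in\mathbb{C}^2:|p|,|q|\le\rho\}$, $\mathcal{S}_\rho:=\{\eta\in\mathbb{C}:|\Im\eta|\le\rho\}$, $\mathcal{D}_\rho:=\mathcal{Q}_\rho\times\mathcal{S}_\rho$. Multi-indices $\underline{\alpha}=(\alpha_1,\alpha_2)\in\mathbb{N}^2$, $|\underline{\alpha}|:=\alpha_1+\alpha_2$. The perturbation $F:\mathcal{Q}_R\times\mathbb{R}^+\to\mathbb{C}$ is, for every $t\in\mathbb{R}^+$, continuous on $\mathcal{Q}_R$, holomorphic in its interior and real for real $(p,q)$; its Taylor expansion is $F=\sum_{\underline\alpha}f_{\underline\alpha}(t)p^{\alpha_1}q^{\alpha_2}$ with $f_{\underline\alpha}(t)=0$ for all $|\underline\alpha|\le2$ and all $t$, and the real and imaginary parts of each $f_{\underline\alpha}$ belong to $C^1(\mathbb{R}^+)$. Time-dependent Taylor norm: for $G=\sum_{\underline\alpha}g_{\underline\alpha}(t)p^{\alpha_1}q^{\alpha_2}$, $\|G\|_{\rho;\mathbb{R}^+}:=\sum_{\underline\alpha}|g_{\underline\alpha}(t)|\rho^{|\underline\alpha|}$ (a function of $t$). The variable $\eta$ is the momentum conjugate to $t$ in the extended phase space; ''canonical'' refers to this extended phase space with $t$ unchanged, and the transformed Hamiltonian is $H\circ\mathcal{M}_{\mathcal S}$. *)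

(* Defs.v *)
From Stdlib Require Import Reals.
Open Scope R_scope.

Definition Cx : Type := (R * R)%type.
Definition Cre (z : Cx) : R := fst z.
Definition Cim (z : Cx) : R := snd z.
Definition RtoC (x : R) : Cx := (x, 0).
Definition C0 : Cx := (0, 0).
Definition C1 : Cx := (1, 0).
Definition Cplus (z w : Cx) : Cx := (fst z + fst w, snd z + snd w).
Definition Copp (z : Cx) : Cx := (- fst z, - snd z).
Definition Cminus (z w : Cx) : Cx := Cplus z (Copp w).
Definition Cmult (z w : Cx) : Cx :=
  (fst z * fst w - snd z * snd w, fst z * snd w + snd z * fst w).
Fixpoint Cpow (z : Cx) (n : nat) : Cx :=
  match n with O => C1 | S m => Cmult z (Cpow z m) end.
Definition Cmod (z : Cx) : R := sqrt (fst z ^ 2 + snd z ^ 2).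
Fixpoint Csum (u : nat -> Cx) (n : nat) : Cx :=
  match n with O => u O | S m => Cplus (Csum u m) (u (S m)) end.
Definition Cconv (u : nat -> Cx) (l : Cx) : Prop :=
  forall eps, 0 < eps -> exists N, forall n, (n >= N)%nat -> Cmod (Cminus (u n) l) < eps.

Definition C3 : Type := (Cx * Cx * Cx)%type.

Definition Qdom (rho : R) (p q : Cx) : Prop := Cmod p <= rho /\ Cmod q <= rho.
Definition Qint (rho : R) (p q : Cx) : Prop := Cmod p < rho /\ Cmod q < rho.
Definition Ddom (rho : R) (x : C3) : Prop :=
  let '(p, q, e) := x in Cmod p <= rho /\ Cmod q <= rho /\ Rabs (Cim e) <= rho.
Definition Dint (rho : R) (x : C3) : Prop :=
  let '(p, q, e) := x in Cmod p < rho /\ Cmod q < rho /\ Rabs (Cim e) < rho.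

Definition Cdiff2 (f : Cx -> Cx -> Cx) (p q : Cx) : Prop :=
  exists a b : Cx, forall eps, 0 < eps -> exists delta, 0 < delta /\
    forall h1 h2, Cmod h1 < delta -> Cmod h2 < delta ->
      Cmod (Cminus (Cminus (f (Cplus p h1) (Cplus q h2)) (f p q))
                   (Cplus (Cmult a h1) (Cmult b h2)))
      <= eps * (Cmod h1 + Cmod h2).

Definition Cdiff3 (f : C3 -> Cx) (x : C3) : Prop :=
  let '(p, q, e) := x in
  exists a b c : Cx, forall eps, 0 < eps -> exists delta, 0 < delta /\
    forall h1 h2 h3, Cmod h1 < delta -> Cmod h2 < delta -> Cmod h3 < delta ->
      Cmod (Cminus (Cminus (f (Cplus p h1, Cplus q h2, Cplus e h3)) (f (p, q, e)))
                   (Cplus (Cplus (Cmult a h1) (Cmult b h2)) (Cmult c h3)))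
      <= eps * (Cmod h1 + Cmod h2 + Cmod h3).

Definition dist3 (x y : C3) : R :=
  let '(p, q, e) := x in let '(p', q', e') := y in
  Cmod (Cminus p p') + Cmod (Cminus q q') + Cmod (Cminus e e').

Definition cont_on_Q (rho : R) (f : Cx -> Cx -> Cx) : Prop :=
  forall p q, Qdom rho p q -> forall eps, 0 < eps -> exists delta, 0 < delta /\
    forall p' q', Qdom rho p' q' -> Cmod (Cminus p' p) < delta -> Cmod (Cminus q' q) < delta ->
      Cmod (Cminus (f p' q') (f p q)) < eps.

Definition cont_on_D (rho : R) (f : C3 -> Cx) : Prop :=
  forall x, Ddom rho x -> forall eps, 0 < eps -> exists delta, 0 < delta /\
    forall y, Ddom rho y -> dist3 y x < delta -> Cmod (Cminus (f y) (f x)) < eps.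

Definition analytic_on_D (rho : R) (f : C3 -> Cx) : Prop :=
  (forall x, Dint rho x -> Cdiff3 f x) /\ cont_on_D rho f.

Definition C1_Rplus (g : R -> R) : Prop :=
  exists g' : R -> R,
    (forall t, 0 <= t -> forall eps, 0 < eps -> exists delta, 0 < delta /\
       forall h, h <> 0 -> 0 <= t + h -> Rabs h < delta ->
         Rabs ((g (t + h) - g t) / h - g' t) < eps) /\
    (forall t, 0 <= t -> forall eps, 0 < eps -> exists delta, 0 < delta /\
       forall s, 0 <= s -> Rabs (s - t) < delta -> Rabs (g' s - g' t) < eps).

Definition taylor_partial (f : nat -> nat -> R -> Cx) (p q : Cx) (t : R) (N : nat) : Cx :=
  Csum (fun i => Csum (fun j => Cmult (f i j t) (Cmult (Cpow p i) (Cpow q j))) N) N.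

Definition norm_partial (f : nat -> nat -> R -> Cx) (rho t : R) (N : nat) : R :=
  sum_f_R0 (fun i => sum_f_R0 (fun j => Cmod (f i j t) * rho ^ (i + j)) N) N.

(** ||F||_{rho;R^+}(t) <= B : the series of non-negative terms has sum <= B,
    i.e. all its (square) partial sums are <= B. *)
Definition taylor_norm_le (f : nat -> nat -> R -> Cx) (rho t B : R) : Prop :=
  forall N, norm_partial f rho t N <= B.

Definition dP_p (G : C3 -> R -> Cx) (x : C3) (t : R) (d : Cx) : Prop :=
  let '(p, q, e) := x in forall eps, 0 < eps -> exists delta, 0 < delta /\
    forall h, Cmod h < delta ->
      Cmod (Cminus (Cminus (G (Cplus p h, q, e) t) (G x t)) (Cmult d h)) <= eps * Cmod h.
Definition dP_q (G : C3 -> R -> Cx) (x : C3) (t : R) (d : Cx) : Prop :=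
  let '(p, q, e) := x in forall eps, 0 < eps -> exists delta, 0 < delta /\
    forall h, Cmod h < delta ->
      Cmod (Cminus (Cminus (G (p, Cplus q h, e) t) (G x t)) (Cmult d h)) <= eps * Cmod h.
Definition dP_e (G : C3 -> R -> Cx) (x : C3) (t : R) (d : Cx) : Prop :=
  let '(p, q, e) := x in forall eps, 0 < eps -> exists delta, 0 < delta /\
    forall h, Cmod h < delta ->
      Cmod (Cminus (Cminus (G (p, q, Cplus e h) t) (G x t)) (Cmult d h)) <= eps * Cmod h.
Definition dP_t (G : C3 -> R -> Cx) (x : C3) (t : R) (d : Cx) : Prop :=
  forall eps, 0 < eps -> exists delta, 0 < delta /\
    forall h, 0 <= t + h -> Rabs h < delta ->
      Cmod (Cminus (Cminus (G x (t + h)) (G x t)) (Cmult d (RtoC h))) <= eps * Rabs h.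

Definition compP (M : C3 -> R -> C3) : C3 -> R -> Cx :=
  fun x t => let '(P, Q, E) := M x t in P.
Definition compQ (M : C3 -> R -> C3) : C3 -> R -> Cx :=
  fun x t => let '(P, Q, E) := M x t in Q.
Definition compE (M : C3 -> R -> C3) : C3 -> R -> Cx :=
  fun x t => let '(P, Q, E) := M x t in E.

Definition wedge (a b c d : Cx) : Cx := Cminus (Cmult a b) (Cmult c d).

(** (p,q,eta,t) |-> (P,Q,E,t) is canonical on the interior of D_rho x R^+:
    it preserves the symplectic form  dq /\ dp + dt /\ deta  of the extended
    phase space, i.e.  dQ/\dP + dt/\dE = dq/\dp + dt/\deta.  Written out on
    the basis dx_i /\ dx_j, (x_1,x_2,x_3,x_4) = (p,q,eta,t). *)
Definition canonical_on (rho : R) (M : C3 -> R -> C3) : Prop :=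
  forall x t, Dint rho x -> 0 <= t ->
  exists Pp Pq Pe Pt Qp Qq Qe Qt Ep Eq Ee : Cx,
    dP_p (compP M) x t Pp /\ dP_q (compP M) x t Pq /\
    dP_e (compP M) x t Pe /\ dP_t (compP M) x t Pt /\
    dP_p (compQ M) x t Qp /\ dP_q (compQ M) x t Qq /\
    dP_e (compQ M) x t Qe /\ dP_t (compQ M) x t Qt /\
    dP_p (compE M) x t Ep /\ dP_q (compE M) x t Eq /\ dP_e (compE M) x t Ee /\
    (* dp/\dq *)   wedge Pp Qq Pq Qp = C1 /\
    (* dp/\deta *) wedge Qp Pe Qe Pp = C0 /\
    (* dq/\deta *) wedge Qq Pe Qe Pq = C0 /\
    (* dp/\dt *)   Cminus (wedge Qp Pt Qt Pp) Ep = C0 /\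
    (* dq/\dt *)   Cminus (wedge Qq Pt Qt Pq) Eq = C0 /\
    (* deta/\dt *) Cminus (wedge Qe Pt Qt Pe) Ee = Copp C1.

Definition Ham (omega : R) (F : Cx -> Cx -> R -> Cx) (x : C3) (t : R) : Cx :=
  let '(p, q, e) := x in
  Cplus (Cplus (Cmult (RtoC omega) (Cmult p q)) e) (F p q t).

(* Main.v *)
(* No KAM iteration is needed.  Look for the transformation in the form P = p + u, Q = q + v with
   u, v formal series in (p, q) whose coefficients are functions of t.  Conjugating the flows
   means (X + omega) u = - F_q(P, Q, t) and (X - omega) v = F_p(P, Q, t), where
   X = d/dt - omega p d/dp + omega q d/dq acts on the coefficient of p^i q^j as
   d/dt + omega (j - i).  Each scalar equation y' + lambda y = g with |g| <= c exp(- beta t) is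
   solved with the loss of a factor 1 / beta only: from t = 0 if lambda > 0 and from t = infinity
   if lambda <= 0, provided that 2 beta <= omega.  There are no small divisors, and F_p, F_q start
   at order two, so the Picard iterates stabilise degree by degree and stay bounded in a weighted
   norm.  The Jacobian J = P_p Q_q - P_q Q_p satisfies X J = 0; J - 1 decays in t and at t = 0
   contains only monomials p^i q^j with j <= i, which forces J = 1.  Finally the momentum
   component eta + omega p q - omega P Q - F(P, Q, t) makes the map canonical in the extended
   phase space. *)
From Stdlib Require Import Reals Lra Lia FunctionalExtensionality.
From Coquelicot Require Import Rcomplements Rbar Hierarchy Continuity Derive RInt RInt_analysis.
From Coquelicot Require Import AutoDerive Lim_seq Series.
From Coquelicot Require Complex.
Require Import Defs.
Open Scope R_scope.
Set Implicit Arguments.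
Unset Strict Implicit.

(** * Formal power series over a commutative ring *)

(** The unknown series enter the conjugation equations without derivatives in p and q, because X is
    diagonal on monomials. So the iteration never shrinks the domain; only a fixed number of
    doublings of the growth rate K is paid afterwards, for products and derivatives. The resonant
    terms, which obstruct a full normal form in the autonomous case, are harmless: for lambda = 0
    the forcing is integrable up to infinity. What slow decay forbids is integrating from infinity
    when lambda > 0, since exp(lambda t) g need not be integrable; there the solution starts at t =
    0. As the map comes from a conjugation of vector fields and not from a generating function,
    symplecticity is a separate issue, and the chosen initial values are what pins the Jacobian to
    1. The algebra (chain rule, X J = 0, canonical relations) is done by [ring] on formal series
    over an abstract coefficient ring; the same Cauchy product serves for complex numbers, functions
    of time and real majorant weights. Size is controlled through the coefficients alone, and
    evaluation at points comes last. *)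

Record cring := CRing {
  car :> Type; rO : car; rI : car;
  radd : car -> car -> car; rmul : car -> car -> car;
  rsub : car -> car -> car; ropp : car -> car;
  rth : ring_theory rO rI radd rmul rsub ropp eq }.
Arguments rO {_}. Arguments rI {_}. Arguments radd {_} _ _. Arguments rmul {_} _ _.
Arguments rsub {_} _ _. Arguments ropp {_} _.

Declare Scope cr_scope.
Delimit Scope cr_scope with cr.
Infix "+" := radd : cr_scope.
Infix "*" := rmul : cr_scope.
Infix "-" := rsub : cr_scope.
Notation "- x" := (ropp x) : cr_scope.
Notation "0" := rO : cr_scope.
Notation "1" := rI : cr_scope.

Fixpoint nsm {A : cring} (n : nat) (x : A) : A :=
  match n with O => 0%cr | S m => (x + nsm m x)%cr end.
Fixpoint rpow {A : cring} (x : A) (n : nat) : A :=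
  match n with O => 1%cr | S m => (x * rpow x m)%cr end.
Fixpoint sumr {A : cring} (f : nat -> A) (n : nat) : A :=
  match n with O => f O | S m => (sumr f m + f (S m))%cr end.

Section Ring.
Variable A : cring.
Add Ring Aring : (rth A).
Open Scope cr_scope.
Implicit Types x y : A.

Lemma nsm_mul k l x y : nsm (k + l) (x * y) = nsm k x * y + x * nsm l y.
Proof.
  assert (H : forall l, nsm l (x * y) = x * nsm l y).
  { clear; induction l as [|l IH]; simpl; [ring|rewrite IH; ring]. }
  induction k as [|k IH]; simpl.
  - rewrite H; ring.
  - rewrite IH; ring.
Qed.

Lemma nsm_mulr l x y : nsm l (x * y) = x * nsm l y.
Proof. generalize (nsm_mul 0 l x y); simpl; intros ->; ring. Qed.

Lemma nsm_add k x y : nsm k (x + y) = nsm k x + nsm k y.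
Proof. induction k as [|k IH]; simpl; [ring|rewrite IH; ring]. Qed.

Lemma nsm_O k : nsm k (0 : A) = 0.
Proof. induction k as [|k IH]; simpl; [ring|rewrite IH; ring]. Qed.

Lemma nsm_opp k x : nsm k (- x) = - nsm k x.
Proof. induction k as [|k IH]; simpl; [ring|rewrite IH; ring]. Qed.

Lemma nsm_comm k l x : nsm k (nsm l x) = nsm l (nsm k x).
Proof.
  induction k as [|k IH]; simpl; [now rewrite nsm_O|now rewrite IH, nsm_add].
Qed.

Lemma sumr_ext (f g : nat -> A) n :
  (forall k, (k <= n)%nat -> f k = g k) -> sumr f n = sumr g n.
Proof.
  induction n as [|n IH]; simpl; intros H; [apply H; lia|].
  rewrite IH, H; auto with arith.
Qed.

Lemma sumr_add (f g : nat -> A) n : sumr (fun k => f k + g k) n = sumr f n + sumr g n.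
Proof. induction n as [|n IH]; simpl; [ring|rewrite IH; ring]. Qed.

Lemma sumr_mulr (f : nat -> A) y n : sumr (fun k => f k * y) n = sumr f n * y.
Proof. induction n as [|n IH]; simpl; [ring|rewrite IH; ring]. Qed.

Lemma sumr_shift (f g : nat -> A) n :
  f O = 0 -> (forall k, f (S k) = g k) -> sumr f n = sumr g n - g n.
Proof.
  intros H0 HS; induction n as [|n IH]; simpl; [rewrite H0; ring|].
  rewrite IH, HS; ring.
Qed.

Lemma sumr_tail (f : nat -> A) m n :
  (m <= n)%nat -> (forall k, (m < k)%nat -> f k = 0) -> sumr f n = sumr f m.
Proof.
  intros Hmn Hf; induction Hmn as [|n Hmn IH]; [reflexivity|].
  simpl; rewrite IH, Hf by lia; ring.
Qed.

Lemma sumr_O (f : nat -> A) n : (forall k, f k = 0) -> sumr f n = 0.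
Proof. intros H; induction n as [|n IH]; simpl; rewrite ?IH, !H; ring. Qed.
End Ring.

Definition tl {T : Type} (a : nat -> T) : nat -> T := fun n => a (S n).

(** Recursion on the tail of [a] mirrors (a0 + x a') b = a0 b + x (a' b), so identities go through
    by induction on n for all [a], without index subtraction. *)
Fixpoint cauchy {A : cring} (a b : nat -> A) (n : nat) : A :=
  match n with
  | O => (a O * b O)%cr
  | S m => (a O * b (S m) + cauchy (tl a) b m)%cr
  end.

Definition cst {A : cring} (x : A) : nat -> A :=
  fun n => match n with O => x | S _ => 0%cr end.

(** Every coefficient of a product is a sum of terms a k * b l with k + l = n, so an additive
    relation only has to be checked on these. Three rings allow a product to be compared with its
    evaluation or with a real majorant; the third slot also carries the second term of a Leibniz
    rule. *)
Lemma cauchy_ind3 (A B D : cring) (P : A -> B -> D -> Prop)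
  (HP : forall x x' y y' z z', P x y z -> P x' y' z' ->
          P (x + x')%cr (y + y')%cr (z + z')%cr) n :
  forall (a b : nat -> A) (a' b' : nat -> B) (a'' b'' : nat -> D),
  (forall k l, (k + l)%nat = n -> P (a k * b l)%cr (a' k * b' l)%cr (a'' k * b'' l)%cr) ->
  P (cauchy a b n) (cauchy a' b' n) (cauchy a'' b'' n).
Proof.
  induction n as [|n IH]; simpl; intros a b a' b' a'' b'' H.
  - now apply H.
  - apply HP; [now apply H|].
    apply IH; intros k l E; apply (H (S k) l); lia.
Qed.

Section PowerSeries.
Variable A : cring.
Add Ring Aring2 : (rth A).
Open Scope cr_scope.
Implicit Types a b c : nat -> A.

Lemma cauchy_Sr n : forall a b, cauchy a b (S n) = cauchy a (tl b) n + a (S n) * b O.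
Proof.
  induction n as [|n IH]; intros a b; [simpl; unfold tl; ring|].
  change (cauchy a b (S (S n))) with (a O * b (S (S n)) + cauchy (tl a) b (S n)).
  rewrite IH; simpl; unfold tl at 3 4; ring.
Qed.

Lemma cauchy_comm n : forall a b, cauchy a b n = cauchy b a n.
Proof.
  induction n as [|n IH]; intros a b; [simpl; ring|].
  rewrite (cauchy_Sr n b a); simpl; rewrite (IH (tl a) b); ring.
Qed.

Lemma cauchy_addl n : forall a a' b,
  cauchy (fun k => a k + a' k) b n = cauchy a b n + cauchy a' b n.
Proof.
  induction n as [|n IH]; intros a a' b; [simpl; ring|].
  simpl; unfold tl at 1; rewrite (IH (tl a) (tl a')); ring.
Qed.

Lemma cauchy_scal x n : forall a b, cauchy (fun k => x * a k) b n = x * cauchy a b n.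
Proof.
  induction n as [|n IH]; intros a b; [simpl; ring|].
  simpl; unfold tl at 1; rewrite (IH (tl a)); ring.
Qed.

Lemma cauchy_assoc n : forall a b c,
  cauchy (cauchy a b) c n = cauchy a (cauchy b c) n.
Proof.
  induction n as [|n IH]; intros a b c; [simpl; ring|].
  simpl.
  change (tl (cauchy a b)) with (fun k => a O * tl b k + cauchy (tl a) b k).
  rewrite cauchy_addl, cauchy_scal, IH; ring.
Qed.

Lemma cauchy_cst x n b : cauchy (cst x) b n = x * b n.
Proof.
  destruct n as [|n]; [reflexivity|]; simpl.
  (* The tail of a constant is 0; writing the product as 0 times itself lets [cauchy_scal] absorb
     that factor. *)
  replace (cauchy (tl (cst x)) b n) with (0 * cauchy (tl (cst x)) b n); [ring|].
  rewrite <- cauchy_scal; f_equal.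
  apply functional_extensionality; intros k; unfold tl; simpl; ring.
Qed.

Lemma ps_theory : @ring_theory (nat -> A) (fun _ => 0) (cst 1)
  (fun a b n => a n + b n) cauchy (fun a b n => a n - b n) (fun a n => - a n) eq.
Proof.
  constructor; intros; apply functional_extensionality; intros n; try ring.
  - rewrite cauchy_cst; ring.
  - apply cauchy_comm.
  - symmetry; apply cauchy_assoc.
  - apply cauchy_addl.
Qed.
End PowerSeries.

Definition ps (A : cring) : cring := CRing (ps_theory A).

(** * Formal differentiation in one variable *)

Definition dps {A : cring} (a : ps A) : ps A := fun n => nsm (S n) (a (S n)).

Section Derivations.
Variable A : cring.
Add Ring Aring3 : (rth A).
Open Scope cr_scope.

Lemma dps_add (a b : ps A) : dps (a + b) = dps a + dps b.
Proof. apply functional_extensionality; intros n; apply (nsm_add (S n)). Qed.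

Lemma dps_opp (a : ps A) : dps (- a) = - dps a.
Proof. apply functional_extensionality; intros n; apply (nsm_opp (S n)). Qed.

Lemma dps_cst (x : A) : dps (cst x : ps A) = 0.
Proof. apply functional_extensionality; intros n; apply (nsm_O A (S n)). Qed.

(** The Euler operator x d/dx multiplies degree n by n, and degrees add in a product; [dps_mul] is
    this Leibniz rule divided by x. *)
Lemma theta_mul (a b : ps A) n :
  nsm n (cauchy a b n) =
  cauchy (fun k => nsm k (a k)) b n + cauchy a (fun k => nsm k (b k)) n.
Proof.
  apply (@cauchy_ind3 A A A (fun x y z => nsm n x = y + z)).
  - intros x x' y y' z z' H H'; rewrite nsm_add, H, H'; ring.
  - intros k l <-; apply nsm_mul.
Qed.

Lemma dps_mul (a b : ps A) : dps (a * b) = dps a * b + a * dps b.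
Proof.
  apply functional_extensionality; intros n.
  change (nsm (S n) (cauchy a b (S n)) = cauchy (dps a) b n + cauchy a (dps b) n).
  rewrite theta_mul, (cauchy_Sr n a); simpl.
  change (tl (fun k => nsm k (a k))) with (dps a).
  change (tl (fun k => nsm k (b k))) with (dps b).
  ring.
Qed.
End Derivations.

Lemma ps_nsm (A : cring) k (a : ps A) n : nsm k a n = nsm k (a n).
Proof. induction k as [|k IH]; simpl; congruence. Qed.


Definition shift {A : cring} (a : ps A) : ps A :=
  fun n => match n with O => 0%cr | S m => a m end.

Section Shift.
Variable A : cring.
Add Ring Aring4 : (rth A).
Open Scope cr_scope.

Lemma shift_mul (a b : ps A) : shift a * b = shift (a * b).
Proof.
  apply functional_extensionality; intros [|n].
  - change (0 * b O = 0); ring.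
  - change (0 * b (S n) + cauchy a b n = cauchy a b n); ring.
Qed.
End Shift.

Lemma cauchy2_ind3 (A B D : cring) (P : A -> B -> D -> Prop)
  (HP : forall x x' y y' z z', P x y z -> P x' y' z' ->
          P (x + x')%cr (y + y')%cr (z + z')%cr) i j
  (a b : ps (ps A)) (a' b' : ps (ps B)) (a'' b'' : ps (ps D)) :
  (forall k l m n, (k + l)%nat = i -> (m + n)%nat = j ->
     P (a k m * b l n)%cr (a' k m * b' l n)%cr (a'' k m * b'' l n)%cr) ->
  P ((a * b)%cr i j) ((a' * b')%cr i j) ((a'' * b'')%cr i j).
Proof.
  intros H.
  apply (@cauchy_ind3 (ps A) (ps B) (ps D) (fun x y z => P (x j) (y j) (z j))).
  - intros; now apply HP.
  - intros k l E; apply (cauchy_ind3 HP); auto.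
Qed.

(** * Series in two variables and substitution *)

Section TwoVariables.
Variable A : cring.
Add Ring Aring5 : (rth A).
Definition S2 : cring := ps (ps A).
Add Ring S2ring : (rth S2).
Open Scope cr_scope.
Implicit Types s : S2.

Lemma S2_ext (a b : S2) : (forall i j, a i j = b i j) -> a = b.
Proof.
  intros H; apply functional_extensionality; intros i.
  apply functional_extensionality; intros j; apply H.
Qed.

Definition inj (x : A) : S2 := cst (cst x : ps A).
Definition var_p : S2 := shift (1 : ps (ps A)).
Definition var_q : S2 := cst (shift (1 : ps A)).
Definition dp (s : S2) : S2 := dps s.
Definition dq (s : S2) : S2 := fun i => dps (s i).

Lemma inj_mul x s i j : (inj x * s) i j = x * s i j.
Proof.
  change (cauchy (cst (cst x : ps A)) s i j = x * s i j).
  rewrite cauchy_cst; apply cauchy_cst.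
Qed.

Lemma var_p_mul s : var_p * s = shift s.
Proof. unfold var_p; transitivity (shift (1 * s : ps (ps A))); [apply shift_mul|f_equal; ring]. Qed.

Lemma var_q_mul s i : (var_q * s) i = shift (s i).
Proof.
  change (cauchy (cst (shift (1 : ps A))) s i = shift (s i)).
  rewrite cauchy_cst, shift_mul; f_equal.
  apply (Rmul_1_l (rth (ps A))).
Qed.

Lemma dp_coef s i j : dp s i j = nsm (S i) (s (S i) j).
Proof. exact (ps_nsm (S i) (s (S i)) j). Qed.

Lemma dq_coef s i j : dq s i j = nsm (S j) (s i (S j)).
Proof. reflexivity. Qed.

Lemma var_p_dp s i j : (var_p * dp s) i j = nsm i (s i j).
Proof. rewrite var_p_mul; destruct i; [reflexivity|apply dp_coef]. Qed.

Lemma var_q_dq s i j : (var_q * dq s) i j = nsm j (s i j).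
Proof. rewrite var_q_mul; now destruct j. Qed.

(** Interface shared by [dp] and [dq], so that the chain rule is proved once; [der_inj] treats the
    coefficients, later functions of time, as constants. *)
Record derivation (D : S2 -> S2) : Prop := {
  der_add : forall s s', D (s + s') = D s + D s';
  der_opp : forall s, D (- s) = - D s;
  der_mul : forall s s', D (s * s') = D s * s' + s * D s';
  der_inj : forall x, D (inj x) = 0 }.

Lemma dp_derivation : derivation dp.
Proof.
  constructor; [apply dps_add|apply dps_opp|apply dps_mul|intros; apply dps_cst].
Qed.

Lemma dq_derivation : derivation dq.
Proof.
  constructor; intros; apply functional_extensionality; intros i.
  - apply dps_add.
  - apply dps_opp.
  - change (dps (cauchy s s' i) = cauchy (dq s) s' i + cauchy s (dq s') i).
    apply (@cauchy_ind3 (ps A) (ps A) (ps A) (fun x y z => dps x = y + z)).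
    + intros x x' y y' z z' H H'; rewrite dps_add, H, H'.
      apply functional_extensionality; intros k; simpl; ring.
    + intros; apply dps_mul.
  - destruct i; [apply dps_cst|].
    apply functional_extensionality; intros k; apply nsm_O.
Qed.

Lemma dp_var_p : dp var_p = 1.
Proof.
  apply S2_ext; intros i j; rewrite dp_coef.
  destruct i as [|i]; [destruct j; simpl; ring|].
  change (var_p (S (S i)) j) with (0 : A); rewrite nsm_O; reflexivity.
Qed.

Lemma dp_var_q : dp var_q = 0.
Proof. apply S2_ext; intros i j; rewrite dp_coef; apply nsm_O. Qed.

Lemma dq_var_p : dq var_p = 0.
Proof.
  apply S2_ext; intros i j; rewrite dq_coef.
  replace (var_p i (S j)) with (0 : A); [apply nsm_O|].
  now destruct i as [|[|]].
Qed.

Lemma dq_var_q : dq var_q = 1.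
Proof.
  apply S2_ext; intros i j; rewrite dq_coef.
  destruct i as [|i]; [|apply nsm_O].
  destruct j as [|j]; [simpl; ring|].
  change (var_q O (S (S j))) with (0 : A); rewrite nsm_O; reflexivity.
Qed.

(** * Order of vanishing *)

Definition val (k : nat) (s : S2) : Prop := forall i j, (i + j < k)%nat -> s i j = 0.

Lemma val_le k l s : (l <= k)%nat -> val k s -> val l s.
Proof. intros H Hs i j Hij; apply Hs; lia. Qed.

Lemma val_add k s s' : val k s -> val k s' -> val k (s + s').
Proof.
  intros H H' i j Hij; change (s i j + s' i j = 0); rewrite H, H' by easy; ring.
Qed.

Lemma val_opp k s : val k s -> val k (- s).
Proof. intros H i j Hij; change (- s i j = 0); rewrite H by easy; ring. Qed.

Lemma val_sub k s s' : val k s -> val k s' -> val k (s - s').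
Proof.
  intros; replace (s - s') with (s + - s') by ring; auto using val_add, val_opp.
Qed.

Lemma val_O k : val k 0.
Proof. now intros i j _. Qed.

Lemma val_mul k l s s' : val k s -> val l s' -> val (k + l) (s * s').
Proof.
  intros H H' i j Hij.
  refine (@cauchy2_ind3 A A A (fun x _ _ => x = 0) _ i j s s' s s' s s' _).
  - intros; subst; ring.
  - intros i1 i2 j1 j2 <- <-.
    destruct (Nat.lt_ge_cases (i1 + j1) k).
    + rewrite H by easy; ring.
    + rewrite H' by lia; ring.
Qed.

Lemma val_mulr l s s' : val l s' -> val l (s * s').
Proof. apply (@val_mul 0 l); intros i j Hij; lia. Qed.

Lemma val_pow k s n : val k s -> val (n * k) (rpow s n).
Proof.
  intros H; induction n as [|n IH]; [intros i j Hij; lia|].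
  now apply val_mul.
Qed.

Lemma val_sumr k (F : nat -> S2) n :
  (forall m, (m <= n)%nat -> val k (F m)) -> val k (sumr F n).
Proof.
  induction n as [|n IH]; simpl; intros H; [apply H; lia|].
  apply val_add; [apply IH; intros; apply H; lia|apply H; lia].
Qed.

(** Separatedness of the filtration by order; formal limits are identified through it. *)
Lemma val_eq s s' : (forall k, val k (s - s')) -> s = s'.
Proof.
  intros H; apply S2_ext; intros i j.
  assert (E : s i j - s' i j = 0) by (apply (H (S (i + j))); lia).
  transitivity (s i j - s' i j + s' i j); [ring|rewrite E; ring].
Qed.

Lemma val_dp k s : val (S k) s -> val k (dp s).
Proof.
  intros H i j Hij; rewrite dp_coef, H by lia; apply nsm_O.
Qed.

Lemma val_dq k s : val (S k) s -> val k (dq s).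
Proof.
  intros H i j Hij; rewrite dq_coef, H by lia; apply nsm_O.
Qed.

(** * Substitution of series without constant term *)

Section Composition.
Variable g : nat -> nat -> A.
Definition mono (U V : S2) a b : S2 := rpow U a * rpow V b.
Definition csum (U V : S2) (N : nat) : S2 :=
  sumr (fun a => sumr (fun b => inj (g a b) * mono U V a b) N) N.
(* The truncation at i + j is harmless when U and V have no constant term: [mono U V a b]
   then has order at least a + b. *)
Definition comp (U V : S2) : S2 := fun i j => csum U V (i + j) i j.
End Composition.

Lemma val_mono U V a b : val 1 U -> val 1 V -> val (a + b) (mono U V a b).
Proof.
  intros HU HV; apply val_mul.
  - apply val_le with (a * 1)%nat; [lia|now apply val_pow].
  - apply val_le with (b * 1)%nat; [lia|now apply val_pow].
Qed.

Lemma S2_sumr (F : nat -> S2) k i j : sumr F k i j = sumr (fun a => F a i j) k.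
Proof.
  induction k as [|k IH]; [reflexivity|].
  change (sumr F k i j + F (S k) i j = sumr (fun a => F a i j) k + F (S k) i j).
  now rewrite IH.
Qed.

Lemma csum_coef g U V N i j :
  csum g U V N i j = sumr (fun a => sumr (fun b => g a b * mono U V a b i j) N) N.
Proof.
  unfold csum; rewrite S2_sumr; apply sumr_ext; intros a _.
  rewrite S2_sumr; apply sumr_ext; intros b _; apply inj_mul.
Qed.

(** A monomial with a or b beyond i + j has order beyond i + j, so enlarging the truncation does not
    change the coefficient (i, j). *)
Lemma csum_comp g U V N : val 1 U -> val 1 V -> val (S N) (csum g U V N - comp g U V).
Proof.
  intros HU HV i j Hij.
  change (csum g U V N i j - csum g U V (i + j) i j = 0).
  rewrite !csum_coef.
  rewrite (@sumr_tail A _ (i + j) N).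
  - erewrite sumr_ext; [|intros a _; apply (@sumr_tail A _ (i + j) N); [lia|]]; [ring|].
    intros b Hb; rewrite (@val_mono U V a b) by (auto; lia); ring.
  - lia.
  - intros a Ha; apply sumr_O; intros b.
    rewrite (@val_mono U V a b) by (auto; lia); ring.
Qed.

Lemma val_comp g U V k : val 1 U -> val 1 V ->
  (forall a b, (a + b < k)%nat -> g a b = 0) -> val k (comp g U V).
Proof.
  intros HU HV Hg i j Hij; unfold comp; rewrite csum_coef.
  apply sumr_O; intros a; apply sumr_O; intros b.
  destruct (Nat.lt_ge_cases (a + b) k).
  - rewrite Hg by easy; ring.
  - rewrite (@val_mono U V a b) by (auto; lia); ring.
Qed.

(** U^n - U'^n contains one factor U - U' of order k and n - 1 factors of order 1. For n = 0 the
    difference is 0, so the truncated subtraction does no harm. *)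
Lemma pow_diff U U' k n : val 1 U -> val 1 U' -> val k (U - U') ->
  val (k + n - 1) (rpow U n - rpow U' n).
Proof.
  intros H H' Hd; induction n as [|n IH]; cbn [rpow].
  - replace (1 - 1 : S2) with (0 : S2) by ring; apply val_O.
  - replace (U * rpow U n - U' * rpow U' n)
      with ((U - U') * rpow U n + U' * (rpow U n - rpow U' n)) by ring.
    apply val_add.
    + apply val_le with (k + n * 1)%nat; [lia|].
      apply val_mul; [easy|now apply val_pow].
    + apply val_le with (1 + (k + n - 1))%nat; [lia|now apply val_mul].
Qed.

Lemma mono_diff U V U' V' k a b :
  val 1 U -> val 1 U' -> val 1 V -> val 1 V' -> val k (U - U') -> val k (V - V') ->
  val (k + (a + b) - 1) (mono U V a b - mono U' V' a b).
Proof.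
  intros HU HU' HV HV' DU DV; unfold mono.
  replace (rpow U a * rpow V b - rpow U' a * rpow V' b)
    with ((rpow U a - rpow U' a) * rpow V b + rpow U' a * (rpow V b - rpow V' b)) by ring.
  apply val_add.
  - destruct a as [|a].
    + cbn [rpow]; replace ((1 - 1) * rpow V b : S2) with (0 : S2) by ring; apply val_O.
    + apply val_le with ((k + S a - 1) + b * 1)%nat; [lia|].
      apply val_mul; [now apply pow_diff|now apply val_pow].
  - destruct b as [|b].
    + cbn [rpow]; replace (rpow U' a * (1 - 1) : S2) with (0 : S2) by ring; apply val_O.
    + apply val_le with (a * 1 + (k + S b - 1))%nat; [lia|].
      apply val_mul; [now apply val_pow|now apply pow_diff].
Qed.

(** As g starts at degree two, each monomial keeps at least one more factor of order 1 next to the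
    difference: substitution gains one order. This is the contraction behind the stabilisation of
    the iterates. *)
Lemma comp_diff g U V U' V' k :
  val 1 U -> val 1 U' -> val 1 V -> val 1 V' -> val k (U - U') -> val k (V - V') ->
  (forall a b, (a + b < 2)%nat -> g a b = 0) ->
  val (S k) (comp g U V - comp g U' V').
Proof.
  intros HU HU' HV HV' DU DV Hg i j Hij.
  change (csum g U V (i + j) i j - csum g U' V' (i + j) i j = 0).
  rewrite !csum_coef.
  replace (sumr _ _) with
    (sumr (fun a => sumr (fun b => g a b * mono U' V' a b i j) (i + j)) (i + j)); [ring|].
  apply sumr_ext; intros a _; apply sumr_ext; intros b _.
  destruct (Nat.lt_ge_cases (a + b) 2).
  - rewrite Hg by easy; ring.
  - assert (E : mono U V a b i j - mono U' V' a b i j = 0).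
    { apply (@mono_diff U V U' V' k a b); auto; lia. }
    transitivity (g a b * (mono U' V' a b i j + (mono U V a b i j - mono U' V' a b i j)));
      [rewrite E; ring|ring].
Qed.

Lemma nsm_S2 n s i j : nsm n s i j = nsm n (s i j).
Proof.
  induction n as [|n IH]; [reflexivity|].
  change (s i j + nsm n s i j = s i j + nsm n (s i j)); now rewrite IH.
Qed.

Lemma inj_nsm n x : inj (nsm n x) = nsm n (inj x).
Proof.
  apply S2_ext; intros [|i] j; rewrite nsm_S2.
  - destruct j; [reflexivity|simpl; now rewrite nsm_O].
  - simpl; now rewrite nsm_O.
Qed.

(** * Chain rule for formal substitution *)

Lemma der_pow D s n : derivation D -> D (rpow s (S n)) = nsm (S n) (rpow s n) * D s.
Proof.
  intros HD.
  assert (D1 : D 1 = 0) by exact (der_inj HD 1).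
  induction n as [|n IH].
  - cbn [rpow nsm]; rewrite (der_mul HD), D1; ring.
  - change (rpow s (S (S n))) with (s * rpow s (S n)).
    rewrite (der_mul HD), IH.
    change (nsm (S (S n)) (rpow s (S n))) with (rpow s (S n) + nsm (S n) (s * rpow s n)).
    rewrite nsm_mulr; ring.
Qed.

Lemma der_sumr D (F : nat -> S2) n : derivation D ->
  D (sumr F n) = sumr (fun k => D (F k)) n.
Proof.
  intros HD; induction n as [|n IH]; [reflexivity|].
  cbn [sumr]; rewrite (der_add HD), IH; reflexivity.
Qed.

Definition gp (g : nat -> nat -> A) a b : A := nsm (S a) (g (S a) b).
Definition gq (g : nat -> nat -> A) a b : A := nsm (S b) (g a (S b)).

Lemma sumr_swap (F : nat -> nat -> S2) m n :
  sumr (fun a => sumr (fun b => F a b) n) m = sumr (fun b => sumr (fun a => F a b) m) n.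
Proof.
  induction m as [|m IH]; [reflexivity|].
  cbn [sumr]; rewrite IH, <- sumr_add; reflexivity.
Qed.

(** Differentiating the square truncation shifts an exponent by one, so the two sides differ only by
    the boundary terms a = n and b = n, which have order at least n. *)
Lemma der_csum D g U V n : derivation D -> val 1 U -> val 1 V ->
  val n (D (csum g U V n) - (csum (gp g) U V n * D U + csum (gq g) U V n * D V)).
Proof.
  intros HD HU HV.
  set (h1 := fun a b => inj (g a b) * (D (rpow U a) * rpow V b)).
  set (h2 := fun a b => inj (g a b) * (rpow U a * D (rpow V b))).
  set (k1 := fun a b => inj (gp g a b) * mono U V a b * D U).
  set (k2 := fun a b => inj (gq g a b) * mono U V a b * D V).
  assert (E : D (csum g U V n) =
    sumr (fun b => sumr (fun a => h1 a b) n) n + sumr (fun a => sumr (fun b => h2 a b) n) n).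
  { rewrite <- sumr_swap, <- sumr_add.
    unfold csum; rewrite der_sumr by easy; apply sumr_ext; intros a _.
    rewrite <- sumr_add, der_sumr by easy; apply sumr_ext; intros b _.
    unfold mono, h1, h2; rewrite !(der_mul HD), (der_inj HD); ring. }
  assert (D1 : D 1 = 0) by exact (der_inj HD 1).
  assert (E1 : csum (gp g) U V n * D U = sumr (fun b => sumr (fun a => k1 a b) n) n).
  { rewrite <- sumr_swap; unfold csum; rewrite <- sumr_mulr.
    apply sumr_ext; intros a _; rewrite <- sumr_mulr; reflexivity. }
  assert (E2 : csum (gq g) U V n * D V = sumr (fun a => sumr (fun b => k2 a b) n) n).
  { unfold csum; rewrite <- sumr_mulr.
    apply sumr_ext; intros a _; rewrite <- sumr_mulr; reflexivity. }
  rewrite E, E1, E2.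
  assert (F1 : sumr (fun b => sumr (fun a => h1 a b) n) n =
    sumr (fun b => sumr (fun a => k1 a b) n) n + sumr (fun b => - k1 n b) n).
  { rewrite <- sumr_add; apply sumr_ext; intros b _.
    rewrite (@sumr_shift S2 (fun a => h1 a b) (fun a => k1 a b)); [ring| |].
    - unfold h1; cbn [rpow]; rewrite D1; ring.
    - intros a; unfold h1, k1, mono, gp; rewrite der_pow by easy.
      rewrite inj_nsm.
      transitivity (inj (g (S a) b) * nsm (S a) (rpow U a) * (rpow V b * D U)); [ring|].
      rewrite <- nsm_mulr.
      replace (nsm (S a) (inj (g (S a) b) * rpow U a))
        with (nsm (S a) (inj (g (S a) b)) * rpow U a); [ring|].
      replace (inj (g (S a) b) * rpow U a) with (rpow U a * inj (g (S a) b)) by ring.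
      rewrite nsm_mulr; ring. }
  assert (F2 : sumr (fun a => sumr (fun b => h2 a b) n) n =
    sumr (fun a => sumr (fun b => k2 a b) n) n + sumr (fun a => - k2 a n) n).
  { rewrite <- sumr_add; apply sumr_ext; intros a _.
    rewrite (@sumr_shift S2 (fun b => h2 a b) (fun b => k2 a b)); [ring| |].
    - unfold h2; cbn [rpow]; rewrite D1; ring.
    - intros b; unfold h2, k2, mono, gq; rewrite der_pow by easy.
      rewrite inj_nsm.
      transitivity (inj (g a (S b)) * nsm (S b) (rpow V b) * (rpow U a * D V)); [ring|].
      rewrite <- nsm_mulr.
      replace (nsm (S b) (inj (g a (S b)) * rpow V b))
        with (nsm (S b) (inj (g a (S b))) * rpow V b); [ring|].
      replace (inj (g a (S b)) * rpow V b) with (rpow V b * inj (g a (S b))) by ring.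
      rewrite nsm_mulr; ring. }
  rewrite F1, F2.
  replace (_ - _) with (sumr (fun b => - k1 n b) n + sumr (fun a => - k2 a n) n) by ring.
  apply val_add; apply val_sumr; intros m _; apply val_opp.
  - unfold k1; replace (inj (gp g n m) * mono U V n m * D U)
      with (inj (gp g n m) * D U * mono U V n m) by ring.
    apply val_mulr, val_le with (n + m)%nat; [lia|now apply val_mono].
  - unfold k2; replace (inj (gq g m n) * mono U V m n * D V)
      with (inj (gq g m n) * D V * mono U V m n) by ring.
    apply val_mulr, val_le with (m + n)%nat; [lia|now apply val_mono].
Qed.

(** Modulo order n all three compositions may be replaced by their truncations: D lowers the order
    by at most one, which keeps the truncation error under control, and n is arbitrary. *)
Lemma chain_rule D g U V : derivation D ->
  (forall k s, val (S k) s -> val k (D s)) -> val 1 U -> val 1 V ->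
  D (comp g U V) = comp (gp g) U V * D U + comp (gq g) U V * D V.
Proof.
  intros HD Hv HU HV; apply val_eq; intros n.
  assert (Dsub : forall s s', D (s - s') = D s - D s').
  { intros; replace (s - s') with (s + - s') by ring.
    rewrite (der_add HD), (der_opp HD); ring. }
  replace (_ - _) with
    ((D (csum g U V n) - (csum (gp g) U V n * D U + csum (gq g) U V n * D V))
     - D (csum g U V n - comp g U V)
     + (D U * (csum (gp g) U V n - comp (gp g) U V)
     + D V * (csum (gq g) U V n - comp (gq g) U V)))
    by (rewrite Dsub; ring).
  assert (Hc : forall h, val (S n) (csum h U V n - comp h U V)) by (intros; now apply csum_comp).
  apply val_add; [apply val_sub|apply val_add].
  - now apply der_csum.
  - apply Hv, Hc.
  - apply val_mulr, val_le with (S n); [lia|apply Hc].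
  - apply val_mulr, val_le with (S n); [lia|apply Hc].
Qed.
End TwoVariables.

(** * Evaluation of geometrically bounded series *)

Declare Scope cx_scope.
Delimit Scope cx_scope with cx.
Infix "+" := Cplus : cx_scope.
Infix "*" := Cmult : cx_scope.
Infix "-" := Cminus : cx_scope.
Notation "- x" := (Copp x) : cx_scope.

Lemma Cx_theory : ring_theory C0 C1 Cplus Cmult Cminus Copp eq.
Proof.
  constructor; intros; repeat match goal with x : Cx |- _ => destruct x end;
    unfold Cminus, Cplus, Cmult, Copp, C0, C1; simpl; try reflexivity; f_equal; ring.
Qed.

Definition Cr : cring := CRing Cx_theory.
Add Ring Cxring : Cx_theory.

Lemma Cx_ext (x y : Cx) : fst x = fst y -> snd x = snd y -> x = y.
Proof. destruct x, y; simpl; congruence. Qed.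

Lemma Cmod_ge0 x : 0 <= Cmod x.
Proof. exact (Complex.Cmod_ge_0 x). Qed.

Lemma Cmod_triangle x y : Cmod (x + y)%cx <= Cmod x + Cmod y.
Proof. exact (Complex.Cmod_triangle x y). Qed.

Lemma Cmod_mult x y : Cmod (x * y)%cx = Cmod x * Cmod y.
Proof. exact (Complex.Cmod_mult x y). Qed.

Lemma Cmod_opp x : Cmod (- x)%cx = Cmod x.
Proof. exact (Complex.Cmod_opp x). Qed.

Lemma Cmod_sub x y : Cmod (x - y)%cx <= Cmod x + Cmod y.
Proof. unfold Cminus; rewrite <- (Cmod_opp y); apply Cmod_triangle. Qed.

Lemma Cmod_RtoC x : Cmod (RtoC x) = Rabs x.
Proof. exact (Complex.Cmod_R x). Qed.

Lemma Cmod_C0 : Cmod C0 = 0.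
Proof. exact Complex.Cmod_0. Qed.

Lemma Cmod_C1 : Cmod C1 = 1.
Proof. exact Complex.Cmod_1. Qed.

Lemma Cmod_eq0 x : Cmod x = 0 -> x = C0.
Proof. exact (Complex.Cmod_eq_0 x). Qed.

Lemma Cmod_fst x : Rabs (fst x) <= Cmod x.
Proof. eapply Rle_trans; [apply Rmax_l|exact (Complex.Rmax_Cmod x)]. Qed.

Lemma Cmod_snd x : Rabs (snd x) <= Cmod x.
Proof. eapply Rle_trans; [apply Rmax_r|exact (Complex.Rmax_Cmod x)]. Qed.

Lemma Cmod_le_sum x : Cmod x <= Rabs (fst x) + Rabs (snd x).
Proof.
  destruct x as [a b].
  replace (a, b) with ((a, 0) + (0, b))%cx
    by (unfold Cplus; simpl; f_equal; ring).
  eapply Rle_trans; [apply Cmod_triangle|].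
  unfold Cmod; simpl.
  replace (a * (a * 1) + 0 * (0 * 1)) with (Rsqr a) by (unfold Rsqr; ring).
  replace (0 * (0 * 1) + b * (b * 1)) with (Rsqr b) by (unfold Rsqr; ring).
  rewrite !sqrt_Rsqr_abs; unfold Cplus; simpl; rewrite !Rplus_0_r, !Rplus_0_l; lra.
Qed.

Lemma Cmod_pow z n : Cmod (Cpow z n) = Cmod z ^ n.
Proof.
  induction n as [|n IH]; [exact Cmod_C1|].
  cbn [Cpow pow]; now rewrite Cmod_mult, IH.
Qed.

Lemma Csub0 x y : (x - y)%cx = C0 -> x = y.
Proof. intros H; transitivity (x - y + y)%cx; [ring|rewrite H; ring]. Qed.

Lemma nsm_Cx n (x : Cr) : nsm n x = (RtoC (INR n) * x)%cx.
Proof.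
  induction n as [|n IH].
  - apply Cx_ext; simpl; ring.
  - cbn [nsm]; rewrite IH, S_INR; apply Cx_ext; simpl; ring.
Qed.

(** Absorbs the factor n + 1 created by a derivative or a Cauchy product into a doubling of the
    growth rate; this is the source of the [2 * K] in the rules for products and derivatives. *)
Lemma INR_le_pow2 n : INR (S n) <= 2 ^ n.
Proof.
  induction n as [|n IH]; [simpl; lra|].
  rewrite S_INR; cbn [pow].
  assert (1 <= 2 ^ n) by (apply pow_R1_Rle; lra); lra.
Qed.

Lemma le_eps (x y : R) : (forall e, 0 < e -> x <= y + e) -> x <= y.
Proof.
  intros H; destruct (Rle_dec x y) as [|N]; [easy|].
  specialize (H ((x - y) / 2)); lra.
Qed.

Lemma small_pow (B : R) e : 0 < e -> exists N, B * (1 / 2) ^ N <= e.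
Proof.
  intros He.
  destruct (pow_lt_1_zero (1 / 2)) with (y := e / (Rabs B + 1)) as [N HN].
  - rewrite Rabs_pos_eq; lra.
  - apply Rdiv_lt_0_compat; [lra|]; pose proof (Rabs_pos B); lra.
  - exists N; specialize (HN N (le_n N)).
    pose proof (Rabs_pos B); pose proof (Rle_abs B).
    assert (0 <= (1 / 2) ^ N) by (apply pow_le; lra).
    rewrite Rabs_pos_eq in HN by easy.
    apply Rle_trans with ((Rabs B + 1) * (1 / 2) ^ N).
    + apply Rmult_le_compat_r; lra.
    + apply Rlt_le in HN.
      apply (Rmult_le_compat_l (Rabs B + 1)) in HN; [|lra].
      replace e with ((Rabs B + 1) * (e / (Rabs B + 1))) by (field; lra); exact HN.
Qed.

(** * Geometrically bounded coefficients in one variable *)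

Definition geo (K C : R) (c : nat -> Cx) : Prop := forall n, Cmod (c n) <= C * K ^ n.

Lemma geo_nonneg K C c : geo K C c -> 0 <= C.
Proof. intros H; specialize (H O); pose proof (Cmod_ge0 (c O)); simpl in H; lra. Qed.

Lemma geo_tl K C c : geo K C c -> geo K (C * K) (tl c).
Proof. intros H n; specialize (H (S n)); unfold tl; simpl in H; lra. Qed.

Lemma geo_le K K' C c : 0 <= K <= K' -> geo K C c -> geo K' C c.
Proof.
  intros HK H n; eapply Rle_trans; [apply H|].
  apply Rmult_le_compat_l; [now apply geo_nonneg in H|now apply pow_incr].
Qed.

Lemma geo_add K C D a b : geo K C a -> geo K D b ->
  geo K (C + D) (fun n => (a n + b n)%cx).
Proof.
  intros Ha Hb n; eapply Rle_trans; [apply Cmod_triangle|].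
  specialize (Ha n); specialize (Hb n); lra.
Qed.

Lemma geo_scal K C x a : geo K C a -> geo K (Cmod x * C) (fun n => (x * a n)%cx).
Proof.
  intros Ha n; rewrite Cmod_mult, Rmult_assoc.
  apply Rmult_le_compat_l; [apply Cmod_ge0|apply Ha].
Qed.

(** A coefficient of degree n has n + 1 terms. The size N is only required to be subadditive, so
    that it may also read off one entry of a row in the two-variable case. *)
Lemma cauchy_count (A : cring) (N : A -> R) (B : R)
  (HN : forall x y : A, N (x + y)%cr <= N x + N y) n : forall a b : nat -> A,
  (forall k l, (k + l)%nat = n -> N (a k * b l)%cr <= B) ->
  N (cauchy a b n) <= INR (S n) * B.
Proof.
  induction n as [|n IH]; intros a b H.
  - rewrite Rmult_1_l; now apply H.
  - change (N (a O * b (S n) + cauchy (tl a) b n)%cr <= INR (S (S n)) * B).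
    eapply Rle_trans; [apply HN|].
    assert (H1 := H O (S n) eq_refl).
    assert (H2 := IH (tl a) b (fun k l E => H (S k) l (f_equal S E))).
    rewrite (S_INR (S n)); lra.
Qed.

Lemma cauchy_geo K C D n a b : 0 <= K -> geo K C a -> geo K D b ->
  Cmod (@cauchy Cr a b n) <= INR (S n) * (C * D * K ^ n).
Proof.
  intros HK Ha Hb; apply (@cauchy_count Cr Cmod); [apply Cmod_triangle|].
  intros k l <-; change (Cmod (a k * b l)%cx <= C * D * K ^ (k + l)).
  rewrite Cmod_mult, pow_add.
  replace (C * D * (K ^ k * K ^ l)) with (C * K ^ k * (D * K ^ l)) by ring.
  apply Rmult_le_compat; try apply Cmod_ge0; [apply Ha|apply Hb].
Qed.

Lemma geo_mul K C D a b : 0 <= K -> geo K C a -> geo K D b ->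
  geo (2 * K) (C * D) (@cauchy Cr a b).
Proof.
  intros HK Ha Hb n; eapply Rle_trans; [eapply cauchy_geo; eassumption|].
  rewrite Rpow_mult_distr.
  replace (C * D * (2 ^ n * K ^ n)) with (2 ^ n * (C * D * K ^ n)) by ring.
  apply Rmult_le_compat_r; [|apply INR_le_pow2].
  apply Rmult_le_pos; [apply Rmult_le_pos; eapply geo_nonneg; eassumption|now apply pow_le].
Qed.

Lemma geo_dps K C (c : ps Cr) : 0 <= K -> geo K C c -> geo (2 * K) (C * K) (dps c).
Proof.
  intros HK Hc n; unfold dps; rewrite nsm_Cx, Cmod_mult, Cmod_RtoC.
  rewrite Rabs_pos_eq by apply pos_INR.
  rewrite Rpow_mult_distr.
  specialize (Hc (S n)); cbn [pow] in Hc.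
  replace (C * K * (2 ^ n * K ^ n)) with (2 ^ n * (C * (K * K ^ n))) by ring.
  apply Rmult_le_compat; [apply pos_INR|apply Cmod_ge0|apply INR_le_pow2|exact Hc].
Qed.

(* [Series] is total; the value is meaningful only for convergent series, in practice under a
   bound [geo K C c] with K |z| <= 1/2. *)
Definition ev1 (c : nat -> Cx) (z : Cx) : Cx :=
  (Series (fun n => fst (c n * Cpow z n)%cx), Series (fun n => snd (c n * Cpow z n)%cx)).

Section Ev1.
Variables (K : R) (z : Cx).
Hypothesis HK : 0 <= K.
Hypothesis Hz : K * Cmod z <= 1 / 2.

Lemma geo_term C c n : geo K C c -> Cmod (c n * Cpow z n)%cx <= C * (1 / 2) ^ n.
Proof.
  intros H; rewrite Cmod_mult, Cmod_pow.
  apply Rle_trans with (C * K ^ n * Cmod z ^ n).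
  - apply Rmult_le_compat_r; [apply pow_le, Cmod_ge0|apply H].
  - rewrite Rmult_assoc, <- Rpow_mult_distr.
    apply Rmult_le_compat_l; [now apply geo_nonneg in H|].
    apply pow_incr; split; [|easy]; apply Rmult_le_pos; [easy|apply Cmod_ge0].
Qed.

Lemma is_series_half C : is_series (fun n => C * (1 / 2) ^ n) (C * 2).
Proof.
  replace (C * 2) with (C * / (1 - 1 / 2)) by field.
  apply (is_series_scal C (fun n => (1 / 2) ^ n)).
  apply is_series_geom; rewrite Rabs_pos_eq; lra.
Qed.

Lemma series_dom C (u : nat -> R) : (forall n, Rabs (u n) <= C * (1 / 2) ^ n) ->
  ex_series u /\ Rabs (Series u) <= 2 * C.
Proof.
  intros H.
  assert (E : ex_series (fun n => C * (1 / 2) ^ n)) by (eexists; apply is_series_half).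
  assert (EA : ex_series (fun n => Rabs (u n))).
  { apply (@ex_series_le R_AbsRing R_CompleteNormedModule) with (2 := E).
    intros n; change (Rabs (Rabs (u n)) <= C * (1 / 2) ^ n); now rewrite Rabs_Rabsolu. }
  split; [now apply ex_series_Rabs|].
  eapply Rle_trans; [now apply Series_Rabs|].
  replace (2 * C) with (Series (fun n => C * (1 / 2) ^ n))
    by (rewrite (is_series_unique _ _ (@is_series_half C)); ring).
  apply Series_le; [|easy]; intros n; split; [apply Rabs_pos|apply H].
Qed.

(** The factor 4 is the sum 2 of the geometric series of ratio 1/2, counted for the real and for the
    imaginary part. *)
Lemma ev1_series C c : geo K C c ->
  (ex_series (fun n => fst (c n * Cpow z n)%cx) /\
   ex_series (fun n => snd (c n * Cpow z n)%cx)) /\ Cmod (ev1 c z) <= 4 * C.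
Proof.
  intros H.
  destruct (@series_dom C (fun n => fst (c n * Cpow z n)%cx)) as [E1 B1].
  { intros n; eapply Rle_trans; [apply Cmod_fst|now apply geo_term]. }
  destruct (@series_dom C (fun n => snd (c n * Cpow z n)%cx)) as [E2 B2].
  { intros n; eapply Rle_trans; [apply Cmod_snd|now apply geo_term]. }
  split; [easy|].
  eapply Rle_trans; [apply Cmod_le_sum|]; unfold ev1; simpl in *; lra.
Qed.

Lemma ev1_bound C c : geo K C c -> Cmod (ev1 c z) <= 4 * C.
Proof. intros H; now apply ev1_series. Qed.

Lemma ev1_add C D a b : geo K C a -> geo K D b ->
  ev1 (fun n => a n + b n)%cx z = (ev1 a z + ev1 b z)%cx.
Proof.
  intros Ha Hb.
  destruct (ev1_series Ha) as [[A1 A2] _]; destruct (ev1_series Hb) as [[B1 B2] _].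
  apply Cx_ext; cbn [ev1 fst snd Cplus]; rewrite <- Series_plus by easy;
    apply Series_ext; intros n; simpl; ring.
Qed.

Lemma ev1_scal C x a : geo K C a -> ev1 (fun n => x * a n)%cx z = (x * ev1 a z)%cx.
Proof.
  intros Ha; destruct (ev1_series Ha) as [[A1 A2] _].
  apply Cx_ext; cbn [ev1 fst snd Cmult]; rewrite <- !Series_scal_l.
  - rewrite <- Series_minus by (apply (ex_series_scal (V := R_NormedModule)); easy).
    apply Series_ext; intros n; simpl; ring.
  - rewrite <- Series_plus by (apply (ex_series_scal (V := R_NormedModule)); easy).
    apply Series_ext; intros n; simpl; ring.
Qed.

(** Peeling off one coefficient is how products, remainders and limits of sums are treated later,
    instead of rearranging double series. *)
Lemma ev1_unfold C c : geo K C c -> ev1 c z = (c O + z * ev1 (tl c) z)%cx.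
Proof.
  intros H; destruct (ev1_series H) as [[A1 A2] _].
  rewrite <- (ev1_scal z (geo_tl H)).
  apply Cx_ext; cbn [ev1 fst snd Cplus]; rewrite Series_incr_1 by easy; f_equal;
    try (simpl; ring); apply Series_ext; intros n; unfold tl; simpl; ring.
Qed.

(* If shifting a sequence reproduces [Phi] up to the factor |z| and an error [C * A],
   iterating the shift removes the crude bound [C * B]. *)
Lemma shift_iteration (Phi : (nat -> Cx) -> R) A B :
  0 <= A -> 0 <= B ->
  (forall C c, geo K C c -> Phi c <= C * B) ->
  (forall C c, geo K C c -> Phi c <= Cmod z * Phi (tl c) + C * A) ->
  forall C c, geo K C c -> Phi c <= 2 * C * A.
Proof.
  intros HA HB HP Hr.
  assert (H : forall N C c, geo K C c -> Phi c <= 2 * C * A + C * B * (1 / 2) ^ N).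
  { assert (Hz0 := Cmod_ge0 z).
    induction N as [|N IH]; intros C c Hc;
      assert (HC := geo_nonneg Hc); assert (HCA : 0 <= C * A) by (now apply Rmult_le_pos).
    - specialize (HP C c Hc); simpl; lra.
    - specialize (Hr C c Hc); specialize (IH _ _ (geo_tl Hc)).
      apply (Rmult_le_compat_l _ _ _ Hz0) in IH.
      assert (0 <= C * B * (1 / 2) ^ N)
        by (apply Rmult_le_pos; [now apply Rmult_le_pos|apply pow_le; lra]).
      cbn [pow].
      replace (Cmod z * (2 * (C * K) * A + C * K * B * (1 / 2) ^ N))
        with (K * Cmod z * (2 * (C * A) + C * B * (1 / 2) ^ N)) in IH by ring.
      assert (K * Cmod z * (2 * (C * A) + C * B * (1 / 2) ^ N)
              <= 1 / 2 * (2 * (C * A) + C * B * (1 / 2) ^ N))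
        by (apply Rmult_le_compat_r; lra).
      lra. }
  intros C c Hc; apply le_eps; intros e He.
  destruct (small_pow (C * B) He) as [N HN].
  specialize (H N C c Hc); lra.
Qed.
End Ev1.

(** The defect of multiplicativity for [a] is z times the defect for its tail, with no error term,
    so [shift_iteration] applies with A = 0. The crude bound 20 C D is 4 C D for the value of the
    product plus 16 C D for the product of the values. *)
Lemma ev1_mul K z C D a b : 0 <= K -> 2 * K * Cmod z <= 1 / 2 ->
  geo K C a -> geo K D b ->
  ev1 (@cauchy Cr a b) z = (ev1 a z * ev1 b z)%cx.
Proof.
  intros HK Hz Ha Hb.
  assert (HD := geo_nonneg Hb); assert (Hz0 := Cmod_ge0 z).
  assert (Hz1 : K * Cmod z <= 1 / 2) by nra.
  assert (HK2 : 0 <= 2 * K) by lra.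
  assert (HKK : 0 <= K <= 2 * K) by lra.
  apply Csub0, Cmod_eq0, Rle_antisym; [|apply Cmod_ge0].
  replace 0 with (2 * C * 0) by ring.
  refine (@shift_iteration K z Hz1
    (fun a => Cmod (ev1 (@cauchy Cr a b) z - ev1 a z * ev1 b z)%cx) 0 (20 * D)
    (Rle_refl 0) _ _ _ C a Ha); [lra| |]; clear C a Ha; intros C a Ha.
  - eapply Rle_trans; [apply Cmod_sub|]; rewrite Cmod_mult.
    assert (H1 := ev1_bound HK2 Hz (geo_mul HK Ha Hb)).
    assert (H2 := ev1_bound HK Hz1 Ha); assert (H3 := ev1_bound HK Hz1 Hb).
    assert (Cmod (ev1 a z) * Cmod (ev1 b z) <= 4 * C * (4 * D))
      by (apply Rmult_le_compat; try apply Cmod_ge0; easy).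
    lra.
  - assert (E : ev1 (@cauchy Cr a b) z = (a O * ev1 b z + z * ev1 (@cauchy Cr (tl a) b) z)%cx).
    { rewrite (ev1_unfold HK2 Hz (geo_mul HK Ha Hb)), (ev1_unfold HK Hz1 Hb).
      change (tl (@cauchy Cr a b)) with (fun n => a O * tl b n + @cauchy Cr (tl a) b n)%cx.
      assert (Hb' := geo_scal (a O) (geo_le HKK (geo_tl Hb))).
      rewrite (ev1_add HK2 Hz Hb' (geo_mul HK (geo_tl Ha) Hb)).
      rewrite (ev1_scal HK Hz1 (a O) (geo_tl Hb)); simpl; ring. }
    rewrite E, (ev1_unfold HK Hz1 Ha), Rmult_0_r, Rplus_0_r, <- Cmod_mult.
    apply Req_le; f_equal; ring.
Qed.

(** With d = |z' - z|, the remainder for c is z' times the remainder for its tail plus (z' - z)^2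
    times the derivative of the tail, and this last term is at most 4 C K^2 d^2; [shift_iteration]
    sums these contributions. *)
Lemma ev1_diff K r z z' C c : 0 <= K -> 2 * K * r <= 1 / 2 ->
  Cmod z <= r -> Cmod z' <= r -> geo K C c ->
  Cmod (ev1 c z' - ev1 c z - (z' - z) * ev1 (@dps Cr c) z)%cx
    <= 8 * C * (K * K) * Cmod (z' - z)%cx ^ 2.
Proof.
  intros HK Hr Hz Hz' Hc.
  assert (Hz0 := Cmod_ge0 z); assert (Hz0' := Cmod_ge0 z').
  assert (HK2 : 0 <= 2 * K) by lra.
  assert (HKK : 0 <= K <= 2 * K) by lra.
  assert (H1 : K * Cmod z <= 1 / 2) by nra.
  assert (H1' : K * Cmod z' <= 1 / 2) by nra.
  assert (H2 : 2 * K * Cmod z <= 1 / 2) by nra.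
  set (d := Cmod (z' - z)%cx).
  assert (Hd : 0 <= d) by apply Cmod_ge0.
  replace (8 * C * (K * K) * d ^ 2) with (2 * C * (4 * (K * K) * d ^ 2)) by ring.
  assert (Hp : 0 <= 4 * (K * K) * d ^ 2) by (apply Rmult_le_pos; nra).
  refine (@shift_iteration K z' H1' (fun c : nat -> Cx =>
     Cmod (ev1 c z' - ev1 c z - (z' - z) * ev1 (@dps Cr c) z)%cx)
     _ (8 + 4 * (K * d)) Hp _ _ _ C c Hc); [nra| |]; clear C c Hc; intros C c Hc.
  - eapply Rle_trans; [apply Cmod_sub|]; rewrite Cmod_mult.
    assert (B1 := Cmod_sub (ev1 c z') (ev1 c z)).
    assert (B2 := ev1_bound HK H1 Hc); assert (B3 := ev1_bound HK H1' Hc).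
    assert (B4 := ev1_bound HK2 H2 (geo_dps HK Hc)).
    apply (Rmult_le_compat_l _ _ _ Hd) in B4; fold d; lra.
  (* Leibniz rule for c0 + z b, where b is the tail: its derivative is b + z b'. *)
  - assert (E : ev1 (@dps Cr c) z = (ev1 (tl c) z + z * ev1 (@dps Cr (tl c)) z)%cx).
    { rewrite (ev1_unfold HK2 H2 (geo_dps HK Hc)).
      rewrite (ev1_unfold HK H1 (geo_tl Hc)).
      assert (G' := geo_le HKK (geo_tl (geo_tl Hc))).
      assert (E : ev1 (@tl Cx (@dps Cr c)) z = (ev1 (tl (tl c)) z + ev1 (@dps Cr (tl c)) z)%cx)
        by exact (ev1_add HK2 H2 G' (geo_dps HK (geo_tl Hc))).
      rewrite E.
      change (@dps Cr c O) with (c 1%nat + C0)%cx.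
      change (tl c O) with (c 1%nat). ring. }
    rewrite E.
    rewrite (ev1_unfold HK H1 Hc), (ev1_unfold HK H1' Hc).
    set (e := ev1 (tl c) z); set (e' := ev1 (tl c) z'); set (f := ev1 (@dps Cr (tl c)) z).
    replace (c O + z' * e' - (c O + z * e) - (z' - z) * (e + z * f))%cx
      with (z' * (e' - e - (z' - z) * f) + (z' - z) * (z' - z) * f)%cx by ring.
    eapply Rle_trans; [apply Cmod_triangle|]; rewrite !Cmod_mult; fold d.
    apply Rplus_le_compat_l.
    assert (B := ev1_bound HK2 H2 (geo_dps HK (geo_tl Hc))).
    replace (C * (4 * (K * K) * d ^ 2)) with (d * d * (4 * (C * K * K))) by ring.
    apply Rmult_le_compat_l; [nra|exact B].
Qed.

(** Dominated convergence by peeling: after N coefficients the rest is at most 4 C / 2^N. [Ev]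
    stands for an arbitrary filter; it is used for h tending to 0 with h <> 0 and t + h >= 0. *)
Lemma ev1_dominated K z (T : Type) (Ev : (T -> Prop) -> Prop) :
  (forall P Q : T -> Prop, Ev P -> Ev Q -> Ev (fun h => P h /\ Q h)) ->
  (forall P Q : T -> Prop, (forall h, P h -> Q h) -> Ev P -> Ev Q) ->
  0 <= K -> K * Cmod z <= 1 / 2 -> Cmod z <= 1 ->
  forall C (c : T -> nat -> Cx), Ev (fun h => geo K C (c h)) ->
  (forall n e, 0 < e -> Ev (fun h => Cmod (c h n) <= e)) ->
  forall e, 0 < e -> Ev (fun h => Cmod (ev1 (c h) z) <= e).
Proof.
  intros Hand Himp HK Hz Hz1.
  assert (Hz0 := Cmod_ge0 z).
  assert (H : forall N C (c : T -> nat -> Cx), Ev (fun h => geo K C (c h)) ->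
    (forall n e, 0 < e -> Ev (fun h => Cmod (c h n) <= e)) ->
    forall e, 0 < e -> Ev (fun h => Cmod (ev1 (c h) z) <= e + 4 * C * (1 / 2) ^ N)).
  { induction N as [|N IH]; intros C c Hc H0 e He.
    - apply Himp with (2 := Hc); intros h Hh.
      assert (B := ev1_bound HK Hz Hh); simpl; lra.
    - assert (Ht : Ev (fun h => geo K (C * K) (tl (c h))))
        by (apply Himp with (2 := Hc); intros; now apply geo_tl).
      assert (He2 : 0 < e / 2) by lra.
      apply Himp with (2 := Hand _ _ Hc (Hand _ _ (H0 O _ He2)
        (IH _ (fun h => tl (c h)) Ht (fun n => H0 (S n)) _ He2))).
      intros h [Hh [B0 B1]].
      rewrite (ev1_unfold HK Hz Hh).
      eapply Rle_trans; [apply Cmod_triangle|]; rewrite Cmod_mult.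
      apply (Rmult_le_compat_l _ _ _ Hz0) in B1.
      assert (0 <= C * (1 / 2) ^ N)
        by (apply Rmult_le_pos; [now apply geo_nonneg in Hh|apply pow_le; lra]).
      assert (Cmod z * (e / 2) <= 1 * (e / 2)) by (apply Rmult_le_compat_r; lra).
      assert (K * Cmod z * (4 * (C * (1 / 2) ^ N)) <= 1 / 2 * (4 * (C * (1 / 2) ^ N)))
        by (apply Rmult_le_compat_r; lra).
      cbn [pow]; lra. }
  intros C c Hc H0 e He.
  destruct (@small_pow (4 * C) (e / 2)) as [N HN]; [lra|].
  apply Himp with (2 := H N C c Hc H0 (e / 2) ltac:(lra)); intros; lra.
Qed.

(** * Evaluation in two variables *)

Definition geo2 (K C : R) (a : nat -> nat -> Cx) : Prop := forall i, geo K (C * K ^ i) (a i).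

Definition ev2 (a : nat -> nat -> Cx) (p q : Cx) : Cx := ev1 (fun i => ev1 (a i) q) p.

Section Geo2.
Variable K : R.
Hypothesis HK : 0 <= K.
Implicit Types a b : S2 Cr.

Lemma geo2_nonneg C a : geo2 K C a -> 0 <= C.
Proof. intros H; specialize (geo_nonneg (H O)); simpl; lra. Qed.

Lemma geo2_le K' C a : K <= K' -> geo2 K C a -> geo2 K' C a.
Proof.
  intros HK' H i j.
  apply Rle_trans with (C * K ^ i * K ^ j); [apply H|].
  rewrite !Rmult_assoc; apply Rmult_le_compat_l; [now apply geo2_nonneg in H|].
  apply Rmult_le_compat; try (now apply pow_le); now apply pow_incr.
Qed.

Lemma geo2_leC C C' a : C <= C' -> geo2 K C a -> geo2 K C' a.
Proof.
  intros HC H i j; eapply Rle_trans; [apply H|].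
  rewrite !Rmult_assoc; apply Rmult_le_compat_r; [|easy].
  apply Rmult_le_pos; now apply pow_le.
Qed.

Lemma geo2_add C D a b : geo2 K C a -> geo2 K D b -> geo2 K (C + D) (a + b)%cr.
Proof. intros Ha Hb i; rewrite Rmult_plus_distr_r; apply (geo_add (Ha i) (Hb i)). Qed.

Lemma geo2_opp C a : geo2 K C a -> geo2 K C (- a)%cr.
Proof.
  intros Ha i j; change (Cmod (- a i j)%cx <= C * K ^ i * K ^ j).
  rewrite Cmod_opp; apply Ha.
Qed.

Lemma geo2_sub C D a b : geo2 K C a -> geo2 K D b -> geo2 K (C + D) (a - b)%cr.
Proof.
  intros Ha Hb i j; change (Cmod (a i j - b i j)%cx <= (C + D) * K ^ i * K ^ j).
  eapply Rle_trans; [apply Cmod_sub|]; specialize (Ha i j); specialize (Hb i j); lra.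
Qed.

Lemma geo2_mul C D a b : geo2 K C a -> geo2 K D b -> geo2 (2 * K) (C * D) (a * b)%cr.
Proof.
  intros Ha Hb i j.
  assert (HC := geo2_nonneg Ha); assert (HD := geo2_nonneg Hb).
  apply Rle_trans with (INR (S i) * (C * D * K ^ i * (2 * K) ^ j)).
  - apply (@cauchy_count (ps Cr) (fun x => Cmod (x j))).
    + intros x y; apply Cmod_triangle.
    + intros k l <-; rewrite pow_add.
      replace (C * D * (K ^ k * K ^ l) * (2 * K) ^ j)
        with (C * K ^ k * (D * K ^ l) * (2 * K) ^ j) by ring.
      now apply geo_mul.
  - rewrite (Rpow_mult_distr 2 K i).
    replace (C * D * (2 ^ i * K ^ i) * (2 * K) ^ j)
      with (2 ^ i * (C * D * K ^ i * (2 * K) ^ j)) by ring.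
    apply Rmult_le_compat_r; [|apply INR_le_pow2].
    repeat apply Rmult_le_pos; try apply pow_le; lra.
Qed.

Lemma geo2_dp C a : geo2 K C a -> geo2 (2 * K) (C * K) (dp a).
Proof.
  intros Ha i j; rewrite dp_coef, nsm_Cx, Cmod_mult, Cmod_RtoC.
  assert (HC := geo2_nonneg Ha).
  rewrite Rabs_pos_eq by apply pos_INR.
  specialize (Ha (S i) j); cbn [pow] in Ha.
  apply Rle_trans with (2 ^ i * (C * (K * K ^ i) * K ^ j)).
  - apply Rmult_le_compat; [apply pos_INR|apply Cmod_ge0|apply INR_le_pow2|exact Ha].
  - rewrite (Rpow_mult_distr 2 K i).
    replace (C * K * (2 ^ i * K ^ i) * (2 * K) ^ j)
      with (2 ^ i * (C * (K * K ^ i) * (2 * K) ^ j)) by ring.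
    apply Rmult_le_compat_l; [apply pow_le; lra|].
    apply Rmult_le_compat_l; [repeat apply Rmult_le_pos; try apply pow_le; lra|].
    apply pow_incr; lra.
Qed.

Lemma geo2_dq C a : geo2 K C a -> geo2 (2 * K) (C * K) (dq a).
Proof.
  intros Ha i.
  assert (HC := geo2_nonneg Ha).
  intros j; eapply Rle_trans; [apply (geo_dps HK (Ha i))|].
  apply Rmult_le_compat_r; [apply pow_le; lra|].
  replace (C * K ^ i * K) with (C * K * K ^ i) by ring.
  apply Rmult_le_compat_l; [now apply Rmult_le_pos|apply pow_incr; lra].
Qed.

Section Ev2.
Variables p q : Cx.
Hypothesis Hp : K * Cmod p <= 1 / 2.
Hypothesis Hq : K * Cmod q <= 1 / 2.

Lemma geo_inner C a : geo2 K C a -> geo K (4 * C) (fun i => ev1 (a i) q).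
Proof.
  intros Ha i; rewrite Rmult_assoc; now apply (ev1_bound HK Hq).
Qed.

Lemma ev2_bound C a : geo2 K C a -> Cmod (ev2 a p q) <= 16 * C.
Proof.
  intros Ha; replace (16 * C) with (4 * (4 * C)) by ring.
  now apply (ev1_bound HK Hp), geo_inner.
Qed.

Lemma ev2_add C D a b : geo2 K C a -> geo2 K D b ->
  ev2 (a + b)%cr p q = (ev2 a p q + ev2 b p q)%cx.
Proof.
  intros Ha Hb; unfold ev2.
  rewrite <- (ev1_add HK Hp (geo_inner Ha) (geo_inner Hb)); f_equal.
  apply functional_extensionality; intros i; apply (ev1_add HK Hq (Ha i) (Hb i)).
Qed.

Lemma ev2_scal C x a : geo2 K C a ->
  ev2 (fun i j => x * a i j)%cx p q = (x * ev2 a p q)%cx.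
Proof.
  intros Ha; unfold ev2.
  rewrite <- (ev1_scal HK Hp x (geo_inner Ha)); f_equal.
  apply functional_extensionality; intros i; apply (ev1_scal HK Hq x (Ha i)).
Qed.

Lemma ev2_opp C a : geo2 K C a -> ev2 (- a)%cr p q = (- ev2 a p q)%cx.
Proof.
  intros Ha; replace (- a)%cr with (fun i j => (- C1) * a i j)%cx.
  - rewrite (ev2_scal _ Ha); ring.
  - apply (@S2_ext Cr); intros i j; change ((- C1) * a i j = - a i j)%cx; ring.
Qed.

Lemma ev2_sub C D a b : geo2 K C a -> geo2 K D b ->
  ev2 (a - b)%cr p q = (ev2 a p q - ev2 b p q)%cx.
Proof.
  intros Ha Hb; replace (a - b)%cr with (a + - b)%cr.
  - rewrite (ev2_add Ha (geo2_opp Hb)), (ev2_opp Hb); ring.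
  - apply (@S2_ext Cr); intros i j; change (a i j + - b i j = a i j - b i j)%cx; ring.
Qed.
End Ev2.

Lemma ev2_mul p q C D a b : 2 * K * Cmod p <= 1 / 2 -> 2 * K * Cmod q <= 1 / 2 ->
  geo2 K C a -> geo2 K D b -> ev2 (a * b)%cr p q = (ev2 a p q * ev2 b p q)%cx.
Proof.
  intros Hp Hq Ha Hb.
  assert (Hq1 : K * Cmod q <= 1 / 2) by (pose proof (Cmod_ge0 q); nra).
  assert (HK2 : 0 <= 2 * K) by lra.
  unfold ev2.
  rewrite <- (ev1_mul HK Hp (geo_inner Hq1 Ha) (geo_inner Hq1 Hb)); f_equal.
  apply functional_extensionality; intros i.
  (* Evaluation is known to be additive only on bounded rows, so the induction carries a bound along
     with the value. *)
  refine (proj2 (@cauchy_ind3 (ps Cr) Cr Cr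
    (fun x y _ => (exists E, geo (2 * K) E x) /\ ev1 x q = y) _ i a b
    (fun i => ev1 (a i) q) (fun i => ev1 (b i) q)
    (fun i => ev1 (a i) q) (fun i => ev1 (b i) q) _)).
  - intros x x' y y' _ _ [[E HE] <-] [[E' HE'] <-]; split.
    + exists (E + E'); now apply geo_add.
    + apply (ev1_add HK2 Hq HE HE').
  - intros k l _; split.
    + eexists; now apply geo_mul.
    + now apply (ev1_mul HK Hq (Ha k) (Hb l)).
Qed.
End Geo2.

Lemma ev2_dp K p q C (a : S2 Cr) : 0 <= K ->
  K * Cmod q <= 1 / 2 -> geo2 K C a ->
  ev2 (dp a) p q = ev1 (@dps Cr (fun i => ev1 (a i) q)) p.
Proof.
  intros HK Hq Ha; unfold ev2; f_equal.
  apply functional_extensionality; intros i.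
  unfold dps; rewrite nsm_Cx.
  rewrite <- (ev1_scal HK Hq (RtoC (INR (S i))) (Ha (S i))); f_equal.
  apply functional_extensionality; intros j; now rewrite dp_coef, nsm_Cx.
Qed.

(** The one-variable remainder estimate is applied to each row in q; its bound scales with K^i, so
    the rows can be summed in p. *)
Lemma ev2_diff_q K r p q q' C (a : S2 Cr) : 0 <= K -> 2 * K * r <= 1 / 2 ->
  Cmod p <= r -> Cmod q <= r -> Cmod q' <= r -> geo2 K C a ->
  Cmod (ev2 a p q' - ev2 a p q - (q' - q) * ev2 (dq a) p q)%cx
    <= 32 * C * (K * K) * Cmod (q' - q)%cx ^ 2.
Proof.
  intros HK Hr Hp Hq Hq' Ha.
  assert (HK2 : 0 <= 2 * K) by lra.
  assert (Hz : forall z, Cmod z <= r -> 2 * K * Cmod z <= 1 / 2).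
  { intros z Hz; pose proof (Cmod_ge0 z); nra. }
  assert (Hz1 : forall z, Cmod z <= r -> K * Cmod z <= 1 / 2).
  { intros z H; pose proof (Cmod_ge0 z); specialize (Hz z H); nra. }
  assert (HKK : K <= 2 * K) by lra.
  assert (Hdq := geo2_dq HK Ha); assert (Ha2 := geo2_le HK HKK Ha).
  set (b := (fun i => (ev1 (a i) q' - ev1 (a i) q) - (q' - q) * ev1 (dq a i) q)%cx).
  assert (G1 := geo_inner HK (Hz1 _ Hq') Ha); assert (G2 := geo_inner HK (Hz1 _ Hq) Ha).
  assert (G3 := geo_inner HK2 (Hz _ Hq) Hdq).
  assert (E : ev1 b p = (ev2 a p q' - ev2 a p q - (q' - q) * ev2 (dq a) p q)%cx).
  { unfold ev2.
    assert (G1' := geo_inner HK2 (Hz _ Hq') Ha2); assert (G2' := geo_inner HK2 (Hz _ Hq) Ha2).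
    transitivity (ev1 (fun i => (ev1 (a i) q' + (- C1) * ev1 (a i) q)
                       + (- (q' - q)) * ev1 (dq a i) q)%cx p).
    - f_equal; apply functional_extensionality; intros i; unfold b; ring.
    - rewrite (ev1_add HK2 (Hz _ Hp) (geo_add G1' (geo_scal (- C1)%cx G2')) (geo_scal (- (q' - q))%cx G3)).
      rewrite (ev1_add HK2 (Hz _ Hp) G1' (geo_scal (- C1)%cx G2')).
      rewrite (ev1_scal HK2 (Hz _ Hp) _ G2'), (ev1_scal HK2 (Hz _ Hp) _ G3); ring. }
  rewrite <- E.
  replace (32 * C * (K * K) * Cmod (q' - q)%cx ^ 2)
    with (4 * (8 * C * (K * K) * Cmod (q' - q)%cx ^ 2)) by ring.
  apply (ev1_bound HK (Hz1 _ Hp)); intros i.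
  replace (8 * C * (K * K) * Cmod (q' - q)%cx ^ 2 * K ^ i)
    with (8 * (C * K ^ i) * (K * K) * Cmod (q' - q)%cx ^ 2) by ring.
  now apply (ev1_diff HK Hr Hq Hq' (Ha i)).
Qed.

(** The increment is split into a move in p at q', a move in q at p, and the change of the
    p-derivative between q and q'. B is chosen before the series, hence is uniform in time later
    on. *)
Lemma ev2_taylor K r C : 0 <= K -> 4 * K * r <= 1 / 2 -> 0 <= C -> exists B, 0 <= B /\
  forall (a : S2 Cr) p q p' q', geo2 K C a ->
  Cmod p <= r -> Cmod q <= r -> Cmod p' <= r -> Cmod q' <= r ->
  Cmod (ev2 a p' q' - ev2 a p q - ((p' - p) * ev2 (dp a) p q + (q' - q) * ev2 (dq a) p q))%cx
    <= B * (Cmod (p' - p)%cx + Cmod (q' - q)%cx) ^ 2.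
Proof.
  intros HK Hr HC.
  (* A Lipschitz constant of [dp a] in q: the quadratic remainder with |q' - q| <= 2 |r|, plus the
     bound for the mixed second derivative. *)
  set (B3 := 32 * (C * K) * (2 * K * (2 * K)) * (2 * Rabs r) + 16 * (C * K * (2 * K))).
  assert (HKK : 0 <= K * K) by nra.
  assert (HCK : 0 <= C * (K * K)) by nra.
  assert (HB3 : 0 <= B3).
  { unfold B3; pose proof (Rabs_pos r).
    apply Rplus_le_le_0_compat; repeat apply Rmult_le_pos; lra. }
  exists (32 * C * (K * K) + 32 * C * (K * K) + B3); split; [lra|].
  intros a p q p' q' Ha Hp Hq Hp' Hq'.
  assert (Hr2 : 2 * K * r <= 1 / 2) by (pose proof (Cmod_ge0 p); nra).
  assert (Hz : forall z, Cmod z <= r -> 2 * K * Cmod z <= 1 / 2).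
  { intros z Hz; pose proof (Cmod_ge0 z); nra. }
  assert (Hz1 : forall z, Cmod z <= r -> K * Cmod z <= 1 / 2).
  { intros z H; pose proof (Cmod_ge0 z); specialize (Hz z H); nra. }
  assert (Hz4 : forall z, Cmod z <= r -> 2 * (2 * K) * Cmod z <= 1 / 2).
  { intros z H; pose proof (Cmod_ge0 z); nra. }
  set (x := Cmod (p' - p)%cx); set (y := Cmod (q' - q)%cx).
  assert (Hx : 0 <= x) by apply Cmod_ge0; assert (Hy : 0 <= y) by apply Cmod_ge0.
  assert (T1 : Cmod (ev2 a p' q' - ev2 a p q' - (p' - p) * ev2 (dp a) p q')%cx
               <= 32 * C * (K * K) * x ^ 2).
  { rewrite (ev2_dp p HK (Hz1 _ Hq') Ha).
    replace (32 * C * (K * K) * x ^ 2) with (8 * (4 * C) * (K * K) * x ^ 2) by ring.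
    apply (ev1_diff HK Hr2 Hp Hp'), (geo_inner HK (Hz1 _ Hq') Ha). }
  assert (T2 := ev2_diff_q HK Hr2 Hp Hq Hq' Ha); fold y in T2.
  assert (T3 : Cmod (ev2 (dp a) p q' - ev2 (dp a) p q)%cx <= B3 * y).
  { assert (HK2 : 0 <= 2 * K) by lra.
    assert (Hr4 : 2 * (2 * K) * r <= 1 / 2) by lra.
    assert (Hb := geo2_dp HK Ha).
    assert (S1 := ev2_diff_q HK2 Hr4 Hp Hq Hq' Hb); fold y in S1.
    assert (HK4 : 0 <= 2 * (2 * K)) by lra.
    assert (S2 := ev2_bound HK4 (Hz4 _ Hp) (Hz4 _ Hq) (geo2_dq HK2 Hb)).
    replace (ev2 (dp a) p q' - ev2 (dp a) p q)%cx
      with ((ev2 (dp a) p q' - ev2 (dp a) p q - (q' - q) * ev2 (dq (dp a)) p q)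
            + (q' - q) * ev2 (dq (dp a)) p q)%cx by ring.
    eapply Rle_trans; [apply Cmod_triangle|]; rewrite (Cmod_mult (q' - q)%cx); fold y.
    apply (Rmult_le_compat_l _ _ _ Hy) in S2.
    assert (Hy2 : y <= 2 * Rabs r).
    { pose proof (Cmod_sub q' q); pose proof (Rle_abs r); fold y in H; lra. }
    assert (32 * (C * K) * (2 * K * (2 * K)) * y ^ 2
            <= 32 * (C * K) * (2 * K * (2 * K)) * (2 * Rabs r) * y).
    { replace (32 * (C * K) * (2 * K * (2 * K)) * y ^ 2)
        with (32 * (C * K) * (2 * K * (2 * K)) * y * y) by ring.
      apply Rmult_le_compat_r; [easy|].
      apply Rmult_le_compat_l; [repeat apply Rmult_le_pos; lra|easy]. }
    unfold B3; lra. }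
  replace (_ - _)%cx with
    ((ev2 a p' q' - ev2 a p q' - (p' - p) * ev2 (dp a) p q')
     + (ev2 a p q' - ev2 a p q - (q' - q) * ev2 (dq a) p q)
     + (p' - p) * (ev2 (dp a) p q' - ev2 (dp a) p q))%cx by ring.
  eapply Rle_trans; [apply Cmod_triangle|].
  eapply Rle_trans; [apply Rplus_le_compat_r, Cmod_triangle|].
  rewrite (Cmod_mult (p' - p)%cx); fold x.
  apply (Rmult_le_compat_l _ _ _ Hx) in T3.
  assert (0 <= x * y) by nra.
  assert (0 <= x * y * B3) by nra.
  assert (0 <= C * (K * K) * (x * y)) by nra.
  assert (0 <= B3 * x ^ 2) by (apply Rmult_le_pos; nra).
  assert (0 <= B3 * y ^ 2) by (apply Rmult_le_pos; nra).
  assert (0 <= C * (K * K) * x ^ 2) by (apply Rmult_le_pos; nra).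
  assert (0 <= C * (K * K) * y ^ 2) by (apply Rmult_le_pos; nra).
  replace ((32 * C * (K * K) + 32 * C * (K * K) + B3) * (x + y) ^ 2) with
    (64 * (C * (K * K) * x ^ 2) + 64 * (C * (K * K) * y ^ 2) + 128 * (C * (K * K) * (x * y))
     + (B3 * x ^ 2 + B3 * y ^ 2 + 2 * (x * y * B3))) by ring.
  lra.
Qed.

(** * Time-dependent coefficients *)

Lemma Fn_theory : @ring_theory (R -> Cx) (fun _ => C0) (fun _ => C1)
  (fun x y t => x t + y t)%cx (fun x y t => x t * y t)%cx
  (fun x y t => x t - y t)%cx (fun x t => - x t)%cx eq.
Proof. constructor; intros; apply functional_extensionality; intros t; ring. Qed.

(** Functions on the whole line, so that derivatives in t are two-sided; bounds are only asked for t
    >= 0. *)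
Definition Fn : cring := CRing Fn_theory.
Notation SS := (S2 Fn).

Definition at_t (s : SS) (t : R) : S2 Cr := fun i j => s i j t.

Lemma at_mul (a b : SS) t : at_t (a * b)%cr t = (at_t a t * at_t b t)%cr.
Proof.
  apply (@S2_ext Cr); intros i j.
  refine (@cauchy2_ind3 Fn Cr Cr (fun x y _ => x t = y) _ i j a b
    (at_t a t) (at_t b t) (at_t a t) (at_t b t) _).
  - intros x x' y y' _ _ <- <-; reflexivity.
  - reflexivity.
Qed.

Lemma nsm_Fn n (x : Fn) t : nsm n x t = (RtoC (INR n) * x t)%cx.
Proof.
  rewrite <- (@nsm_Cx n (x t)).
  induction n as [|n IH]; [reflexivity|].
  change (x t + nsm n x t = x t + @nsm Cr n (x t))%cx; now rewrite IH.
Qed.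

Lemma at_dp (a : SS) t : at_t (dp a) t = dp (at_t a t).
Proof.
  apply (@S2_ext Cr); intros i j; unfold at_t.
  now rewrite !dp_coef, nsm_Cx, nsm_Fn.
Qed.

Lemma at_dq (a : SS) t : at_t (dq a) t = dq (at_t a t).
Proof.
  apply (@S2_ext Cr); intros i j; unfold at_t.
  now rewrite !dq_coef, nsm_Cx, nsm_Fn.
Qed.

(** * Differentiation in time *)

Definition cder (x : R -> Cx) (t : R) (d : Cx) : Prop :=
  is_derive (fun s => fst (x s)) t (fst d) /\ is_derive (fun s => snd (x s)) t (snd d).

Lemma cder_add x y t d e : cder x t d -> cder y t e ->
  cder (fun s => x s + y s)%cx t (d + e)%cx.
Proof.
  intros [Hx1 Hx2] [Hy1 Hy2]; split.
  - apply (is_derive_plus _ _ _ _ _ Hx1 Hy1).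
  - apply (is_derive_plus _ _ _ _ _ Hx2 Hy2).
Qed.

Lemma cder_mul x y t d e : cder x t d -> cder y t e ->
  cder (fun s => x s * y s)%cx t (d * y t + x t * e)%cx.
Proof.
  intros [Hx1 Hx2] [Hy1 Hy2].
  assert (M : forall u v du dv, is_derive u t du -> is_derive v t dv ->
    is_derive (fun s => u s * v s) t (du * v t + u t * dv)).
  { intros u v du dv Hu Hv; exact (is_derive_mult u v t du dv Hu Hv). }
  split; simpl.
  - replace (_ + _) with (minus (fst d * fst (y t) + fst (x t) * fst e)
      (snd d * snd (y t) + snd (x t) * snd e)) by (unfold minus, plus, opp; simpl; ring).
    apply (is_derive_minus (V := R_NormedModule)); auto.
  - replace (_ + _) with (plus (fst d * snd (y t) + fst (x t) * snd e)
      (snd d * fst (y t) + snd (x t) * fst e)) by (unfold plus; simpl; ring).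
    apply (is_derive_plus (V := R_NormedModule)); auto.
Qed.

Lemma cder_const z t : cder (fun _ => z) t C0.
Proof. split; simpl; apply @is_derive_const. Qed.

Lemma cder_ext x t d d' : d = d' -> cder x t d -> cder x t d'.
Proof. now intros ->. Qed.

Lemma cder_cmul z x t d : cder x t d -> cder (fun s => z * x s)%cx t (z * d)%cx.
Proof.
  intros H; apply cder_ext with (C0 * x t + z * d)%cx; [ring|].
  apply cder_mul; [apply cder_const|easy].
Qed.

(** Both Psi - Phi and Psi + Phi are nondecreasing. With an explicit primitive Psi this replaces
    estimates of integrals. *)
Lemma dom_incr (Phi Psi phi psi : R -> R) a b : a <= b ->
  (forall s, a <= s <= b -> is_derive Phi s (phi s)) ->
  (forall s, a <= s <= b -> is_derive Psi s (psi s)) ->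
  (forall s, a <= s <= b -> Rabs (phi s) <= psi s) ->
  Rabs (Phi b - Phi a) <= Psi b - Psi a.
Proof.
  intros Hab HP HQ Hle.
  assert (M : forall h dh : R -> R, (forall s, a <= s <= b -> is_derive h s (dh s)) ->
    (forall s, a <= s <= b -> 0 <= dh s) -> h a <= h b).
  { intros h dh Hd Hpos.
    destruct (MVT_gen h a b dh) as [c [Hc E]].
    - intros s Hs; rewrite Rmin_left, Rmax_right in Hs by easy; apply Hd; lra.
    - intros s Hs; rewrite Rmin_left, Rmax_right in Hs by easy.
      apply derivable_continuous_pt; exists (dh s); apply is_derive_Reals, Hd; lra.
    - rewrite Rmin_left, Rmax_right in Hc by easy.
      assert (0 <= dh c * (b - a)) by (apply Rmult_le_pos; [now apply Hpos|lra]); lra. }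
  assert (Habs : forall s, a <= s <= b -> - psi s <= phi s <= psi s).
  { intros s Hs; apply Rabs_le_between, Hle, Hs. }
  assert (H1 := M (fun s => Psi s - Phi s) (fun s => psi s - phi s)
    (fun s Hs => is_derive_minus (V := R_NormedModule) _ _ _ _ _ (HQ s Hs) (HP s Hs))).
  assert (H2 := M (fun s => Psi s + Phi s) (fun s => psi s + phi s)
    (fun s Hs => is_derive_plus (V := R_NormedModule) _ _ _ _ _ (HQ s Hs) (HP s Hs))).
  apply Rabs_le_between; split.
  - assert (Psi a + Phi a <= Psi b + Phi b)
      by (apply H2; intros s Hs; specialize (Habs s Hs); lra); lra.
  - assert (Psi a - Phi a <= Psi b - Phi b)
      by (apply H1; intros s Hs; specialize (Habs s Hs); lra); lra.
Qed.

Lemma is_derive_lin c s : is_derive (fun x => c * x) s c.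
Proof. auto_derive; [easy|ring]. Qed.

Lemma cder_lipschitz (x d : R -> Cx) B a b :
  (forall s, Rmin a b <= s <= Rmax a b -> cder x s (d s) /\ Cmod (d s) <= B) ->
  Cmod (x b - x a)%cx <= 2 * B * Rabs (b - a).
Proof.
  assert (W : forall a b, a <= b ->
    (forall s, a <= s <= b -> cder x s (d s) /\ Cmod (d s) <= B) ->
    Cmod (x b - x a)%cx <= 2 * B * (b - a)).
  { clear a b; intros a b Hab H.
    eapply Rle_trans; [apply Cmod_le_sum|].
    replace (2 * B * (b - a)) with ((B * b - B * a) + (B * b - B * a)) by ring.
    apply Rplus_le_compat.
    - apply (@dom_incr (fun s => fst (x s)) (fun s => B * s) (fun s => fst (d s)) (fun _ => B));
        intros; try easy; [now apply H|apply is_derive_lin|].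
      eapply Rle_trans; [apply Cmod_fst|now apply H].
    - apply (@dom_incr (fun s => snd (x s)) (fun s => B * s) (fun s => snd (d s)) (fun _ => B));
        intros; try easy; [now apply H|apply is_derive_lin|].
      eapply Rle_trans; [apply Cmod_snd|now apply H]. }
  intros H; destruct (Rle_dec a b) as [L|L].
  - rewrite Rmin_left, Rmax_right in H by easy.
    rewrite Rabs_pos_eq by lra; now apply W.
  - rewrite Rmin_right, Rmax_left in H by lra.
    rewrite Rabs_left by lra.
    rewrite <- Cmod_opp; replace (- (x b - x a))%cx with (x a - x b)%cx by ring.
    replace (- (b - a)) with (a - b) by ring; apply W; [lra|easy].
Qed.

Lemma cder_quotient x t d : cder x t d -> forall e, 0 < e -> exists delta, 0 < delta /\
  forall h, h <> 0 -> Rabs h < delta ->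
  Cmod (RtoC (/ h) * (x (t + h)%R - x t) - d)%cx <= e.
Proof.
  intros [H1 H2] e He.
  apply is_derive_Reals in H1; apply is_derive_Reals in H2.
  destruct (H1 (e / 2)) as [d1 D1]; [lra|]; destruct (H2 (e / 2)) as [d2 D2]; [lra|].
  exists (Rmin d1 d2); split; [apply Rmin_glb_lt; [apply d1|apply d2]|].
  intros h Hh Hlt.
  specialize (D1 h Hh (Rlt_le_trans _ _ _ Hlt (Rmin_l _ _))).
  specialize (D2 h Hh (Rlt_le_trans _ _ _ Hlt (Rmin_r _ _))).
  eapply Rle_trans; [apply Cmod_le_sum|].
  set (u := (RtoC (/ h) * (x (t + h)%R - x t) - d)%cx).
  replace (fst u) with ((fst (x (t + h)) - fst (x t)) / h - fst d)
    by (unfold u, Cminus, Cmult, Cplus, Copp, RtoC; simpl; field; easy).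
  replace (snd u) with ((snd (x (t + h)) - snd (x t)) / h - snd d)
    by (unfold u, Cminus, Cmult, Cplus, Copp, RtoC; simpl; field; easy).
  lra.
Qed.

Definition gbound (K C : R) (s : SS) : Prop := forall t, 0 <= t -> geo2 K C (at_t s t).

(** Dominated convergence in both summations: the difference quotients tend to the coefficients of
    [b] one by one, and the mean value bound makes them geometrically bounded uniformly in h. *)
Lemma ev2_dt K C (a b : SS) p q t : 0 <= K -> K * Cmod p <= 1 / 2 -> K * Cmod q <= 1 / 2 ->
  Cmod p <= 1 -> Cmod q <= 1 -> gbound K C a -> gbound K C b ->
  (forall i j s, cder (a i j) s (b i j s)) -> 0 <= t ->
  forall e, 0 < e -> exists delta, 0 < delta /\
  forall h, 0 <= t + h -> Rabs h < delta ->
  Cmod (ev2 (at_t a (t + h)) p q - ev2 (at_t a t) p q - ev2 (at_t b t) p q * RtoC h)%cx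
    <= e * Rabs h.
Proof.
  intros HK Hp Hq Hp1 Hq1 Ha Hb Hd Ht e He.
  set (Ev := fun P : R -> Prop => exists delta, 0 < delta /\
     forall h, h <> 0 -> 0 <= t + h -> Rabs h < delta -> P h).
  assert (Eand : forall P Q : R -> Prop, Ev P -> Ev Q -> Ev (fun h => P h /\ Q h)).
  { intros P Q [d1 [H1 E1]] [d2 [H2 E2]]; exists (Rmin d1 d2); split.
    - now apply Rmin_glb_lt.
    - intros h Hh H0 Hlt; split; [apply E1|apply E2]; auto;
        (eapply Rlt_le_trans; [exact Hlt|]); [apply Rmin_l|apply Rmin_r]. }
  assert (Eimp : forall P Q : R -> Prop, (forall h, P h -> Q h) -> Ev P -> Ev Q).
  { intros P Q H [d1 [H1 E1]]; exists d1; split; auto. }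
  set (c := fun (h : R) i j => (RtoC (/ h) * (a i j (t + h)%R - a i j t) - b i j t)%cx).
  (* The 3 C is 2 C from the Lipschitz bound of the quotient plus C from [b]. *)
  assert (Hc : Ev (fun h => geo2 K (3 * C) (c h))).
  { exists 1; split; [lra|]; intros h Hh H0 _ i j.
    set (B := C * K ^ i * K ^ j).
    assert (L : Cmod (a i j (t + h)%R - a i j t)%cx <= 2 * B * Rabs (t + h - t)).
    { apply cder_lipschitz with (d := b i j); intros s Hs; split; [apply Hd|].
      apply Hb; eapply Rle_trans; [|apply Hs]; now apply Rmin_glb. }
    replace (t + h - t) with h in L by ring.
    unfold c; eapply Rle_trans; [apply Cmod_sub|].
    rewrite Cmod_mult, Cmod_RtoC, Rabs_inv.
    assert (Hb' : Cmod (b i j t) <= B) by (now apply Hb).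
    assert (0 < Rabs h) by (now apply Rabs_pos_lt).
    assert (/ Rabs h * Cmod (a i j (t + h)%R - a i j t)%cx <= / Rabs h * (2 * B * Rabs h)).
    { apply Rmult_le_compat_l; [apply Rlt_le; now apply Rinv_0_lt_compat|exact L]. }
    replace (/ Rabs h * (2 * B * Rabs h)) with (2 * B) in H1 by (field; lra).
    replace (3 * C * K ^ i * K ^ j) with (3 * B) by (unfold B; ring).
    lra. }
  assert (H0 : forall i j e, 0 < e -> Ev (fun h => Cmod (c h i j) <= e)).
  { intros i j e' He'; destruct (cder_quotient (Hd i j t) He') as [d1 [H1 E1]].
    exists d1; split; [easy|]; intros h Hh _ Hlt; now apply E1. }
  assert (H1 : forall i e, 0 < e -> Ev (fun h => Cmod (ev1 (c h i) q) <= e)).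
  { intros i; apply (ev1_dominated Eand Eimp HK Hq Hq1) with (C := 3 * C * K ^ i); [|apply H0].
    apply Eimp with (2 := Hc); intros h Hh; apply Hh. }
  assert (H2 : Ev (fun h => Cmod (ev2 (c h) p q) <= e)).
  { apply (ev1_dominated Eand Eimp HK Hp Hp1) with (C := 4 * (3 * C)); [|apply H1|easy].
    apply Eimp with (2 := Hc); intros h Hh; now apply (geo_inner HK Hq). }
  destruct H2 as [d1 [Hd1 E1]]; exists d1; split; [easy|]; intros h Hth Hlt.
  destruct (Req_dec h 0) as [->|Hh].
  - rewrite Rplus_0_r, Rabs_R0, Rmult_0_r.
    replace (_ - _)%cx with C0 by (change (RtoC 0) with C0; ring).
    rewrite Cmod_C0; lra.
  - specialize (E1 h Hh Hth Hlt).
    assert (E : ev2 (c h) p q = (RtoC (/ h) * (ev2 (at_t a (t + h)) p q - ev2 (at_t a t) p q)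
                                 - ev2 (at_t b t) p q)%cx).
    { assert (G1 := Ha _ Hth); assert (G2 := Ha _ Ht); assert (G3 := Hb _ Ht).
      rewrite <- (ev2_sub HK Hp Hq G1 G2), <- (ev2_scal HK Hp Hq (RtoC (/ h)) (geo2_sub G1 G2)).
      refine (ev2_sub HK Hp Hq (C := Cmod (RtoC (/ h)) * (C + C)) _ G3).
      intros i; rewrite Rmult_assoc; apply (geo_scal (RtoC (/ h)) (geo2_sub G1 G2 i)). }
    rewrite E in E1.
    replace (_ - _)%cx with (RtoC h * (RtoC (/ h) * (ev2 (at_t a (t + h)) p q - ev2 (at_t a t) p q)
                                 - ev2 (at_t b t) p q))%cx.
    + rewrite Cmod_mult, Cmod_RtoC, Rmult_comm.
      apply Rmult_le_compat_r; [apply Rabs_pos|exact E1].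
    + set (u := (ev2 (at_t a (t + h)) p q - ev2 (at_t a t) p q)%cx).
      assert (Eh : (RtoC h * RtoC (/ h))%cx = C1).
      { apply Cx_ext; simpl; [field; easy|ring]. }
      transitivity (RtoC h * RtoC (/ h) * u - ev2 (at_t b t) p q * RtoC h)%cx; [ring|].
      rewrite Eh; ring.
Qed.

(** * The scalar equation y' + lam y = g *)

Section Duhamel.
Variables (lam : R) (g : R -> R).
Hypothesis Hg : forall t, continuous g t.

Definition Gint (t : R) : R := RInt (fun s => exp (lam * s) * g s) 0 t.

(* For [lam <= 0] the integral is taken from infinity, otherwise from 0. *)
Definition duhamel (t : R) : R :=
  exp (- lam * t) *
  (Gint t - if Rlt_dec 0 lam then 0 else real (Lim_seq (fun n => Gint (INR n)))).

Lemma Gint_derive t : is_derive Gint t (exp (lam * t) * g t).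
Proof.
  assert (Hc : forall s, continuous (fun s => exp (lam * s) * g s) s).
  { intros s; apply (@continuous_mult R_UniformSpace R_AbsRing); [|apply Hg].
    apply (@ex_derive_continuous R_AbsRing R_NormedModule); auto_derive; easy. }
  apply (is_derive_RInt (fun s => exp (lam * s) * g s) Gint 0 t); [|apply Hc].
  apply (@filter_forall R); [apply locally_filter|]; intros b; apply (@RInt_correct R_CompleteNormedModule).
  apply (@ex_RInt_continuous R_CompleteNormedModule); intros; apply Hc.
Qed.

Lemma duhamel_derive t : is_derive duhamel t (g t - lam * duhamel t).
Proof.
  unfold duhamel; set (L := if Rlt_dec 0 lam then 0 else _).
  assert (HG := Gint_derive t).
  assert (HE : is_derive (fun s => exp (- lam * s)) t (- lam * exp (- lam * t))).
  { auto_derive; [easy|ring]. }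
  assert (HM : is_derive (fun s => Gint s - L) t (exp (lam * t) * g t)).
  { replace (exp (lam * t) * g t) with (minus (exp (lam * t) * g t) 0)
      by (unfold minus, plus, opp; simpl; ring).
    apply (is_derive_minus (V := R_NormedModule)); [exact HG|apply @is_derive_const]. }
  replace (g t - _) with (- lam * exp (- lam * t) * (Gint t - L)
    + exp (- lam * t) * (exp (lam * t) * g t)).
  - exact (is_derive_mult _ _ t _ _ HE HM).
  - transitivity (exp (- lam * t) * exp (lam * t) * g t
      - lam * (exp (- lam * t) * (Gint t - L))); [ring|].
    rewrite <- exp_plus; replace (- lam * t + lam * t) with 0 by ring; rewrite exp_0; ring.
Qed.

Lemma duhamel_0 : 0 < lam -> duhamel 0 = 0.
Proof.
  intros H; unfold duhamel; destruct (Rlt_dec 0 lam); [|lra].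
  unfold Gint; rewrite RInt_point; unfold zero; simpl; ring.
Qed.

Variables (c beta : R).
Hypothesis Hbeta : 0 < beta.
Hypothesis Hbound : forall s, 0 <= s -> Rabs (g s) <= c * exp (- beta * s).

Lemma Gint_incr a b : 0 <= a <= b -> lam <> beta ->
  Rabs (Gint b - Gint a) <=
  c / (lam - beta) * exp ((lam - beta) * b) - c / (lam - beta) * exp ((lam - beta) * a).
Proof.
  intros Hab Hne.
  apply (@dom_incr Gint (fun s => c / (lam - beta) * exp ((lam - beta) * s))
    (fun s => exp (lam * s) * g s) (fun s => c * exp ((lam - beta) * s))); [lra| | |].
  - intros; apply Gint_derive.
  - intros s _; auto_derive; [easy|field; lra].
  - intros s Hs; rewrite Rabs_mult, (Rabs_pos_eq (exp _)) by (apply Rlt_le, exp_pos).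
    replace ((lam - beta) * s) with (lam * s + - beta * s) by ring.
    rewrite exp_plus.
    replace (c * (exp (lam * s) * exp (- beta * s)))
      with (exp (lam * s) * (c * exp (- beta * s))) by ring.
    apply Rmult_le_compat_l; [apply Rlt_le, exp_pos|apply Hbound; lra].
Qed.

(** The primitive of exp((lam - beta) s) has denominator mu = |lam - beta|, and mu >= beta in both
    cases. Values of lam near beta are excluded, so there is no resonance with the decay rate of g
    and no factor t appears. *)
Lemma duhamel_bound t : 0 <= t -> lam <= 0 \/ 2 * beta <= lam ->
  Rabs (duhamel t) <= c / beta * exp (- beta * t).
Proof.
  intros Ht Hlam.
  assert (Hc : 0 <= c).
  { specialize (Hbound (Rle_refl 0)); rewrite Rmult_0_r, exp_0 in Hbound.
    pose proof (Rabs_pos (g 0)); lra. }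
  assert (Hexp : forall x, 0 <= x -> forall mu, 0 < mu -> beta <= mu ->
    x <= c / mu * exp ((lam - beta) * t) ->
    exp (- lam * t) * x <= c / beta * exp (- beta * t)).
  { intros x Hx mu Hmu Hbm H.
    apply Rle_trans with (exp (- lam * t) * (c / mu * exp ((lam - beta) * t))).
    - apply Rmult_le_compat_l; [apply Rlt_le, exp_pos|exact H].
    - replace (exp (- lam * t) * (c / mu * exp ((lam - beta) * t)))
        with (c / mu * (exp (- lam * t) * exp ((lam - beta) * t))) by ring.
      rewrite <- exp_plus; replace (- lam * t + (lam - beta) * t) with (- beta * t) by ring.
      apply Rmult_le_compat_r; [apply Rlt_le, exp_pos|].
      apply Rmult_le_compat_l; [easy|now apply Rinv_le_contravar]. }
  unfold duhamel; rewrite Rabs_mult, (Rabs_pos_eq (exp _)) by (apply Rlt_le, exp_pos).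
  destruct (Rlt_dec 0 lam) as [H|H].
  - apply Hexp with (mu := lam - beta); [apply Rabs_pos|lra|lra|].
    assert (B := @Gint_incr 0 t (conj (Rle_refl 0) Ht) ltac:(lra)).
    replace (Gint 0) with 0 in B by (unfold Gint; now rewrite RInt_point).
    eapply Rle_trans; [exact B|].
    assert (0 <= c / (lam - beta) * exp ((lam - beta) * 0)); [|lra].
    apply Rmult_le_pos; [apply Rdiv_le_0_compat; lra|apply Rlt_le, exp_pos].
  - set (mu := beta - lam).
    assert (Hmu : 0 < mu) by (unfold mu; lra).
    assert (Htail : forall a b, 0 <= a <= b ->
      Rabs (Gint b - Gint a) <= c / mu * exp ((lam - beta) * a)).
    { intros a b Hab; eapply Rle_trans; [apply Gint_incr; lra|].
      replace (c / (lam - beta)) with (- (c / mu)) by (unfold mu; field; lra).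
      assert (0 <= c / mu * exp ((lam - beta) * b)); [|lra].
      apply Rmult_le_pos; [apply Rdiv_le_0_compat; lra|apply Rlt_le, exp_pos]. }
    assert (Hcv : ex_finite_lim_seq (fun n => Gint (INR n))).
    { apply ex_lim_seq_cauchy_corr; intros e.
      (* Chosen so that beyond N the tail (c / mu) exp(- mu n) is below e, by exp x >= 1 + x. *)
      destruct (INR_unbounded (c / mu / (e * mu))) as [N HN].
      assert (He := cond_pos e).
      assert (W : forall n m, (N <= n)%nat -> (n <= m)%nat ->
        Rabs (Gint (INR m) - Gint (INR n)) < e).
      { intros n m Hn Hm.
        eapply Rle_lt_trans; [apply Htail; split; [apply pos_INR|now apply le_INR]|].
        assert (HNn : INR N <= INR n) by (now apply le_INR).
        assert (Hx : 0 <= mu * INR n) by (apply Rmult_le_pos; [lra|apply pos_INR]).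
        replace ((lam - beta) * INR n) with (- (mu * INR n)) by (unfold mu; ring).
        rewrite exp_Ropp.
        assert (H1 : 1 + mu * INR n <= exp (mu * INR n)) by (apply exp_ineq1_le).
        change (c / mu / exp (mu * INR n) < e).
        apply Rlt_div_l; [apply exp_pos|].
        assert (Hem : 0 < e * mu) by (now apply Rmult_lt_0_compat).
        assert (H2 : c / mu < INR n * (e * mu)).
        { apply (Rlt_div_l (c / mu) (INR n) (e * mu) Hem); lra. }
        assert (e * (1 + mu * INR n) <= e * exp (mu * INR n))
          by (apply Rmult_le_compat_l; lra).
        unfold Rdiv in H2; lra. }
      exists N; intros n m Hn Hm.
      destruct (Nat.le_ge_cases n m).
      - rewrite Rabs_minus_sym; now apply W.
      - now apply W. }
    apply Lim_seq_correct' in Hcv.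
    apply Hexp with (mu := mu); [apply Rabs_pos|easy|unfold mu; lra|].
    set (L := real (Lim_seq _)) in *.
    assert (HL : is_lim_seq (fun n => Rabs (Gint t - Gint (INR n))) (Rabs (Gint t - L))).
    { apply (is_lim_seq_abs _ (Finite (Gint t - L))).
      apply is_lim_seq_minus'; [apply is_lim_seq_const|exact Hcv]. }
    refine (is_lim_seq_le_loc _ (fun _ => c / mu * exp ((lam - beta) * t)) _ _ _ HL
      (is_lim_seq_const _)).
    destruct (INR_unbounded t) as [N HN].
    exists N; intros n Hn; rewrite Rabs_minus_sym; apply Htail.
    split; [easy|]; apply le_INR in Hn; lra.
Qed.
End Duhamel.

(** * A submultiplicative weighted norm *)

Lemma Rr_theory : ring_theory 0 1 Rplus Rmult Rminus Ropp eq.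
Proof. exact RTheory. Qed.
Definition Rr : cring := CRing Rr_theory.

(* The weights 1 / (n + 1)^2 make the weighted sup norm of the coefficients submultiplicative
   (see [wsq_conv]), so that all estimates can be done coefficientwise. *)
Definition wsq (n : nat) : R := / INR (S n) ^ 2.

Lemma wsq_pos n : 0 < wsq n.
Proof. apply Rinv_0_lt_compat, pow_lt, lt_0_INR; lia. Qed.

(** Convolution with the constant 1 is the partial sum of the weights, which telescopes by 1 / (x +
    1)^2 <= 1 / x - 1 / (x + 1). *)
Lemma wsq_sum n : @cauchy Rr wsq (fun _ => 1) n <= 2 - / INR (S n).
Proof.
  induction n as [|n IH].
  - change (@cauchy Rr wsq (fun _ => 1) 0) with (wsq 0 * 1); unfold wsq; simpl.
    rewrite !Rmult_1_r, Rinv_1; lra.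
  - rewrite cauchy_Sr.
    change (@cauchy Rr wsq (fun _ => 1) n + wsq (S n) * 1 <= 2 - / INR (S (S n))).
    unfold wsq; rewrite (S_INR (S n)).
    assert (H : 1 <= INR (S n)) by (apply (le_INR 1); lia).
    set (x := INR (S n)) in *.
    rewrite Rmult_1_r.
    apply Rle_trans with (2 - / x + (/ x - / (x + 1))); [|apply Req_le; ring].
    apply Rplus_le_compat; [exact IH|].
    replace (/ x - / (x + 1)) with (/ (x * (x + 1))) by (field; lra).
    apply Rinv_le_contravar; nra.
Qed.

(** For k + l = n put x = k + 1 and y = l + 1: then x + y = n + 2 is fixed, 1 / (x y) = (1 / x + 1 /
    y) / (x + y), and squaring leaves two partial sums, each at most 2. *)
Lemma wsq_conv n : @cauchy Rr wsq wsq n <= 8 * wsq n.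
Proof.
  assert (H1 : 0 < INR (S n)) by (apply lt_0_INR; lia).
  set (m := INR (S n) + 1).
  assert (H : @cauchy Rr wsq wsq n <=
    2 / m ^ 2 * (@cauchy Rr wsq (fun _ => 1) n + @cauchy Rr (fun _ => 1) wsq n)).
  { apply (@cauchy_ind3 Rr Rr Rr (fun x y z => x <= 2 / m ^ 2 * (y + z))).
    - intros x x' y y' z z' H H'.
      change (x + x' <= 2 / m ^ 2 * (y + y' + (z + z'))); lra.
    - intros k l Hkl.
      change (wsq k * wsq l <= 2 / m ^ 2 * (wsq k * 1 + 1 * wsq l)).
      assert (Em : m = INR (S k) + INR (S l)).
      { unfold m; rewrite <- Hkl, !S_INR, plus_INR; ring. }
      assert (Hk : 0 < INR (S k)) by (apply lt_0_INR; lia).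
      assert (Hl : 0 < INR (S l)) by (apply lt_0_INR; lia).
      unfold wsq; rewrite Em.
      set (x := INR (S k)) in *; set (y := INR (S l)) in *.
      assert (E : / x ^ 2 * / y ^ 2 = (/ x + / y) ^ 2 / (x + y) ^ 2) by (field; lra).
      rewrite E.
      replace (2 / (x + y) ^ 2 * (/ x ^ 2 * 1 + 1 * / y ^ 2))
        with (2 * ((/ x) ^ 2 + (/ y) ^ 2) / (x + y) ^ 2) by (field; lra).
      apply Rmult_le_compat_r; [apply Rlt_le, Rinv_0_lt_compat; nra|].
      pose proof (pow2_ge_0 (/ x - / y)); nra. }
  rewrite (cauchy_comm n (A := Rr) (fun _ => 1) wsq) in H.
  assert (Hs := wsq_sum n).
  assert (0 < / INR (S n)) by (now apply Rinv_0_lt_compat).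
  assert (Hm : 0 < 2 / m ^ 2).
  { apply Rdiv_lt_0_compat; [lra|]; apply pow_lt; unfold m; lra. }
  apply Rle_trans with (2 / m ^ 2 * 4).
  - eapply Rle_trans; [exact H|]; apply Rmult_le_compat_l; lra.
  - replace (2 / m ^ 2 * 4) with (8 * / m ^ 2) by (field; unfold m; lra).
    apply Rmult_le_compat_l; [lra|]; unfold wsq.
    apply Rinv_le_contravar; [now apply pow_lt|].
    apply pow_incr; unfold m; lra.
Qed.

Definition wt (K : R) (n : nat) : R := K ^ n * wsq n.
Definition wt2 (K : R) : S2 Rr := fun i j => wt K i * wt K j.

Section Weights.
Variable K : R.
Hypothesis HK : 0 < K.

Lemma wt_pos n : 0 < wt K n.
Proof. apply Rmult_lt_0_compat; [now apply pow_lt|apply wsq_pos]. Qed.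

Lemma wt2_pos i j : 0 < wt2 K i j.
Proof. apply Rmult_lt_0_compat; apply wt_pos. Qed.

Lemma wt_le n : wt K n <= K ^ n.
Proof.
  rewrite <- (Rmult_1_r (K ^ n)); apply Rmult_le_compat_l; [now apply pow_le, Rlt_le|].
  unfold wsq; rewrite <- Rinv_1; apply Rinv_le_contravar; [lra|].
  apply pow_R1_Rle, (le_INR 1); lia.
Qed.

Lemma wt_conv n : @cauchy Rr (wt K) (wt K) n <= 8 * wt K n.
Proof.
  replace (@cauchy Rr (wt K) (wt K) n) with (K ^ n * @cauchy Rr wsq wsq n).
  - replace (8 * wt K n) with (K ^ n * (8 * wsq n)) by (unfold wt; ring).
    apply Rmult_le_compat_l; [now apply pow_le, Rlt_le|apply wsq_conv].
  - refine (@cauchy_ind3 Rr Rr Rr (fun x y _ => K ^ n * x = y) _ n wsq wsq (wt K) (wt K) wsq wsq _).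
    + intros x x' y y' _ _ <- <-; change (K ^ n * (x + x') = K ^ n * x + K ^ n * x'); ring.
    + intros k l <-; change (K ^ (k + l) * (wsq k * wsq l) = wt K k * wt K l).
      unfold wt; rewrite pow_add; ring.
Qed.

(** The weight is a product, so its convolution factorises: 64 = 8 * 8. *)
Lemma wt2_conv i j : (wt2 K * wt2 K)%cr i j <= 64 * wt2 K i j.
Proof.
  assert (E : (wt2 K * wt2 K)%cr i j =
    @cauchy Rr (wt K) (wt K) i * @cauchy Rr (wt K) (wt K) j).
  { refine (@cauchy_ind3 (ps Rr) Rr Rr (fun x y _ => x j = y * @cauchy Rr (wt K) (wt K) j) _ i
      (wt2 K) (wt2 K) (wt K) (wt K) (wt K) (wt K) _).
    - intros x x' y y' _ _ H H'.
      change (x j + x' j = (y + y') * @cauchy Rr (wt K) (wt K) j); rewrite H, H'; ring.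
    - intros k l _.
      change (@cauchy Rr (fun n => wt K k * wt K n) (fun n => wt K l * wt K n) j
        = wt K k * wt K l * @cauchy Rr (wt K) (wt K) j).
      rewrite (cauchy_scal (A := Rr) (wt K k) j (wt K)), cauchy_comm.
      rewrite (cauchy_scal (A := Rr) (wt K l) j (wt K)); simpl; ring. }
  rewrite E.
  replace (64 * wt2 K i j) with ((8 * wt K i) * (8 * wt K j)) by (unfold wt2; ring).
  assert (P : forall n, 0 <= @cauchy Rr (wt K) (wt K) n).
  { intros n; refine (@cauchy_ind3 Rr Rr Rr (fun x _ _ => 0 <= x) _ n
      (wt K) (wt K) (wt K) (wt K) (wt K) (wt K) _).
    - intros x x' _ _ _ _; apply Rplus_le_le_0_compat.
    - intros k l _; apply Rmult_le_pos; apply Rlt_le, wt_pos. }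
  apply Rmult_le_compat; auto; apply wt_conv.
Qed.

(** The exponent records decay in time: rates add under multiplication, while 1, p and q only have
    rate 0. *)
Definition wbound (mu c : R) (a : SS) : Prop := forall i j t, 0 <= t ->
  Cmod (a i j t) <= c * wt2 K i j * exp (- mu * t).

Lemma wbound_nonneg mu c a : wbound mu c a -> 0 <= c.
Proof.
  intros H; specialize (H O O 0 (Rle_refl 0)).
  rewrite Rmult_0_r, exp_0, Rmult_1_r in H.
  assert (H0 := wt2_pos 0 0); assert (H1 := Cmod_ge0 (a O O 0)).
  destruct (Rle_dec 0 c) as [|N]; [easy|]; nra.
Qed.

Lemma wbound_le mu mu' c c' a : 0 <= mu' <= mu -> c <= c' -> wbound mu c a -> wbound mu' c' a.
Proof.
  intros Hmu Hc H i j t Ht; assert (Hc0 := wbound_nonneg H); assert (W := wt2_pos i j).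
  eapply Rle_trans; [now apply H|].
  apply Rmult_le_compat; [nra|apply Rlt_le, exp_pos|nra|].
  assert (L : - mu * t <= - mu' * t) by nra.
  destruct (Rle_lt_or_eq_dec _ _ L) as [L'|E]; [left; now apply exp_increasing|].
  rewrite E; lra.
Qed.

Lemma wbound_add mu c d a b : wbound mu c a -> wbound mu d b -> wbound mu (c + d) (a + b)%cr.
Proof.
  intros Ha Hb i j t Ht.
  eapply Rle_trans; [apply (Cmod_triangle (a i j t) (b i j t))|].
  specialize (Ha i j t Ht); specialize (Hb i j t Ht); lra.
Qed.

Lemma wbound_opp mu c a : wbound mu c a -> wbound mu c (- a)%cr.
Proof.
  intros Ha i j t Ht; eapply Rle_trans; [|now apply Ha].
  change (Cmod (- a i j t)%cx <= Cmod (a i j t)); rewrite Cmod_opp; lra.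
Qed.

Lemma wbound_mul mu nu c d a b : wbound mu c a -> wbound nu d b -> wbound (mu + nu) (64 * (c * d)) (a * b)%cr.
Proof.
  intros Ha Hb i j t Ht.
  assert (Hc := wbound_nonneg Ha); assert (Hd := wbound_nonneg Hb).
  apply Rle_trans with (c * d * (wt2 K * wt2 K)%cr i j * exp (- (mu + nu) * t)).
  - refine (@cauchy2_ind3 Fn Rr Rr (fun x y _ => Cmod (x t) <= c * d * y * exp (- (mu + nu) * t))
      _ i j a b (wt2 K) (wt2 K) (wt2 K) (wt2 K) _).
    + intros x x' y y' _ _ H H'.
      eapply Rle_trans; [apply (Cmod_triangle (x t) (x' t))|].
      change (Cmod (x t) + Cmod (x' t) <= c * d * (y + y') * exp (- (mu + nu) * t)); lra.
    + intros k l m n _ _.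
      change (Cmod (a k m t * b l n t)%cx
        <= c * d * (wt2 K k m * wt2 K l n) * exp (- (mu + nu) * t)).
      rewrite Cmod_mult; replace (- (mu + nu) * t) with (- mu * t + - nu * t) by ring.
      rewrite exp_plus.
      replace (_ * (exp _ * exp _)) with
        ((c * wt2 K k m * exp (- mu * t)) * (d * wt2 K l n * exp (- nu * t))) by ring.
      apply Rmult_le_compat; try apply Cmod_ge0; auto.
  - apply Rmult_le_compat_r; [apply Rlt_le, exp_pos|].
    replace (64 * (c * d) * wt2 K i j) with (c * d * (64 * wt2 K i j)) by ring.
    apply Rmult_le_compat_l; [now apply Rmult_le_pos|apply wt2_conv].
Qed.

Lemma wt2_00 : wt2 K O O = 1.
Proof. unfold wt2, wt, wsq; simpl; field. Qed.

Lemma wt2_10 : wt2 K 1%nat O = K / 4 /\ wt2 K O 1%nat = K / 4.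
Proof. unfold wt2, wt, wsq; simpl; split; field. Qed.

Lemma wbound_single (a : SS) c i0 j0 : 0 <= c -> c * wt2 K i0 j0 = 1 ->
  (forall i j, a i j = fun _ => if andb (Nat.eqb i i0) (Nat.eqb j j0) then C1 else C0) ->
  wbound 0 c a.
Proof.
  intros Hc E Ha i j t Ht; rewrite Ha.
  replace (- 0 * t) with 0 by ring; rewrite exp_0, Rmult_1_r.
  destruct (andb _ _) eqn:B.
  - apply andb_prop in B; destruct B as [B1 B2].
    apply Nat.eqb_eq in B1; apply Nat.eqb_eq in B2; subst.
    rewrite Cmod_C1, E; lra.
  - rewrite Cmod_C0; apply Rmult_le_pos; [easy|apply Rlt_le, wt2_pos].
Qed.

Lemma wbound_one : wbound 0 1 (1 : SS)%cr.
Proof.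
  apply wbound_single with O O; [lra|rewrite wt2_00; ring|].
  now intros [|i] [|j].
Qed.

Lemma wbound_var_p : wbound 0 (4 / K) (var_p Fn).
Proof.
  apply wbound_single with 1%nat O; [apply Rdiv_le_0_compat; lra| |].
  - rewrite (proj1 wt2_10); field; lra.
  - now intros [|[|i]] [|j].
Qed.

Lemma wbound_var_q : wbound 0 (4 / K) (var_q Fn).
Proof.
  apply wbound_single with O 1%nat; [apply Rdiv_le_0_compat; lra| |].
  - rewrite (proj2 wt2_10); field; lra.
  - now intros [|i] [|[|j]].
Qed.

Lemma wbound_pow c a n : wbound 0 c a -> wbound 0 ((64 * c) ^ n) (rpow a n).
Proof.
  intros Ha; induction n as [|n IH]; [exact wbound_one|].
  apply wbound_le with (0 + 0) (64 * (c * (64 * c) ^ n)); [lra|simpl; lra|].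
  now apply wbound_mul.
Qed.

Lemma sumr_half (F : nat -> Fn) t D n :
  (forall k, Cmod (F k t) <= D * (1 / 2) ^ k) -> Cmod (sumr F n t) <= 2 * D.
Proof.
  intros H.
  assert (HD : 0 <= D) by (specialize (H O); pose proof (Cmod_ge0 (F O t)); simpl in H; lra).
  assert (E : Cmod (sumr F n t) <= 2 * D - D * (1 / 2) ^ n).
  { induction n as [|n IH]; [specialize (H O); simpl in *; lra|].
    eapply Rle_trans; [apply (Cmod_triangle (sumr F n t) (F (S n) t))|].
    specialize (H (S n)); cbn [pow] in *; lra. }
  assert (0 <= D * (1 / 2) ^ n) by (apply Rmult_le_pos; [easy|apply pow_le; lra]); lra.
Qed.

(** With x = 64 c L <= 1/2 the term (a, b) is at most 64 G x^(a+b); as a + b >= k, a factor (2 x)^k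
    can be taken out, leaving (1/2)^(a+b). The 256 is 64 times 2 for each of the two sums. The power
    k makes the bound quadratic in c when g starts at degree two. *)
Lemma csum_wbound (g : nat -> nat -> Fn) G L beta c U V k N : 0 <= L -> 2 * (64 * c * L) <= 1 ->
  (forall a b t, 0 <= t -> Cmod (g a b t) <= G * (L ^ a * L ^ b) * exp (- beta * t)) ->
  (forall a b, (a + b < k)%nat -> g a b = fun _ => C0) ->
  wbound 0 c U -> wbound 0 c V ->
  wbound beta (256 * G * (2 * (64 * c * L)) ^ k) (csum g U V N).
Proof.
  intros HL Hx Hg Hg0 HU HV i j t Ht.
  assert (Hc := wbound_nonneg HU).
  set (x := 64 * c * L) in *.
  assert (Hx0 : 0 <= x) by (unfold x; repeat apply Rmult_le_pos; lra).
  set (D := 64 * G * (2 * x) ^ k * wt2 K i j * exp (- beta * t)).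
  replace (256 * G * (2 * x) ^ k * wt2 K i j * exp (- beta * t)) with (2 * (2 * D))
    by (unfold D; ring).
  assert (HG : 0 <= G).
  { specialize (Hg O O 0 (Rle_refl 0)); rewrite Rmult_0_r, exp_0 in Hg; simpl in Hg.
    pose proof (Cmod_ge0 (g O O 0)); lra. }
  assert (HD : 0 <= D).
  { unfold D; apply Rmult_le_pos; [|apply Rlt_le, exp_pos].
    apply Rmult_le_pos; [|apply Rlt_le, wt2_pos].
    apply Rmult_le_pos; [lra|apply pow_le; lra]. }
  rewrite csum_coef; apply sumr_half; intros a.
  rewrite Rmult_assoc; apply sumr_half; intros b.
  change (Cmod (g a b t * mono U V a b i j t)%cx <= D * (1 / 2) ^ a * (1 / 2) ^ b).
  destruct (Nat.lt_ge_cases (a + b) k) as [Hk|Hk].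
  - rewrite Hg0 by easy; replace (C0 * mono U V a b i j t)%cx with C0 by ring.
    rewrite Cmod_C0, Rmult_assoc; apply Rmult_le_pos; [exact HD|].
    apply Rmult_le_pos; apply pow_le; lra.
  - rewrite Cmod_mult.
    assert (HM := wbound_mul (wbound_pow a HU) (wbound_pow b HV)).
    specialize (HM i j t Ht); fold (mono U V a b) in HM.
    replace (- (0 + 0) * t) with 0 in HM by ring; rewrite exp_0, Rmult_1_r in HM.
    apply Rle_trans with (G * (L ^ a * L ^ b) * exp (- beta * t) *
      (64 * ((64 * c) ^ a * (64 * c) ^ b) * wt2 K i j)).
    { apply Rmult_le_compat; try apply Cmod_ge0; [now apply Hg|exact HM]. }
    replace (G * (L ^ a * L ^ b) * exp (- beta * t) *
      (64 * ((64 * c) ^ a * (64 * c) ^ b) * wt2 K i j))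
      with (64 * G * ((64 * c) ^ a * L ^ a * ((64 * c) ^ b * L ^ b)) * wt2 K i j
        * exp (- beta * t)) by ring.
    rewrite <- !Rpow_mult_distr; fold x; rewrite <- pow_add.
    unfold D; replace (64 * G * (2 * x) ^ k * wt2 K i j * exp (- beta * t) * (1 / 2) ^ a * (1 / 2) ^ b)
      with (64 * G * ((2 * x) ^ k * ((1 / 2) ^ a * (1 / 2) ^ b)) * wt2 K i j * exp (- beta * t))
      by ring.
    rewrite <- pow_add.
    apply Rmult_le_compat_r; [apply Rlt_le, exp_pos|].
    apply Rmult_le_compat_r; [apply Rlt_le, wt2_pos|].
    apply Rmult_le_compat_l; [lra|].
    replace x with (2 * x * (1 / 2)) at 1 by field; rewrite Rpow_mult_distr.
    apply Rmult_le_compat_r; [apply pow_le; lra|].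
    replace (a + b)%nat with (k + (a + b - k))%nat by lia; rewrite pow_add.
    rewrite <- (Rmult_1_r ((2 * x) ^ k)) at 2.
    apply Rmult_le_compat_l; [apply pow_le; lra|].
    rewrite <- (pow1 (a + b - k)); apply pow_incr; lra.
Qed.

Lemma comp_wbound (g : nat -> nat -> Fn) G L beta c U V k : 0 <= L -> 2 * (64 * c * L) <= 1 ->
  (forall a b t, 0 <= t -> Cmod (g a b t) <= G * (L ^ a * L ^ b) * exp (- beta * t)) ->
  (forall a b, (a + b < k)%nat -> g a b = fun _ => C0) ->
  wbound 0 c U -> wbound 0 c V ->
  wbound beta (256 * G * (2 * (64 * c * L)) ^ k) (comp g U V).
Proof. intros HL Hx Hg Hg0 HU HV i j; now apply (csum_wbound (i + j) HL Hx Hg Hg0 HU HV). Qed.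
End Weights.

(** * Continuity of the coefficients in time *)

Definition ccont (x : Fn) : Prop :=
  forall t, continuous (fun s => fst (x s)) t /\ continuous (fun s => snd (x s)) t.

Lemma ccont_add (x y : Fn) : ccont x -> ccont y -> ccont (x + y)%cr.
Proof.
  intros Hx Hy t; destruct (Hx t) as [A B]; destruct (Hy t) as [C D]; split.
  - apply (@continuous_plus R_UniformSpace R_AbsRing R_NormedModule _ _ _ A C).
  - apply (@continuous_plus R_UniformSpace R_AbsRing R_NormedModule _ _ _ B D).
Qed.

Lemma ccont_opp (x : Fn) : ccont x -> ccont (- x)%cr.
Proof.
  intros Hx t; destruct (Hx t) as [A B]; split.
  - apply (@continuous_opp R_UniformSpace R_AbsRing R_NormedModule _ _ A).
  - apply (@continuous_opp R_UniformSpace R_AbsRing R_NormedModule _ _ B).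
Qed.

Lemma ccont_mul (x y : Fn) : ccont x -> ccont y -> ccont (x * y)%cr.
Proof.
  intros Hx Hy t; destruct (Hx t) as [A B]; destruct (Hy t) as [C D].
  assert (M : forall u v : R -> R, continuous u t -> continuous v t ->
    continuous (fun s => u s * v s) t).
  { intros u v; apply (@continuous_mult R_UniformSpace R_AbsRing). }
  split.
  - apply (@continuous_minus R_UniformSpace R_AbsRing R_NormedModule
      (fun s => fst (x s) * fst (y s)) (fun s => snd (x s) * snd (y s))); now apply M.
  - apply (@continuous_plus R_UniformSpace R_AbsRing R_NormedModule
      (fun s => fst (x s) * snd (y s)) (fun s => snd (x s) * fst (y s))); now apply M.
Qed.

Lemma ccont_const z : ccont (fun _ => z).
Proof. intros t; split; apply continuous_const. Qed.

Lemma cder_ccont (x d : R -> Cx) : (forall t, cder x t (d t)) -> ccont x.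
Proof.
  intros H t; destruct (H t) as [A B]; split;
    apply (@ex_derive_continuous R_AbsRing R_NormedModule); eexists; eassumption.
Qed.

Definition SScont (s : SS) : Prop := forall i j, ccont (s i j).

Lemma SScont_mul a b : SScont a -> SScont b -> SScont (a * b)%cr.
Proof.
  intros Ha Hb i j.
  refine (@cauchy2_ind3 Fn Fn Fn (fun x _ _ => ccont x) _ i j a b a b a b _).
  - intros; now apply ccont_add.
  - intros; now apply ccont_mul.
Qed.

Lemma SScont_one : SScont (1 : SS)%cr.
Proof. intros [|i] [|j]; first [exact (ccont_const C1)|exact (ccont_const C0)]. Qed.

Lemma SScont_pow a n : SScont a -> SScont (rpow a n).
Proof. intros Ha; induction n as [|n IH]; [exact SScont_one|now apply SScont_mul]. Qed.

Lemma ccont_sumr (F : nat -> Fn) n : (forall k, ccont (F k)) -> ccont (sumr F n).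
Proof. intros H; induction n as [|n IH]; [apply H|now apply ccont_add]. Qed.

Lemma SScont_comp (g : nat -> nat -> Fn) U V : (forall a b, ccont (g a b)) ->
  SScont U -> SScont V -> SScont (comp g U V).
Proof.
  intros Hg HU HV i j; unfold comp; rewrite csum_coef.
  apply ccont_sumr; intros a; apply ccont_sumr; intros b; apply ccont_mul; [apply Hg|].
  now apply SScont_mul; apply SScont_pow.
Qed.

Lemma SScont_var_p : SScont (var_p Fn).
Proof. intros [|[|i]] [|j]; first [exact (ccont_const C1)|exact (ccont_const C0)]. Qed.

Lemma SScont_var_q : SScont (var_q Fn).
Proof. intros [|i] [|[|j]]; first [exact (ccont_const C1)|exact (ccont_const C0)]. Qed.

Lemma wbound_gbound K mu c s : 0 < K -> 0 <= mu -> wbound K mu c s -> gbound K c s.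
Proof.
  intros HK Hmu H t Ht i j; assert (Hc := wbound_nonneg HK H).
  assert (H0 : wbound K 0 c s) by (apply (wbound_le HK) with (3 := H); lra).
  eapply Rle_trans; [apply (H0 i j t Ht)|].
  replace (- 0 * t) with 0 by ring; rewrite exp_0, Rmult_1_r, Rmult_assoc.
  apply Rmult_le_compat_l; [easy|].
  apply Rmult_le_compat; try (apply Rlt_le, (wt_pos HK)); apply (wt_le HK).
Qed.

Lemma val_sub_coef (A : cring) k (s s' : S2 A) :
  val k (s - s')%cr <-> (forall i j, (i + j < k)%nat -> s i j = s' i j).
Proof.
  split; intros H i j Hij.
  - assert (E : (s i j - s' i j)%cr = 0%cr) by exact (H i j Hij).
    destruct (rth A).
    rewrite <- (Radd_0_l (s' i j)), <- E, Rsub_def, <- Radd_assoc,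
      (Radd_comm (- s' i j)%cr), Ropp_def, Radd_comm; symmetry; apply Radd_0_l.
  - change ((s i j - s' i j)%cr = 0%cr); rewrite (H i j Hij).
    destruct (rth A); now rewrite Rsub_def.
Qed.

Lemma gp_bound (f : nat -> nat -> Fn) G L beta : 0 <= L ->
  (forall i j t, 0 <= t -> Cmod (f i j t) <= G * (L ^ i * L ^ j) * exp (- beta * t)) ->
  forall i j t, 0 <= t ->
  Cmod (gp f i j t) <= G * L * ((2 * L) ^ i * (2 * L) ^ j) * exp (- beta * t) /\
  Cmod (gq f i j t) <= G * L * ((2 * L) ^ i * (2 * L) ^ j) * exp (- beta * t).
Proof.
  intros HL Hf i j t Ht.
  assert (HG : 0 <= G).
  { specialize (Hf O O 0 (Rle_refl 0)); rewrite Rmult_0_r, exp_0 in Hf; simpl in Hf.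
    pose proof (Cmod_ge0 (f O O 0)); lra. }
  assert (HLn : forall n, 0 <= L ^ n) by (intros; now apply pow_le).
  assert (H2 : forall n, 1 <= 2 ^ n) by (intros; apply pow_R1_Rle; lra).
  assert (He := Rlt_le _ _ (exp_pos (- beta * t))).
  assert (HX : 0 <= G * L * (L ^ i * L ^ j) * exp (- beta * t)).
  { repeat apply Rmult_le_pos; auto. }
  rewrite !Rpow_mult_distr.
  replace (G * L * (2 ^ i * L ^ i * (2 ^ j * L ^ j)) * exp (- beta * t))
    with (2 ^ i * 2 ^ j * (G * L * (L ^ i * L ^ j) * exp (- beta * t))) by ring.
  set (X := G * L * (L ^ i * L ^ j) * exp (- beta * t)) in *.
  unfold gp, gq; rewrite !nsm_Fn, !Cmod_mult, !Cmod_RtoC, !Rabs_pos_eq by apply pos_INR.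
  assert (Hp := Hf (S i) j t Ht); assert (Hq := Hf i (S j) t Ht).
  replace (G * (L ^ S i * L ^ j) * exp (- beta * t)) with X in Hp by (unfold X; simpl; ring).
  replace (G * (L ^ i * L ^ S j) * exp (- beta * t)) with X in Hq by (unfold X; simpl; ring).
  assert (P := H2 i); assert (Q := H2 j).
  split.
  - apply Rle_trans with (2 ^ i * X).
    + apply Rmult_le_compat; auto using pos_INR, Cmod_ge0, INR_le_pow2.
    + apply Rmult_le_compat_r; [easy|nra].
  - apply Rle_trans with (2 ^ j * X).
    + apply Rmult_le_compat; auto using pos_INR, Cmod_ge0, INR_le_pow2.
    + apply Rmult_le_compat_r; [easy|nra].
Qed.

(** * Picard iteration for the conjugation *)

Section Construction.
Variables omega beta G L : R.
Variable f : nat -> nat -> Fn.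
Hypothesis Hbeta : 0 < beta.
Hypothesis Homega : 2 * beta <= omega.
Hypothesis HL : 1 <= L.
Hypothesis Hfc : forall i j, ccont (f i j).
Hypothesis Hfb : forall i j t, 0 <= t ->
  Cmod (f i j t) <= G * (L ^ i * L ^ j) * exp (- beta * t).
Hypothesis Hf0 : forall i j, (i + j <= 2)%nat -> f i j = fun _ => C0.

(* The scalar equations for the coefficients of u (k = 1) and v (k = -1) are y' + lam k i j y = g. *)
Definition lam (k : R) (i j : nat) : R := omega * (INR j - INR i + k).

Definition solve (k : R) (s : SS) : SS := fun i j t =>
  (duhamel (lam k i j) (fun x => fst (s i j x)) t,
   duhamel (lam k i j) (fun x => snd (s i j x)) t).

Lemma solve_cder k s i j t : SScont s ->
  cder (solve k s i j) t (s i j t - RtoC (lam k i j) * solve k s i j t)%cx.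
Proof.
  intros Hs.
  assert (C1 := fun x => proj1 (Hs i j x)); assert (C2 := fun x => proj2 (Hs i j x)).
  split; simpl.
  - replace (fst (s i j t) + _) with (fst (s i j t) - lam k i j *
      duhamel (lam k i j) (fun x => fst (s i j x)) t) by ring.
    exact (duhamel_derive (lam k i j) C1 t).
  - replace (snd (s i j t) + _) with (snd (s i j t) - lam k i j *
      duhamel (lam k i j) (fun x => snd (s i j x)) t) by ring.
    exact (duhamel_derive (lam k i j) C2 t).
Qed.

(** [lam] is omega times an integer, and an integer is at most 0 or at least 1. This spectral gap,
    with 2 beta <= omega, is the reason why no small divisors occur. *)
Lemma lam_gap k i j : k = 1 \/ k = -1 -> lam k i j <= 0 \/ 2 * beta <= lam k i j.
Proof.
  intros Hk; unfold lam.
  assert (H : exists m n, INR j - INR i + k = INR m - INR n).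
  { destruct Hk as [-> | ->].
    - exists (S j), i; rewrite S_INR; ring.
    - exists j, (S i); rewrite S_INR; ring. }
  destruct H as [m [n ->]].
  destruct (Nat.le_gt_cases m n) as [H|H].
  - left; apply le_INR in H; nra.
  - right; apply le_INR in H; rewrite S_INR in H; nra.
Qed.

Lemma solve_wbound K c k s : 0 < K -> k = 1 \/ k = -1 -> SScont s ->
  wbound K beta c s -> wbound K beta (2 * c / beta) (solve k s).
Proof.
  intros HK Hk Hs H i j t Ht.
  assert (A1 : forall x, 0 <= x -> Rabs (fst (s i j x)) <= c * wt2 K i j * exp (- beta * x)).
  { intros x Hx; eapply Rle_trans; [apply Cmod_fst|now apply H]. }
  assert (A2 : forall x, 0 <= x -> Rabs (snd (s i j x)) <= c * wt2 K i j * exp (- beta * x)).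
  { intros x Hx; eapply Rle_trans; [apply Cmod_snd|now apply H]. }
  assert (B1 := duhamel_bound (fun x => proj1 (Hs i j x)) Hbeta A1 Ht (lam_gap i j Hk)).
  assert (B2 := duhamel_bound (fun x => proj2 (Hs i j x)) Hbeta A2 Ht (lam_gap i j Hk)).
  eapply Rle_trans; [apply Cmod_le_sum|]; unfold solve; simpl.
  replace (2 * c / beta * wt2 K i j * exp (- beta * t)) with
    (c * wt2 K i j / beta * exp (- beta * t) + c * wt2 K i j / beta * exp (- beta * t))
    by (field; lra).
  now apply Rplus_le_compat.
Qed.

Lemma solve_0 k s i j : 0 < lam k i j -> solve k s i j 0 = C0.
Proof. intros H; unfold solve; now rewrite !duhamel_0. Qed.

Lemma solve_cont k s : SScont s -> SScont (solve k s).
Proof.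
  intros Hs i j.
  apply (cder_ccont (d := fun t => (s i j t - RtoC (lam k i j) * solve k s i j t)%cx)).
  intros t; now apply solve_cder.
Qed.

Lemma solve_ext k s s' i j : s i j = s' i j -> solve k s i j = solve k s' i j.
Proof. intros E; unfold solve; now rewrite E. Qed.

(** For zero data the base point at infinity has to be inspected as well: the limit there is that of
    the zero sequence. *)
Lemma solve_val k n s : val n s -> val n (solve k s).
Proof.
  intros H i j Hij; rewrite (@solve_ext k s (0 : SS)%cr) by (rewrite H by easy; reflexivity).
  apply functional_extensionality; intros t; unfold solve, duhamel, Gint; simpl.
  assert (E : forall x, RInt (fun s => exp (lam k i j * s) * 0) 0 x = 0).
  { intros x; rewrite (RInt_ext _ (fun _ => 0)).
    - rewrite RInt_const; unfold scal; simpl; unfold mult; simpl; ring.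
    - intros; apply Rmult_0_r. }
  rewrite !E, (Lim_seq_ext _ (fun _ => 0)) by (intros; apply E).
  rewrite Lim_seq_const; simpl.
  destruct (Rlt_dec 0 (lam k i j)); apply Cx_ext; simpl; ring.
Qed.

Definition rhsU (w : SS * SS) : SS := (- comp (gq f) (var_p Fn + fst w) (var_q Fn + snd w))%cr.
Definition rhsV (w : SS * SS) : SS := comp (gp f) (var_p Fn + fst w)%cr (var_q Fn + snd w)%cr.
Definition picard (w : SS * SS) : SS * SS := (solve 1 (rhsU w), solve (-1) (rhsV w)).
Fixpoint iterate (n : nat) : SS * SS :=
  match n with O => (0%cr, 0%cr) | S m => picard (iterate m) end.

Lemma gp0 a b : (a + b < 2)%nat -> gp f a b = fun _ => C0.
Proof. intros H; unfold gp; rewrite Hf0 by lia; apply nsm_O. Qed.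

Lemma gq0 a b : (a + b < 2)%nat -> gq f a b = fun _ => C0.
Proof. intros H; unfold gq; rewrite Hf0 by lia; apply nsm_O. Qed.

Lemma nsm_cont n x : ccont x -> ccont (nsm n x : Fn).
Proof. intros H; induction n as [|n IH]; [exact (ccont_const C0)|now apply ccont_add]. Qed.

Lemma val_var_p : val 1 (var_p Fn).
Proof. intros [|[|i]] [|j] H; (lia || reflexivity). Qed.

Lemma val_var_q : val 1 (var_q Fn).
Proof. intros [|i] [|[|j]] H; (lia || reflexivity). Qed.

Definition agree k (w w' : SS * SS) : Prop :=
  val k (fst w - fst w')%cr /\ val k (snd w - snd w')%cr.
Definition low (w : SS * SS) : Prop := val 2 (fst w) /\ val 2 (snd w).

Lemma val_U w : low w -> val 1 (var_p Fn + fst w)%cr /\ val 1 (var_q Fn + snd w)%cr.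
Proof.
  intros [H1 H2]; split; apply val_add; try exact val_var_p; try exact val_var_q;
    now apply val_le with 2%nat; [lia|].
Qed.

Lemma picard_low w : low w -> low (picard w).
Proof.
  intros H; destruct (val_U H) as [HU HV]; split; apply solve_val.
  - apply val_opp, val_comp; [easy|easy|apply gq0].
  - apply val_comp; [easy|easy|apply gp0].
Qed.

(** [comp_diff] gains one order and [solve] acts on each coefficient separately, so one step settles
    one further degree. *)
Lemma picard_agree k w w' : low w -> low w' -> agree k w w' ->
  agree (S k) (picard w) (picard w').
Proof.
  intros H H' [D1 D2].
  destruct (val_U H) as [HU HV]; destruct (val_U H') as [HU' HV'].
  assert (E : forall X s s', val k (s - s')%cr -> val k (((X + s) - (X + s')) : SS)%cr).
  { intros X s s' Hs; apply val_sub_coef; intros i j Hij.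
    change ((X i j + s i j = X i j + s' i j)%cr); f_equal.
    exact (proj1 (val_sub_coef _ _ _) Hs i j Hij). }
  split; apply val_sub_coef; intros i j Hij; apply solve_ext.
  - change ((- comp (gq f) (var_p Fn + fst w) (var_q Fn + snd w) i j)%cr =
            (- comp (gq f) (var_p Fn + fst w') (var_q Fn + snd w') i j)%cr); f_equal.
    revert i j Hij; apply val_sub_coef, comp_diff; auto; apply gq0.
  - revert i j Hij; apply val_sub_coef, comp_diff; auto; apply gp0.
Qed.

Lemma iterate_low n : low (iterate n).
Proof.
  induction n as [|n IH]; [split; apply val_O|now apply picard_low].
Qed.

Lemma iterate_agree n : agree (S (S n)) (iterate (S n)) (iterate n).
Proof.
  induction n as [|n IH].
  - assert (H := iterate_low 1); destruct H as [H1 H2].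
    split; apply val_sub; try easy; apply val_O.
  - exact (picard_agree (iterate_low (S n)) (iterate_low n) IH).
Qed.

Lemma iterate_stable m n i j : (i + j < S (S m))%nat -> (m <= n)%nat ->
  fst (iterate n) i j = fst (iterate m) i j /\ snd (iterate n) i j = snd (iterate m) i j.
Proof.
  intros Hij Hmn; induction Hmn as [|n Hmn [IH1 IH2]]; [easy|].
  destruct (iterate_agree n) as [D1 D2].
  rewrite <- IH1, <- IH2; split; apply (val_sub_coef (S (S n))); auto; lia.
Qed.

(* The coefficient of degree d of the n-th iterate no longer changes once n >= d - 1. *)
Definition fixpt : SS * SS :=
  (fun i j => fst (iterate (i + j)) i j, fun i j => snd (iterate (i + j)) i j).

Lemma fixpt_it n : agree (S (S n)) fixpt (iterate n).
Proof.
  split; apply val_sub_coef; intros i j Hij; simpl.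
  - destruct (Nat.le_ge_cases (i + j) n).
    + symmetry; apply iterate_stable; lia.
    + apply iterate_stable; lia.
  - destruct (Nat.le_ge_cases (i + j) n).
    + symmetry; apply iterate_stable; lia.
    + apply iterate_stable; lia.
Qed.

Lemma fixpt_low : low fixpt.
Proof.
  split; intros i j Hij; simpl; destruct (iterate_low (i + j)) as [H1 H2]; auto.
Qed.

(** Both sides agree with [iterate (S n)] below degree n + 3, for every n. *)
Lemma fixpt_eq : fixpt = picard fixpt.
Proof.
  assert (H : forall n, agree n fixpt (picard fixpt)).
  { intros n.
    destruct (fixpt_it (S n)) as [A1 A2].
    destruct (picard_agree fixpt_low (iterate_low n) (fixpt_it n)) as [B1 B2].
    split; apply val_sub_coef; intros i j Hij.
    - rewrite (proj1 (val_sub_coef _ _ _) A1 i j) by lia.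
      symmetry; apply (proj1 (val_sub_coef _ _ _) B1 i j); lia.
    - rewrite (proj1 (val_sub_coef _ _ _) A2 i j) by lia.
      symmetry; apply (proj1 (val_sub_coef _ _ _) B2 i j); lia. }
  apply injective_projections; apply val_eq; intros k; apply H.
Qed.

(** The radius 4 / K is the weighted norm of the monomials p and q: the corrections may be as large
    as the identity part, and U, V have norm at most 8 / K. Continuity in time is carried along
    because the Duhamel integrals need it. *)
Definition bounded (K : R) (w : SS * SS) : Prop :=
  (SScont (fst w) /\ wbound K beta (4 / K) (fst w)) /\
  (SScont (snd w) /\ wbound K beta (4 / K) (snd w)).

Lemma bounded_UV K w : 0 < K -> bounded K w ->
  (SScont (var_p Fn + fst w)%cr /\ wbound K 0 (8 / K) (var_p Fn + fst w)%cr) /\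
  (SScont (var_q Fn + snd w)%cr /\ wbound K 0 (8 / K) (var_q Fn + snd w)%cr).
Proof.
  intros HK [[C1 B1] [C2 B2]].
  assert (E : forall a b, wbound K 0 (4 / K) a -> wbound K beta (4 / K) b -> wbound K 0 (8 / K) (a + b)%cr).
  { intros a b Ha Hb; replace (8 / K) with (4 / K + 4 / K) by (field; lra).
    apply wbound_add; [easy|]; apply (wbound_le HK) with (3 := Hb); lra. }
  refine (conj (conj _ (E _ _ (wbound_var_p HK) B1)) (conj _ (E _ _ (wbound_var_q HK) B2)));
    intros i j; apply ccont_add; [apply SScont_var_p|apply C1|apply SScont_var_q|apply C2].
Qed.

(** The right-hand sides are quadratic in 8 / K while the radius of the ball is linear in 1 / K, so
    both numerical conditions hold for large K. *)
Lemma picard_bounded K w : 0 < K -> 2 * (64 * (8 / K) * (2 * L)) <= 1 ->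
  2 * (256 * (G * L) * (2 * (64 * (8 / K) * (2 * L))) ^ 2) / beta <= 4 / K ->
  bounded K w -> bounded K (picard w).
Proof.
  intros HK Hx HB Hw.
  destruct (bounded_UV HK Hw) as [[CU BU] [CV BV]].
  assert (HL2 : 0 <= 2 * L) by lra.
  assert (HL0 : 0 <= L) by lra.
  assert (Cp : SScont (rhsV w)).
  { apply SScont_comp; auto; intros; apply nsm_cont, Hfc. }
  assert (Cq : SScont (rhsU w)).
  { intros i j; apply ccont_opp.
    exact (SScont_comp (g := gq f) (fun a b => nsm_cont (S b) (Hfc a (S b))) CU CV i j). }
  assert (Bp := comp_wbound HK (k := 2) HL2 Hx
    (fun a b t Ht => proj1 (gp_bound HL0 Hfb a b Ht)) gp0 BU BV).
  assert (Bq := wbound_opp (comp_wbound HK (k := 2) HL2 Hx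
    (fun a b t Ht => proj2 (gp_bound HL0 Hfb a b Ht)) gq0 BU BV)).
  refine (conj (conj _ _) (conj _ _)).
  - now apply solve_cont.
  - apply (wbound_le HK) with (mu := beta) (3 := solve_wbound HK (or_introl eq_refl) Cq Bq); [lra|easy].
  - now apply solve_cont.
  - apply (wbound_le HK) with (mu := beta) (3 := solve_wbound HK (or_intror eq_refl) Cp Bp); [lra|easy].
Qed.

Lemma fixpt_bounded : exists K, 1 <= K /\ 2 * (64 * (8 / K) * (2 * L)) <= 1 /\ bounded K fixpt.
Proof.
  assert (HG : 0 <= G).
  { assert (H := Hfb O O (Rle_refl 0)); rewrite Rmult_0_r, exp_0 in H; simpl in H.
    pose proof (Cmod_ge0 (f O O 0)); lra. }
  (* Chosen so that the second condition of [picard_bounded] becomes A / K <= 1; the first one is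
     2048 L <= K. *)
  set (A := 128 * (G * L) * (2048 * L) ^ 2 / beta).
  assert (HA : 0 <= A).
  { apply Rdiv_le_0_compat; [|easy]; repeat apply Rmult_le_pos; try lra. }
  set (K := A + 2048 * L + 1).
  assert (HK : 0 < K) by (unfold K; lra).
  assert (Hx : 2 * (64 * (8 / K) * (2 * L)) <= 1).
  { replace (2 * (64 * (8 / K) * (2 * L))) with (2048 * L / K) by (field; lra).
    apply Rle_div_l; [easy|]; unfold K; lra. }
  assert (HB : 2 * (256 * (G * L) * (2 * (64 * (8 / K) * (2 * L))) ^ 2) / beta <= 4 / K).
  { replace (2 * (256 * (G * L) * (2 * (64 * (8 / K) * (2 * L))) ^ 2) / beta)
      with (4 / K * (A / K)) by (unfold A; field; lra).
    rewrite <- (Rmult_1_r (4 / K)) at 2.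
    apply Rmult_le_compat_l; [apply Rdiv_le_0_compat; lra|].
    apply Rle_div_l; [easy|]; unfold K; lra. }
  exists K; split; [unfold K; lra|split; [exact Hx|]].
  assert (H : forall n, bounded K (iterate n)).
  { induction n as [|n IH]; [|now apply picard_bounded].
    assert (H0 : SScont (0 : SS)%cr /\ wbound K beta (4 / K) (0 : SS)%cr).
    { split; [intros i j; exact (ccont_const C0)|]; intros i j t Ht.
      change (Cmod C0 <= 4 / K * wt2 K i j * exp (- beta * t)); rewrite Cmod_C0.
      apply Rmult_le_pos; [|apply Rlt_le, exp_pos].
      apply Rmult_le_pos; [apply Rdiv_le_0_compat; lra|apply Rlt_le, (wt2_pos HK)]. }
    now split. }
  (* Each coefficient of [fixpt] is a coefficient of an iterate, so the bounds carry over without a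
     limit argument. *)
  refine (conj (conj _ _) (conj _ _)); intros i j; simpl;
    destruct (H (i + j)%nat) as [[H1 H2] [H3 H4]]; auto.
Qed.

(** Gathers what the later parts use about the fixed point under a single constant C. The bounds for
    the compositions are taken with k = 0, since from here on boundedness is enough. *)
Lemma series_solution : exists (u v : SS) (K C : R),
  let U := (var_p Fn + u)%cr in let V := (var_q Fn + v)%cr in
  1 <= K /\ val 2 u /\ val 2 v /\
  ((forall i j t, cder (u i j) t
     ((- comp (gq f) U V)%cr i j t - RtoC (lam 1 i j) * u i j t)%cx) /\
   (forall i j t, cder (v i j) t
     (comp (gp f) U V i j t - RtoC (lam (-1) i j) * v i j t)%cx)) /\
  ((forall i j, 0 < lam 1 i j -> u i j 0 = C0) /\
   (forall i j, 0 < lam (-1) i j -> v i j 0 = C0)) /\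
  (wbound K beta C u /\ wbound K beta C v) /\
  (wbound K 0 C U /\ wbound K 0 C V /\ gbound K C (comp (gp f) U V) /\ gbound K C (comp (gq f) U V)) /\
  (gbound K C (comp f U V) /\ forall N, gbound K C (csum f U V N)).
Proof.
  destruct fixpt_bounded as [K [HK1 [Hx Hb]]].
  assert (HK : 0 < K) by lra.
  destruct (bounded_UV HK Hb) as [[CU BU] [CV BV]].
  assert (HL2 : 0 <= 2 * L) by lra.
  assert (HL0 : 0 <= L) by lra.
  assert (Cp : SScont (rhsV fixpt)).
  { apply SScont_comp; auto; intros; apply nsm_cont, Hfc. }
  assert (Cq : SScont (rhsU fixpt)).
  { intros i j; apply ccont_opp.
    exact (SScont_comp (g := gq f) (fun a b => nsm_cont (S b) (Hfc a (S b))) CU CV i j). }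
  assert (Z : forall g : nat -> nat -> Fn, forall a b, (a + b < 0)%nat -> g a b = fun _ => C0)
    by (intros; lia).
  assert (Bp := comp_wbound HK (k := 0) HL2 Hx
    (fun a b t Ht => proj1 (gp_bound HL0 Hfb a b Ht)) (Z _) BU BV).
  assert (Bq := comp_wbound HK (k := 0) HL2 Hx
    (fun a b t Ht => proj2 (gp_bound HL0 Hfb a b Ht)) (Z _) BU BV).
  assert (Hx1 : 2 * (64 * (8 / K) * L) <= 1).
  { assert (0 <= 8 / K) by (apply Rdiv_le_0_compat; lra); nra. }
  assert (Bf := comp_wbound HK (k := 0) HL0 Hx1 Hfb (Z f) BU BV).
  assert (Bs := fun N => csum_wbound HK (k := 0) N HL0 Hx1 Hfb (Z f) BU BV).
  cbn [pow] in Bp, Bq, Bf, Bs; rewrite Rmult_1_r in Bp, Bq, Bf.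
  destruct fixpt_low as [L1 L2].
  assert (E1 := f_equal fst fixpt_eq); assert (E2 := f_equal snd fixpt_eq).
  unfold picard in E1, E2; cbn [fst] in E1; cbn [snd] in E2.
  set (C := 8 / K + 256 * (G * L) + 256 * G).
  assert (H8 : 0 < 8 / K) by (apply Rdiv_lt_0_compat; lra).
  assert (HG := wbound_nonneg HK Bf); assert (HG' := wbound_nonneg HK Bp).
  assert (W : forall mu c s, c <= C -> 0 <= mu -> wbound K mu c s -> gbound K C s).
  { intros mu c s Hc Hmu H; apply (wbound_gbound HK Hmu), (wbound_le HK) with (3 := H); [lra|easy]. }
  exists (fst fixpt), (snd fixpt), K, C.
  split; [exact HK1|]; split; [exact L1|]; split; [exact L2|].
  split; [split|split; [split|split; [split|split]]].
  - intros i j t; assert (H := solve_cder 1 i j t Cq); rewrite <- E1 in H; exact H.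
  - intros i j t; assert (H := solve_cder (-1) i j t Cp); rewrite <- E2 in H; exact H.
  - intros i j H; rewrite E1; now apply solve_0.
  - intros i j H; rewrite E2; now apply solve_0.
  - destruct Hb as [[_ H] _]; apply (wbound_le HK) with (3 := H); [lra|].
    unfold C; replace (4 / K) with (8 / K / 2) by (field; lra); lra.
  - destruct Hb as [_ [_ H]]; apply (wbound_le HK) with (3 := H); [lra|].
    unfold C; replace (4 / K) with (8 / K / 2) by (field; lra); lra.
  - split; [|split; [|split]].
    + apply (wbound_le HK) with (3 := BU); unfold C; lra.
    + apply (wbound_le HK) with (3 := BV); unfold C; lra.
    + apply W with (3 := Bp); unfold C; lra.
    + apply W with (3 := Bq); unfold C; lra.
  - split; [apply W with (3 := Bf); unfold C; lra|].
    intros N; assert (B := Bs N); rewrite Rmult_1_r in B; apply W with (3 := B); unfold C; lra.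
Qed.
End Construction.

(** Multiplication by exp(- mu t) turns the equation into a vanishing derivative. *)
Lemma cder_ode (y : R -> Cx) mu : (forall t, cder y t (RtoC mu * y t)%cx) ->
  forall t, y t = (RtoC (exp (mu * t)) * y 0)%cx.
Proof.
  intros Hy t.
  assert (W : forall z : R -> R, (forall t, is_derive z t (mu * z t)) ->
    z t = exp (mu * t) * z 0).
  { intros z Hz.
    set (h := fun s => exp (- mu * s) * z s).
    assert (Hh : forall s, is_derive h s 0).
    { intros s.
      assert (HE : is_derive (fun s => exp (- mu * s)) s (- mu * exp (- mu * s))).
      { auto_derive; [easy|ring]. }
      replace 0 with (- mu * exp (- mu * s) * z s + exp (- mu * s) * (mu * z s)) by ring.
      exact (is_derive_mult _ _ s _ _ HE (Hz s)). }
    assert (Hc : forall a b, a <= b -> h b = h a).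
    { intros a b Hab.
      assert (H := @dom_incr h (fun _ => 0) (fun _ => 0) (fun _ => 0) a b Hab
        (fun s _ => Hh s) (fun s _ => @is_derive_const R_AbsRing R_NormedModule 0 s)
        (fun s _ => Req_le _ _ Rabs_R0)).
      pose proof (Rabs_pos (h b - h a)).
      assert (E : Rabs (h b - h a) = 0) by lra.
      destruct (Req_dec (h b - h a) 0) as [E0|N]; [lra|].
      apply Rabs_no_R0 in N; lra. }
    assert (E : h t = h 0).
    { destruct (Rle_dec 0 t); [now apply Hc|symmetry; apply Hc; lra]. }
    unfold h in E; rewrite Rmult_0_r, exp_0, Rmult_1_l in E; rewrite <- E.
    rewrite <- Rmult_assoc, <- exp_plus.
    replace (mu * t + - mu * t) with 0 by ring; rewrite exp_0; ring. }
  apply Cx_ext; simpl.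
  - rewrite (W (fun s => fst (y s))); [ring|].
    intros s; destruct (Hy s) as [H _]; simpl in H.
    replace (mu * fst (y s)) with (mu * fst (y s) - 0 * snd (y s)) by ring; exact H.
  - rewrite (W (fun s => snd (y s))); [ring|].
    intros s; destruct (Hy s) as [_ H]; simpl in H.
    replace (mu * snd (y s)) with (mu * snd (y s) + 0 * fst (y s)) by ring; exact H.
Qed.

(** * Symplecticity *)

Section Symplectic.
Variables omega beta : R.
Hypothesis Homega : 0 < omega.
Hypothesis Hbeta : 0 < beta.
Add Ring SSring : (rth SS).

Definition omega_s : SS := inj (A := Fn) (fun _ => RtoC omega).
Definition xweight (i j : nat) : R := omega * (INR j - INR i).

(* [isX a x]: the image of a under X = d/dt - omega p d/dp + omega q d/dq is x. *)
Definition isX (a x : SS) : Prop := forall i j t,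
  cder (a i j) t (x i j t - RtoC (xweight i j) * a i j t)%cx.

Lemma omega_s_mul s i j t : (omega_s * s)%cr i j t = (RtoC omega * s i j t)%cx.
Proof.
  exact (f_equal (fun x => x t) (inj_mul (A := Fn) (fun _ => RtoC omega) s i j)).
Qed.

Lemma RtoC_mult x y : RtoC (x * y) = (RtoC x * RtoC y)%cx.
Proof. apply Cx_ext; simpl; ring. Qed.
Lemma RtoC_plus x y : RtoC (x + y) = (RtoC x + RtoC y)%cx.
Proof. apply Cx_ext; simpl; ring. Qed.
Lemma RtoC_minus x y : RtoC (x - y) = (RtoC x - RtoC y)%cx.
Proof. apply Cx_ext; simpl; ring. Qed.

Lemma isX_add a b x y : isX a x -> isX b y -> isX (a + b)%cr (x + y)%cr.
Proof.
  intros Ha Hb i j t; assert (H := cder_add (Ha i j t) (Hb i j t)).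
  eapply cder_ext; [|exact H].
  change ((x + y)%cr i j t) with (x i j t + y i j t)%cx.
  change ((a + b)%cr i j t) with (a i j t + b i j t)%cx; ring.
Qed.

Lemma isX_opp a x : isX a x -> isX (- a)%cr (- x)%cr.
Proof.
  intros Ha i j t; assert (H := cder_cmul (- C1)%cx (Ha i j t)).
  replace ((- a)%cr i j) with (fun s => (- C1) * a i j s)%cx.
  - eapply cder_ext; [|exact H].
    change ((- x)%cr i j t) with (- x i j t)%cx; ring.
  - apply functional_extensionality; intros s.
    change ((- C1) * a i j s = - a i j s)%cx; ring.
Qed.

Lemma isX_sub a b x y : isX a x -> isX b y -> isX (a - b)%cr (x - y)%cr.
Proof.
  intros Ha Hb; replace (a - b)%cr with (a + - b)%cr by ring.
  replace (x - y)%cr with (x + - y)%cr by ring; auto using isX_add, isX_opp.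
Qed.

(** [xweight] is additive in the exponents and d/dt obeys the Leibniz rule, so X is a derivation. *)
Lemma isX_mul a b x y : isX a x -> isX b y -> isX (a * b)%cr (x * b + a * y)%cr.
Proof.
  intros Ha Hb i j t.
  refine (@cauchy2_ind3 Fn Fn Fn (fun z z1 z2 =>
    cder z t (z1 t + z2 t - RtoC (xweight i j) * z t)%cx) _ i j a b x b a y _).
  - intros z z' z1 z1' z2 z2' H H'.
    eapply cder_ext; [|exact (cder_add H H')].
    change ((z + z')%cr t) with (z t + z' t)%cx.
    change ((z1 + z1')%cr t) with (z1 t + z1' t)%cx.
    change ((z2 + z2')%cr t) with (z2 t + z2' t)%cx; ring.
  - intros k l m n <- <-.
    eapply cder_ext; [|exact (cder_mul (Ha k m t) (Hb l n t))].
    change ((x k m * b l n)%cr t) with (x k m t * b l n t)%cx.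
    change ((a k m * y l n)%cr t) with (a k m t * y l n t)%cx.
    change ((a k m * b l n)%cr t) with (a k m t * b l n t)%cx.
    replace (xweight (k + l) (m + n)) with (xweight k m + xweight l n)
      by (unfold xweight; rewrite !plus_INR; ring).
    rewrite RtoC_plus; ring.
Qed.

Lemma nsm_cder n (x : Fn) t d : cder x t d -> cder (nsm n x) t (RtoC (INR n) * d)%cx.
Proof.
  intros H; replace (nsm n x : R -> Cx) with (fun s => RtoC (INR n) * x s)%cx.
  - now apply cder_cmul.
  - apply functional_extensionality; intros s; symmetry; apply nsm_Fn.
Qed.

(** The commutator of X with d/dp is omega d/dp, since [xweight] changes by omega when i changes by
    one. With d/dq the sign is opposite, and the two corrections cancel in the Jacobian. *)
Lemma isX_dp a x : isX a x -> isX (dp a) (dp x + omega_s * dp a)%cr.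
Proof.
  intros Ha i j t.
  change ((dp x + omega_s * dp a)%cr i j t) with (dp x i j t + (omega_s * dp a)%cr i j t)%cx.
  rewrite omega_s_mul, !dp_coef, !nsm_Fn.
  eapply cder_ext; [|exact (nsm_cder (S i) (Ha (S i) j t))].
  replace (xweight (S i) j) with (xweight i j - omega) by (unfold xweight; rewrite S_INR; ring).
  rewrite RtoC_minus; ring.
Qed.

Lemma isX_dq a x : isX a x -> isX (dq a) (dq x - omega_s * dq a)%cr.
Proof.
  intros Ha i j t.
  change ((dq x - omega_s * dq a)%cr i j t) with (dq x i j t - (omega_s * dq a)%cr i j t)%cx.
  rewrite omega_s_mul, !dq_coef, !nsm_Fn.
  eapply cder_ext; [|exact (nsm_cder (S j) (Ha i (S j) t))].
  replace (xweight i (S j)) with (xweight i j + omega) by (unfold xweight; rewrite S_INR; ring).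
  rewrite RtoC_plus; ring.
Qed.

Lemma isX_single (a x : SS) (k : R) i0 j0 :
  (forall i j, a i j = fun _ => if andb (Nat.eqb i i0) (Nat.eqb j j0) then C1 else C0) ->
  xweight i0 j0 = k -> (forall i j t, x i j t = RtoC k * a i j t)%cx -> isX a x.
Proof.
  intros Ha Hk Hx i j t; rewrite Hx, Ha.
  eapply cder_ext; [|apply cder_const].
  destruct (andb _ _) eqn:B; [|apply Cx_ext; simpl; ring].
  apply andb_prop in B; destruct B as [B1 B2].
  apply Nat.eqb_eq in B1; apply Nat.eqb_eq in B2; subst; apply Cx_ext; simpl; ring.
Qed.

Lemma isX_var_p : isX (var_p Fn) (- (omega_s * var_p Fn))%cr.
Proof.
  apply isX_single with (- omega) 1%nat O.
  - now intros [|[|i]] [|j].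
  - unfold xweight; simpl; ring.
  - intros i j t; change ((- (omega_s * var_p Fn))%cr i j t) with (- (omega_s * var_p Fn)%cr i j t)%cx.
    rewrite omega_s_mul; apply Cx_ext; simpl; ring.
Qed.

Lemma isX_var_q : isX (var_q Fn) (omega_s * var_q Fn)%cr.
Proof.
  apply isX_single with omega O 1%nat.
  - now intros [|i] [|[|j]].
  - unfold xweight; simpl; ring.
  - intros i j t; apply omega_s_mul.
Qed.

Lemma isX_one : isX 1%cr 0%cr.
Proof.
  apply isX_single with 0 O O.
  - now intros [|i] [|j].
  - unfold xweight; simpl; ring.
  - intros i j t; generalize ((1 : SS)%cr i j t : Cx); intros z.
    change (C0 = (RtoC 0 * z)%cx); apply Cx_ext; simpl; ring.
Qed.

(** * Uniqueness for X s = 0 *)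

(** The constant may depend on the coefficient: uniqueness is coefficientwise, and the class is then
    stable under d/dp and d/dq without a change of K. *)
Definition decays (s : SS) : Prop := forall i j, exists C, forall t, 0 <= t ->
  Cmod (s i j t) <= C * exp (- beta * t).

Lemma decays_add a b : decays a -> decays b -> decays (a + b)%cr.
Proof.
  intros Ha Hb i j; destruct (Ha i j) as [C HC]; destruct (Hb i j) as [D HD].
  exists (C + D); intros t Ht.
  eapply Rle_trans; [apply (Cmod_triangle (a i j t) (b i j t))|].
  specialize (HC t Ht); specialize (HD t Ht); lra.
Qed.

Lemma decays_opp a : decays a -> decays (- a)%cr.
Proof.
  intros Ha i j; destruct (Ha i j) as [C HC]; exists C; intros t Ht.
  change (Cmod (- a i j t)%cx <= C * exp (- beta * t)); rewrite Cmod_opp; auto.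
Qed.

Lemma decays_mul a b : decays a -> decays b -> decays (a * b)%cr.
Proof.
  intros Ha Hb i j.
  refine (@cauchy2_ind3 Fn Fn Fn (fun z _ _ => exists C, forall t, 0 <= t ->
    Cmod (z t) <= C * exp (- beta * t)) _ i j a b a b a b _).
  - intros x x' _ _ _ _ [C HC] [D HD]; exists (C + D); intros t Ht.
    eapply Rle_trans; [apply (Cmod_triangle (x t) (x' t))|].
    specialize (HC t Ht); specialize (HD t Ht); lra.
  - intros k l m n _ _; destruct (Ha k m) as [C HC]; destruct (Hb l n) as [D HD].
    exists (C * D); intros t Ht.
    change (Cmod (a k m t * b l n t)%cx <= C * D * exp (- beta * t)); rewrite Cmod_mult.
    specialize (HC t Ht); specialize (HD t Ht).
    assert (He : 0 < exp (- beta * t) <= 1).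
    { split; [apply exp_pos|]; rewrite <- exp_0.
      destruct (Rle_lt_or_eq_dec _ _ Ht) as [L|<-].
      - left; apply exp_increasing; nra.
      - rewrite Rmult_0_r; lra. }
    set (x := exp (- beta * t)) in *.
    apply Rle_trans with (C * x * (D * x)).
    + apply Rmult_le_compat; auto; apply Cmod_ge0.
    + assert (HC0 : 0 <= C * x) by (eapply Rle_trans; [apply Cmod_ge0|exact HC]).
      assert (HD0 : 0 <= D * x) by (eapply Rle_trans; [apply Cmod_ge0|exact HD]).
      assert (0 <= D) by nra; assert (0 <= C) by nra.
      replace (C * x * (D * x)) with (C * D * x * x) by ring.
      rewrite <- (Rmult_1_r (C * D * x)) at 2.
      apply Rmult_le_compat_l; [|lra]; repeat apply Rmult_le_pos; lra.
Qed.

Lemma nsm_decays n (x : Fn) C : (forall t, 0 <= t -> Cmod (x t) <= C * exp (- beta * t)) ->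
  exists D, forall t, 0 <= t -> Cmod (nsm n x t) <= D * exp (- beta * t).
Proof.
  intros H; exists (INR n * C); intros t Ht; rewrite nsm_Fn, Cmod_mult, Cmod_RtoC.
  rewrite Rabs_pos_eq, Rmult_assoc by apply pos_INR.
  apply Rmult_le_compat_l; [apply pos_INR|auto].
Qed.

Lemma decays_dp a : decays a -> decays (dp a).
Proof.
  intros Ha i j; destruct (Ha (S i) j) as [C HC].
  rewrite dp_coef; exact (nsm_decays (S i) HC).
Qed.

Lemma decays_dq a : decays a -> decays (dq a).
Proof.
  intros Ha i j; destruct (Ha i (S j)) as [C HC].
  rewrite dq_coef; exact (nsm_decays (S j) HC).
Qed.

(** At t = 0 only monomials with i - j >= n - m survive, written without subtraction. Offsets add
    under multiplication, so those of [dq u] and [dp v] cancel in their product. *)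
Definition supp0 (m n : nat) (s : SS) : Prop :=
  forall i j, (i + m < j + n)%nat -> s i j 0 = C0.

Lemma supp0_add m n a b : supp0 m n a -> supp0 m n b -> supp0 m n (a + b)%cr.
Proof.
  intros Ha Hb i j H; change (a i j 0 + b i j 0 = C0)%cx; rewrite Ha, Hb by easy; ring.
Qed.

Lemma supp0_opp m n a : supp0 m n a -> supp0 m n (- a)%cr.
Proof. intros Ha i j H; change (- a i j 0 = C0)%cx; rewrite Ha by easy; ring. Qed.

Lemma supp0_mul m n m' n' a b : supp0 m n a -> supp0 m' n' b -> supp0 (m + m') (n + n') (a * b)%cr.
Proof.
  intros Ha Hb i j H.
  refine (@cauchy2_ind3 Fn Fn Fn (fun z _ _ => z 0 = C0) _ i j a b a b a b _).
  - intros x x' _ _ _ _ E E'; change (x 0 + x' 0 = C0)%cx; rewrite E, E'; ring.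
  - intros k l k' l' <- <-; change (a k k' 0 * b l l' 0 = C0)%cx.
    destruct (Nat.lt_ge_cases (k + m) (k' + n)).
    + rewrite Ha by easy; ring.
    + rewrite Hb by lia; ring.
Qed.

Lemma isX_unique s : isX s 0%cr -> decays s -> supp0 0 0 s -> s = 0%cr.
Proof.
  intros HX Hd Hs; apply S2_ext; intros i j.
  apply functional_extensionality; intros t; change (s i j t = C0).
  assert (E : forall t, s i j t = (RtoC (exp (- xweight i j * t)) * s i j 0)%cx).
  { apply cder_ode; intros t'; eapply cder_ext; [|apply HX].
    change ((0 : SS)%cr i j t') with C0.
    apply Cx_ext; simpl; ring. }
  assert (E0 : s i j 0 = C0).
  { destruct (Nat.lt_ge_cases i j) as [H|H]; [apply Hs; lia|].
    destruct (Hd i j) as [C HC].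
    apply Cmod_eq0, Rle_antisym; [|apply Cmod_ge0].
    apply le_eps; intros e He.
    assert (HC0 : 0 <= C).
    { specialize (HC 0 (Rle_refl 0)); rewrite Rmult_0_r, exp_0 in HC.
      pose proof (Cmod_ge0 (s i j 0)); lra. }
    (* At this time exp(beta T) >= 1 + beta T > C / e, so the decay bound drops below e. *)
    set (T := C / (e * beta)).
    assert (Heb : 0 < e * beta) by nra.
    assert (HT : 0 <= T) by (now apply Rdiv_le_0_compat).
    specialize (HC T HT); rewrite E, Cmod_mult, Cmod_RtoC in HC.
    assert (H1 : 1 <= exp (- xweight i j * T)).
    { apply Rle_trans with (1 + - xweight i j * T); [|apply exp_ineq1_le].
      apply le_INR in H.
      assert (xweight i j <= 0) by (unfold xweight; nra).
      nra. }
    rewrite Rabs_pos_eq in HC by lra.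
    assert (H2 : Cmod (s i j 0) <= C * exp (- beta * T)).
    { eapply Rle_trans; [|exact HC]; pose proof (Cmod_ge0 (s i j 0)); nra. }
    assert (H3 : C * exp (- beta * T) <= e); [|lra].
    replace (- beta * T) with (- (beta * T)) by ring; rewrite exp_Ropp.
    apply Rle_div_l; [apply exp_pos|].
    assert (H4 := exp_ineq1_le (beta * T)).
    assert (EC : C = e * (beta * T)) by (unfold T; field; split; lra).
    nra. }
  rewrite E, E0; ring.
Qed.

(** * The Jacobian and the canonical relations *)

Section Conjugation.
Variable f : nat -> nat -> Fn.
Variables u v : SS.
Let U : SS := (var_p Fn + u)%cr.
Let V : SS := (var_q Fn + v)%cr.
Let P : SS := comp (gp f) U V.
Let Q : SS := comp (gq f) U V.
Hypothesis Hu2 : val 2 u.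
Hypothesis Hv2 : val 2 v.
Hypothesis HdU : forall i j t, cder (u i j) t
  ((- Q)%cr i j t - RtoC (lam omega 1 i j) * u i j t)%cx.
Hypothesis HdV : forall i j t, cder (v i j) t
  (P i j t - RtoC (lam omega (-1) i j) * v i j t)%cx.
Hypothesis Hu0 : forall i j, 0 < lam omega 1 i j -> u i j 0 = C0.
Hypothesis Hv0 : forall i j, 0 < lam omega (-1) i j -> v i j 0 = C0.
Hypothesis Hdu : decays u.
Hypothesis Hdv : decays v.

(** Hamilton's equations p' = - H_q, q' = H_p for omega p q + F, read along (U, V): [isX_U] and
    [isX_V] express that the map carries the linear flow to the flow of H. *)
Definition XU : SS := (- (omega_s * U) - Q)%cr.
Definition XV : SS := (omega_s * V + P)%cr.

Lemma isX_U : isX U XU.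
Proof.
  replace XU with (- (omega_s * var_p Fn) + (- Q - omega_s * u))%cr by (unfold XU, U; ring).
  apply isX_add; [exact isX_var_p|]; intros i j t.
  eapply cder_ext; [|exact (HdU i j t)].
  change ((- Q - omega_s * u)%cr i j t) with ((- Q)%cr i j t - (omega_s * u)%cr i j t)%cx.
  rewrite omega_s_mul.
  replace (lam omega 1 i j) with (xweight i j + omega) by (unfold lam, xweight; ring).
  rewrite RtoC_plus; ring.
Qed.

Lemma isX_V : isX V XV.
Proof.
  replace XV with (omega_s * var_q Fn + (P + omega_s * v))%cr by (unfold XV, V; ring).
  apply isX_add; [exact isX_var_q|]; intros i j t.
  eapply cder_ext; [|exact (HdV i j t)].
  change ((P + omega_s * v)%cr i j t) with (P i j t + (omega_s * v)%cr i j t)%cx.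
  rewrite omega_s_mul.
  replace (lam omega (-1) i j) with (xweight i j - omega) by (unfold lam, xweight; ring).
  rewrite RtoC_minus; ring.
Qed.

Lemma val_UV : val 1 U /\ val 1 V.
Proof.
  split; apply val_add; try exact val_var_p; try exact val_var_q;
    (apply val_le with 2%nat; [lia|easy]).
Qed.

Lemma gp_gq : gp (gq f) = gq (gp f).
Proof.
  apply functional_extensionality; intros a; apply functional_extensionality; intros b.
  apply nsm_comm.
Qed.

(* The coefficient of p^i q^j in J - 1 is a multiple of exp (omega (i - j) t): it vanishes for
   i >= j because J - 1 decays, and for i < j because of the initial values at t = 0. *)
Lemma jacobian_one : (dp U * dq V - dq U * dp V)%cr = (1 : SS)%cr.
Proof.
  destruct val_UV as [HU HV].
  assert (Dp := dp_derivation Fn); assert (Dq := dq_derivation Fn).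
  assert (CP := chain_rule (gp f) Dp (@val_dp Fn) HU HV).
  assert (CP' := chain_rule (gp f) Dq (@val_dq Fn) HU HV).
  assert (CQ := chain_rule (gq f) Dp (@val_dp Fn) HU HV).
  assert (CQ' := chain_rule (gq f) Dq (@val_dq Fn) HU HV).
  rewrite gp_gq in CQ, CQ'; fold P in CP, CP'; fold Q in CQ, CQ'.
  set (Fpp := comp (gp (gp f)) U V) in *; set (Fpq := comp (gq (gp f)) U V) in *.
  set (Fqq := comp (gq (gq f)) U V) in *.
  assert (Ddp : forall s, dp (omega_s * s)%cr = (omega_s * dp s)%cr).
  { intros s; rewrite (der_mul Dp); unfold omega_s; rewrite (der_inj Dp); ring. }
  assert (Ddq : forall s, dq (omega_s * s)%cr = (omega_s * dq s)%cr).
  { intros s; rewrite (der_mul Dq); unfold omega_s; rewrite (der_inj Dq); ring. }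
  assert (Sp : forall s s' : SS, dp (s - s')%cr = (dp s - dp s')%cr).
  { intros s s'; replace (s - s')%cr with (s + - s')%cr by ring.
    rewrite (der_add Dp), (der_opp Dp); ring. }
  assert (Sq : forall s s' : SS, dq (s - s')%cr = (dq s - dq s')%cr).
  { intros s s'; replace (s - s')%cr with (s + - s')%cr by ring.
    rewrite (der_add Dq), (der_opp Dq); ring. }
  (* The linearised Hamiltonian field has trace 0: the terms with [Fpq] cancel, and so do the two
     commutator terms with omega. *)
  assert (XJ : isX (dp U * dq V - dq U * dp V - 1)%cr 0%cr).
  { assert (HX := isX_sub (isX_sub (isX_mul (isX_dp isX_U) (isX_dq isX_V))
       (isX_mul (isX_dq isX_U) (isX_dp isX_V))) isX_one).
    match type of HX with isX _ ?x => replace x with (0 : SS)%cr in HX; [exact HX|] end.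
    unfold XU, XV; rewrite !Sp, !Sq, !(der_add Dp), !(der_add Dq), !(der_opp Dp), !(der_opp Dq),
      !Ddp, !Ddq, CP, CP', CQ, CQ'; ring. }
  assert (EJ : (dp U * dq V - dq U * dp V - 1)%cr =
     (dp u + dq v + dp u * dq v + - (dq u * dp v))%cr).
  { unfold U, V; rewrite !(der_add Dp), !(der_add Dq), dp_var_p, dp_var_q, dq_var_p, dq_var_q; ring. }
  assert (Z : (dp U * dq V - dq U * dp V - 1)%cr = (0 : SS)%cr).
  { apply isX_unique; [exact XJ| |]; rewrite EJ.
    - apply decays_add; [apply decays_add; [apply decays_add|apply decays_mul]|apply decays_opp, decays_mul];
        (apply decays_dp || apply decays_dq); assumption.
    - assert (Hn : forall n (x : Fn), x 0 = C0 -> nsm n x 0 = C0).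
      { intros n x Hx; rewrite nsm_Fn, Hx; ring. }
      assert (Lu : forall i j, (i <= j)%nat -> u i j 0 = C0).
      { intros i j H; apply Hu0; unfold lam; apply le_INR in H; nra. }
      assert (Lv : forall i j, (i + 2 <= j)%nat -> v i j 0 = C0).
      { intros i j H; apply Hv0; unfold lam; apply le_INR in H.
        rewrite plus_INR in H; simpl in H; nra. }
      assert (U1 : supp0 0 0 (dp u)).
      { intros i j H; rewrite dp_coef; apply Hn, Lu; lia. }
      assert (V1 : supp0 0 0 (dq v)).
      { intros i j H; rewrite dq_coef; apply Hn, Lv; lia. }
      assert (U2 : supp0 0 2 (dq u)).
      { intros i j H; rewrite dq_coef; apply Hn, Lu; lia. }
      assert (V2 : supp0 2 0 (dp v)).
      { intros i j H; rewrite dp_coef; apply Hn, Lv; lia. }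
      assert (W2 : supp0 0 0 (dq u * dp v)%cr).
      { intros i j H; apply (supp0_mul U2 V2); lia. }
      exact (supp0_add (supp0_add (supp0_add U1 V1) (supp0_mul U1 V1)) (supp0_opp W2)). }
  transitivity (dp U * dq V - dq U * dp V - 1 + 1)%cr; [ring|rewrite Z; ring].
Qed.

(* d/dt of the coefficients, recovered from X by removing its p d/dp and q d/dq parts. *)
Definition TU : SS := (XU - omega_s * var_q Fn * dq U + omega_s * var_p Fn * dp U)%cr.
Definition TV : SS := (XV - omega_s * var_q Fn * dq V + omega_s * var_p Fn * dp V)%cr.
Definition energy : SS := (omega_s * var_p Fn * var_q Fn - omega_s * U * V - comp f U V)%cr.

Lemma isX_time a x : isX a x -> forall i j t,
  cder (a i j) t ((x - omega_s * var_q Fn * dq a + omega_s * var_p Fn * dp a)%cr i j t).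
Proof.
  intros H i j t; eapply cder_ext; [|apply H].
  replace (x - omega_s * var_q Fn * dq a + omega_s * var_p Fn * dp a)%cr
    with (x - omega_s * (var_q Fn * dq a) + omega_s * (var_p Fn * dp a))%cr by ring.
  change ((x - omega_s * (var_q Fn * dq a) + omega_s * (var_p Fn * dp a))%cr i j t) with
    (x i j t - (omega_s * (var_q Fn * dq a))%cr i j t + (omega_s * (var_p Fn * dp a))%cr i j t)%cx.
  assert (Ep : (var_p Fn * dp a)%cr i j = nsm i (a i j)) by exact (var_p_dp a i j).
  assert (Eq : (var_q Fn * dq a)%cr i j = nsm j (a i j)) by exact (var_q_dq a i j).
  rewrite !omega_s_mul, Ep, Eq, !nsm_Fn.
  unfold xweight; rewrite RtoC_mult, RtoC_minus; ring.
Qed.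

(** In this antisymmetric expression the omega p d/dp part of d/dt drops out and the omega q d/dq
    part yields omega q times the Jacobian, which is 1; the rest is the p-derivative of - omega U V
    - F(U, V) by the chain rule. *)
Lemma canonical_p : (dp V * TU - TV * dp U)%cr = dp energy.
Proof.
  destruct val_UV as [HU HV].
  assert (Dp := dp_derivation Fn).
  assert (E : dp energy = (omega_s * var_q Fn - omega_s * (dp U * V + U * dp V) - (P * dp U + Q * dp V))%cr).
  { unfold energy.
    replace (omega_s * var_p Fn * var_q Fn - omega_s * U * V - comp f U V)%cr
      with (omega_s * (var_p Fn * var_q Fn) + - (omega_s * (U * V)) + - comp f U V)%cr by ring.
    rewrite !(der_add Dp), !(der_opp Dp), !(der_mul Dp).
    unfold omega_s; rewrite (der_inj Dp), dp_var_p, dp_var_q.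
    rewrite (chain_rule f Dp (@val_dp Fn) HU HV); fold P; fold Q; ring. }
  rewrite E; unfold TU, TV, XU, XV.
  transitivity (omega_s * var_q Fn * (dp U * dq V - dq U * dp V) - omega_s * (dp U * V + U * dp V)
    - (P * dp U + Q * dp V))%cr; [ring|].
  rewrite jacobian_one; ring.
Qed.

Lemma canonical_q : (dq V * TU - TV * dq U)%cr = dq energy.
Proof.
  destruct val_UV as [HU HV].
  assert (Dq := dq_derivation Fn).
  assert (E : dq energy = (omega_s * var_p Fn - omega_s * (dq U * V + U * dq V) - (P * dq U + Q * dq V))%cr).
  { unfold energy.
    replace (omega_s * var_p Fn * var_q Fn - omega_s * U * V - comp f U V)%cr
      with (omega_s * (var_p Fn * var_q Fn) + - (omega_s * (U * V)) + - comp f U V)%cr by ring.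
    rewrite !(der_add Dq), !(der_opp Dq), !(der_mul Dq).
    unfold omega_s; rewrite (der_inj Dq), dq_var_p, dq_var_q.
    rewrite (chain_rule f Dq (@val_dq Fn) HU HV); fold P; fold Q; ring. }
  rewrite E; unfold TU, TV, XU, XV.
  transitivity (omega_s * var_p Fn * (dp U * dq V - dq U * dp V) - omega_s * (dq U * V + U * dq V)
    - (P * dq U + Q * dq V))%cr; [ring|].
  rewrite jacobian_one; ring.
Qed.
End Conjugation.
End Symplectic.

(** * Passage from series to functions *)

Lemma ev1_zero z : ev1 (fun _ => C0) z = C0.
Proof.
  apply Cx_ext; cbn [ev1 fst snd C0];
    rewrite (Series_ext _ (fun n => 0 * 0)) by (intros; simpl; ring);
    rewrite Series_scal_l; ring.
Qed.

Lemma geo_cst K x : 0 <= K -> geo K (Cmod x) (@cst Cr x).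
Proof.
  intros HK [|n]; simpl; [lra|].
  change (Cmod C0 <= Cmod x * (K * K ^ n)); rewrite Cmod_C0.
  apply Rmult_le_pos; [apply Cmod_ge0|]; apply Rmult_le_pos; [easy|now apply pow_le].
Qed.

Lemma ev1_cst x z : ev1 (@cst Cr x) z = x.
Proof.
  rewrite (@ev1_unfold 0 z (Rle_refl 0) ltac:(lra) (Cmod x) _ (geo_cst x (Rle_refl 0))).
  change (tl (@cst Cr x)) with (fun _ : nat => C0); rewrite ev1_zero.
  change (x + z * C0 = x)%cx; ring.
Qed.

Lemma ev1_shift K C c z : 0 <= K -> K * Cmod z <= 1 / 2 -> geo K C (@shift Cr c) ->
  ev1 (@shift Cr c) z = (z * ev1 c z)%cx.
Proof.
  intros HK Hz H; rewrite (ev1_unfold HK Hz H).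
  change (tl (@shift Cr c)) with (fun n => c n).
  change (C0 + z * ev1 c z = z * ev1 c z)%cx; ring.
Qed.

Section Basics.
Variables (K : R) (p q : Cx) (t : R).
Hypothesis HK : 0 < K.
Hypothesis Hp : K * Cmod p <= 1 / 2.
Hypothesis Hq : K * Cmod q <= 1 / 2.

Lemma geo_shift_one : geo K (/ K) (@shift Cr (1 : ps Cr)%cr).
Proof.
  assert (0 < / K) by (now apply Rinv_0_lt_compat).
  intros [|[|n]].
  - change (Cmod C0 <= / K * 1); rewrite Cmod_C0; lra.
  - change (Cmod C1 <= / K * (K * 1)); rewrite Cmod_C1; right; field; lra.
  - change (Cmod C0 <= / K * K ^ S (S n)); rewrite Cmod_C0.
    apply Rmult_le_pos; [lra|now apply pow_le, Rlt_le].
Qed.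

Lemma ev2_var_p : ev2 (at_t (var_p Fn) t) p q = p.
Proof.
  transitivity (ev1 (@shift Cr (1 : ps Cr)%cr) p).
  - unfold ev2; f_equal; apply functional_extensionality; intros [|[|i]].
    + apply ev1_zero.
    + transitivity (ev1 (@cst Cr C1) q); [|apply ev1_cst].
      f_equal; apply functional_extensionality; now intros [|j].
    + apply ev1_zero.
  - rewrite (ev1_shift (Rlt_le _ _ HK) Hp geo_shift_one).
    change (1%cr : ps Cr) with (@cst Cr C1); rewrite ev1_cst; ring.
Qed.

Lemma ev2_var_q : ev2 (at_t (var_q Fn) t) p q = q.
Proof.
  transitivity (ev1 (@cst Cr (ev1 (@shift Cr (1 : ps Cr)%cr) q)) p).
  - unfold ev2; f_equal; apply functional_extensionality; intros [|i].
    + unfold cst; f_equal; apply functional_extensionality; now intros [|[|j]].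
    + apply ev1_zero.
  - rewrite ev1_cst, (ev1_shift (Rlt_le _ _ HK) Hq geo_shift_one).
    change (1%cr : ps Cr) with (@cst Cr C1); rewrite ev1_cst; ring.
Qed.

Lemma ev2_inj (x : Fn) : ev2 (at_t (inj x) t) p q = x t.
Proof.
  transitivity (ev1 (@cst Cr (ev1 (@cst Cr (x t)) q)) p); [|now rewrite !ev1_cst].
  unfold ev2; f_equal; apply functional_extensionality; intros [|i].
  - unfold cst at 1; f_equal; apply functional_extensionality; now intros [|j].
  - apply ev1_zero.
Qed.

Lemma ev2_one : ev2 (at_t (1 : SS)%cr t) p q = C1.
Proof. exact (ev2_inj (fun _ => C1)). Qed.

Lemma ev_sumr (F : nat -> SS) n : (forall k, exists C, geo2 K C (at_t (F k) t)) ->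
  (exists C, geo2 K C (at_t (sumr F n) t)) /\
  ev2 (at_t (sumr F n) t) p q = Csum (fun k => ev2 (at_t (F k) t) p q) n.
Proof.
  intros HF; induction n as [|n [[C HC] IH]]; [split; [apply HF|reflexivity]|].
  destruct (HF (S n)) as [D HD]; split.
  - exists (C + D); exact (geo2_add HC HD).
  - simpl Csum; rewrite <- IH.
    exact (ev2_add (Rlt_le _ _ HK) Hp Hq HC HD).
Qed.

Lemma ev_inj_mul (x : Fn) (s : SS) C : geo2 K C (at_t s t) ->
  (exists D, geo2 K D (at_t (inj x * s)%cr t)) /\
  ev2 (at_t (inj x * s)%cr t) p q = (x t * ev2 (at_t s t) p q)%cx.
Proof.
  intros H.
  assert (E : at_t (inj x * s)%cr t = fun i j => (x t * at_t s t i j)%cx).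
  { apply (@S2_ext Cr); intros i j; unfold at_t; rewrite inj_mul; reflexivity. }
  rewrite E; split.
  - exists (Cmod (x t) * C); intros i; rewrite Rmult_assoc; exact (geo_scal (x t) (H i)).
  - exact (ev2_scal (Rlt_le _ _ HK) Hp Hq (x t) H).
Qed.
End Basics.

Lemma Csum_ext u v n : (forall k, u k = v k) -> Csum u n = Csum v n.
Proof. intros H; induction n as [|n IH]; simpl; rewrite ?IH, H; reflexivity. Qed.

(** * Evaluation of a substituted series *)

Section Substitution.
Variables (K c : R) (p q : Cx) (t : R) (U V : SS).
Hypothesis HK : 0 < K.
Hypothesis Hp : 2 * K * Cmod p <= 1 / 2.
Hypothesis Hq : 2 * K * Cmod q <= 1 / 2.
Hypothesis Ht : 0 <= t.
Hypothesis HU : wbound K 0 c U.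
Hypothesis HV : wbound K 0 c V.
Let x := ev2 (at_t U t) p q.
Let y := ev2 (at_t V t) p q.

Lemma half_disc z : 2 * K * Cmod z <= 1 / 2 -> K * Cmod z <= 1 / 2.
Proof. pose proof (Cmod_ge0 z); nra. Qed.

(** The weighted norm bounds all powers at the same rate K; repeated use of [geo2_mul] would double
    K for each factor. *)
Lemma ev_pow (s : SS) n : wbound K 0 c s ->
  ev2 (at_t (rpow s n) t) p q = Cpow (ev2 (at_t s t) p q) n.
Proof.
  intros Hs; induction n as [|n IH]; [exact (ev2_one p q t)|].
  cbn [rpow Cpow]; rewrite at_mul, <- IH.
  apply (ev2_mul (Rlt_le _ _ HK) Hp Hq (wbound_gbound HK (Rle_refl 0) Hs Ht)
    (wbound_gbound HK (Rle_refl 0) (wbound_pow HK n Hs) Ht)).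
Qed.

Lemma ev_csum (g : nat -> nat -> Fn) N :
  ev2 (at_t (csum g U V N) t) p q = taylor_partial g x y t N.
Proof.
  assert (Hp1 := half_disc Hp); assert (Hq1 := half_disc Hq).
  assert (HM : forall a b, geo2 K (64 * ((64 * c) ^ a * (64 * c) ^ b)) (at_t (mono U V a b) t)).
  { intros a b.
    assert (B := wbound_mul HK (wbound_pow HK a HU) (wbound_pow HK b HV)).
    rewrite Rplus_0_r in B; exact (wbound_gbound HK (Rle_refl 0) B Ht). }
  assert (EM : forall a b, ev2 (at_t (mono U V a b) t) p q = (Cpow x a * Cpow y b)%cx).
  { intros a b; unfold mono; rewrite at_mul.
    rewrite (ev2_mul (Rlt_le _ _ HK) Hp Hq (wbound_gbound HK (Rle_refl 0) (wbound_pow HK a HU) Ht)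
      (wbound_gbound HK (Rle_refl 0) (wbound_pow HK b HV) Ht)).
    now rewrite !ev_pow. }
  assert (HT : forall a b, exists D, geo2 K D (at_t (inj (g a b) * mono U V a b)%cr t)).
  { intros a b; apply (ev_inj_mul HK Hp1 Hq1 (g a b) (HM a b)). }
  assert (HI := fun a => ev_sumr HK Hp1 Hq1 N (HT a)).
  unfold csum, taylor_partial.
  rewrite (proj2 (ev_sumr HK Hp1 Hq1 N (fun a => proj1 (HI a)))).
  apply Csum_ext; intros a; rewrite (proj2 (HI a)).
  apply Csum_ext; intros b.
  now rewrite (proj2 (ev_inj_mul HK Hp1 Hq1 (g a b) (HM a b))), EM.
Qed.
End Substitution.

(** A Schwarz lemma for coefficients: order n buys a smaller constant at the price of a larger
    growth rate. With mu = 1/2 it gives the convergence of the truncations, with small mu the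
    smallness of the map near the origin. *)
Lemma geo2_val K C mu n (a : S2 Cr) : 0 <= K -> 0 < mu <= 1 -> geo2 K C a ->
  val n a -> geo2 (K / mu) (C * mu ^ n) a.
Proof.
  intros HK Hmu Ha Hv i j.
  assert (HC := geo2_nonneg Ha).
  assert (HKm : 0 <= K / mu) by (apply Rdiv_le_0_compat; lra).
  destruct (Nat.lt_ge_cases (i + j) n) as [H|H].
  - rewrite Hv by easy; change (Cmod C0 <= C * mu ^ n * (K / mu) ^ i * (K / mu) ^ j).
    rewrite Cmod_C0; repeat apply Rmult_le_pos; try apply pow_le; lra.
  - eapply Rle_trans; [apply Ha|].
    rewrite !Rmult_assoc; apply Rmult_le_compat_l; [easy|].
    rewrite <- !pow_add; replace (i + j)%nat with (n + (i + j - n))%nat at 2 by lia.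
    rewrite (pow_add (K / mu)), <- Rmult_assoc, <- Rpow_mult_distr.
    replace (mu * (K / mu)) with K by (field; lra).
    replace (i + j)%nat with (n + (i + j - n))%nat at 1 by lia; rewrite pow_add.
    apply Rmult_le_compat_l; [now apply pow_le|].
    apply pow_incr; split; [easy|].
    apply Rle_div_r; [lra|nra].
Qed.

Lemma Cconv_unique (u : nat -> Cx) l l' B : Cconv u l ->
  (forall n, Cmod (u n - l')%cx <= B * (1 / 2) ^ n) -> l = l'.
Proof.
  intros Hu H; apply Csub0, Cmod_eq0, Rle_antisym; [|apply Cmod_ge0].
  apply le_eps; intros e He.
  destruct (Hu (e / 2)) as [N HN]; [lra|].
  destruct (@small_pow (Rabs B) (e / 2)) as [N' HN']; [lra|].
  set (n := (N + N')%nat).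
  assert (H1 := HN n ltac:(unfold n; lia)); assert (H2 := H n).
  replace (l - l')%cx with ((u n - l') - (u n - l))%cx by ring.
  eapply Rle_trans; [apply Cmod_sub|].
  assert (B * (1 / 2) ^ n <= Rabs B * (1 / 2) ^ N').
  { unfold n; rewrite Nat.add_comm, pow_add.
    assert (P1 : 0 <= (1 / 2) ^ N') by (apply pow_le; lra).
    assert (P2 : 0 <= (1 / 2) ^ N <= 1).
    { split; [apply pow_le; lra|].
      apply Rle_trans with (1 ^ N); [apply pow_incr; lra|rewrite pow1; lra]. }
    pose proof (Rle_abs B); pose proof (Rabs_pos B).
    rewrite <- (Rmult_1_r (Rabs B * (1 / 2) ^ N')), <- Rmult_assoc.
    assert (B * (1 / 2) ^ N' <= Rabs B * (1 / 2) ^ N') by (apply Rmult_le_compat_r; easy).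
    assert (0 <= Rabs B * (1 / 2) ^ N') by (now apply Rmult_le_pos).
    nra. }
  change (Cminus (u n) l) with (u n - l)%cx in H1; lra.
Qed.

(** * From a quadratic Taylor remainder to analyticity *)

Section Differentiability.
Variables (r B D : R) (g gp gq : Cx -> Cx -> Cx) (k : Cx) (G : C3 -> Cx).
Hypothesis HB : 0 <= B.
Hypothesis HG : forall p q e, G (p, q, e) = (g p q + k * e)%cx.
Hypothesis Htaylor : forall p q p' q',
  Cmod p <= r -> Cmod q <= r -> Cmod p' <= r -> Cmod q' <= r ->
  Cmod (g p' q' - g p q - ((p' - p) * gp p q + (q' - q) * gq p q))%cx
    <= B * (Cmod (p' - p)%cx + Cmod (q' - q)%cx) ^ 2.
Hypothesis Hbound : forall p q, Cmod p <= r -> Cmod q <= r ->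
  Cmod (gp p q) <= D /\ Cmod (gq p q) <= D.

Lemma taylor_eps p q : Cmod p < r -> Cmod q < r -> forall eps, 0 < eps ->
  exists delta, 0 < delta /\ forall h1 h2, Cmod h1 < delta -> Cmod h2 < delta ->
  Cmod (g (p + h1) (q + h2) - g p q - (h1 * gp p q + h2 * gq p q))%cx
    <= eps * (Cmod h1 + Cmod h2).
Proof.
  intros Hp Hq eps He.
  (* Then s <= 2 d gives B s <= eps; the B + 1 avoids division by 0. *)
  set (d := eps / (2 * (B + 1))).
  assert (Hd : 0 < d) by (apply Rdiv_lt_0_compat; lra).
  exists (Rmin d (Rmin (r - Cmod p) (r - Cmod q))); split.
  - repeat apply Rmin_glb_lt; lra.
  - intros h1 h2 H1 H2.
    assert (M1 := Rmin_l d (Rmin (r - Cmod p) (r - Cmod q))).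
    assert (M2 := Rmin_r d (Rmin (r - Cmod p) (r - Cmod q))).
    assert (M3 := Rmin_l (r - Cmod p) (r - Cmod q)).
    assert (M4 := Rmin_r (r - Cmod p) (r - Cmod q)).
    assert (T1 := Cmod_triangle p h1); assert (T2 := Cmod_triangle q h2).
    assert (T := @Htaylor p q (p + h1)%cx (q + h2)%cx ltac:(lra) ltac:(lra) ltac:(lra) ltac:(lra)).
    replace (p + h1 - p)%cx with h1 in T by ring.
    replace (q + h2 - q)%cx with h2 in T by ring.
    eapply Rle_trans; [exact T|].
    assert (P1 := Cmod_ge0 h1); assert (P2 := Cmod_ge0 h2).
    set (s := Cmod h1 + Cmod h2) in *.
    assert (Hs : 0 <= s <= 2 * d) by (unfold s; lra).
    assert (E : eps = 2 * (B + 1) * d) by (unfold d; field; lra).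
    rewrite E; replace (B * s ^ 2) with (B * s * s) by ring.
    apply Rmult_le_compat_r; [easy|].
    assert (B * s <= B * (2 * d)) by (now apply Rmult_le_compat_l); nra.
Qed.

Lemma G_Cdiff3 x : Dint r x -> Cdiff3 G x.
Proof.
  destruct x as [[p q] e]; intros [Hp [Hq He]].
  exists (gp p q), (gq p q), k; intros eps Heps.
  destruct (taylor_eps Hp Hq Heps) as [d [Hd H]]; exists d; split; [easy|].
  intros h1 h2 h3 H1 H2 H3; rewrite !HG.
  replace (_ - _)%cx with
    (g (p + h1) (q + h2) - g p q - (h1 * gp p q + h2 * gq p q))%cx by ring.
  eapply Rle_trans; [now apply H|].
  apply Rmult_le_compat_l; [lra|]; pose proof (Cmod_ge0 h3); lra.
Qed.

(** The remainder estimate and the derivative bounds hold on the closed polydisc, so continuity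
    reaches the boundary, with A as a Lipschitz constant. *)
Lemma G_cont : cont_on_D r G.
Proof.
  intros [[p q] e] [Hp [Hq _]] eps Heps.
  assert (HD := Rle_trans _ _ _ (Cmod_ge0 _) (proj1 (Hbound Hp Hq))).
  set (A := B * (4 * Rabs r) + D + Cmod k + 1).
  assert (HA : 1 <= A).
  { unfold A; pose proof (Rabs_pos r); pose proof (Cmod_ge0 k).
    assert (0 <= B * (4 * Rabs r)) by (apply Rmult_le_pos; lra); lra. }
  exists (eps / A); split; [apply Rdiv_lt_0_compat; lra|].
  intros [[p' q'] e'] [Hp' [Hq' _]] Hdist; unfold dist3 in Hdist; rewrite !HG.
  destruct (Hbound Hp Hq) as [B1 B2].
  assert (T := Htaylor Hp Hq Hp' Hq').
  set (s1 := Cmod (p' - p)%cx) in *; set (s2 := Cmod (q' - q)%cx) in *.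
  set (s3 := Cmod (e' - e)%cx) in *.
  assert (P1 : 0 <= s1) by apply Cmod_ge0; assert (P2 : 0 <= s2) by apply Cmod_ge0.
  assert (P3 : 0 <= s3) by apply Cmod_ge0.
  assert (S12 : s1 + s2 <= 4 * Rabs r).
  { pose proof (Cmod_sub p' p); pose proof (Cmod_sub q' q); pose proof (Rle_abs r).
    fold s1 in H; fold s2 in H0; lra. }
  set (w := (g p' q' - g p q - ((p' - p) * gp p q + (q' - q) * gq p q))%cx) in *.
  assert (E : (g p' q' + k * e' - (g p q + k * e))%cx =
    (w + ((p' - p) * gp p q + (q' - q) * gq p q) + k * (e' - e))%cx) by (unfold w; ring).
  rewrite E.
  apply Rle_lt_trans with (A * (s1 + s2 + s3)).
  - eapply Rle_trans; [apply Cmod_triangle|]; rewrite Cmod_mult; fold s3.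
    eapply Rle_trans; [apply Rplus_le_compat_r, Cmod_triangle|].
    assert (T2 := Cmod_triangle ((p' - p) * gp p q)%cx ((q' - q) * gq p q)%cx).
    rewrite !Cmod_mult in T2; fold s1 in T2; fold s2 in T2.
    apply (Rmult_le_compat_l _ _ _ P1) in B1; apply (Rmult_le_compat_l _ _ _ P2) in B2.
    assert (Hk := Cmod_ge0 k).
    assert (B * (s1 + s2) ^ 2 <= B * (4 * Rabs r) * (s1 + s2)).
    { replace (B * (s1 + s2) ^ 2) with (B * (s1 + s2) * (s1 + s2)) by ring.
      apply Rmult_le_compat_r; [lra|now apply Rmult_le_compat_l]. }
    assert (0 <= B * (4 * Rabs r)) by (pose proof (Rabs_pos r); apply Rmult_le_pos; lra).
    unfold A.
    assert (0 <= B * (4 * Rabs r) * s3) by (now apply Rmult_le_pos).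
    assert (0 <= D * s3) by (now apply Rmult_le_pos).
    assert (0 <= Cmod k * s1) by (now apply Rmult_le_pos).
    assert (0 <= Cmod k * s2) by (now apply Rmult_le_pos).
    lra.
  - apply (Rmult_lt_compat_l A) in Hdist; [|lra].
    replace (A * (eps / A)) with eps in Hdist by (field; lra); exact Hdist.
Qed.

Lemma G_analytic : analytic_on_D r G.
Proof. split; [exact G_Cdiff3|exact G_cont]. Qed.

Variables (G' : C3 -> R -> Cx) (t : R).
Hypothesis HG' : forall x, G' x t = G x.

Lemma G_partials p q e : Dint r (p, q, e) ->
  dP_p G' (p, q, e) t (gp p q) /\ dP_q G' (p, q, e) t (gq p q) /\ dP_e G' (p, q, e) t k.
Proof.
  intros [Hp [Hq He]]; split; [|split]; intros eps Heps.
  - destruct (taylor_eps Hp Hq Heps) as [d [Hd H]]; exists d; split; [easy|].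
    intros h Hh; rewrite !HG', !HG.
    specialize (H h C0 Hh); rewrite Cmod_C0 in H; specialize (H Hd).
    replace (q + C0)%cx with q in H by ring.
    rewrite Rplus_0_r in H; eapply Rle_trans; [|exact H].
    apply Req_le; f_equal; ring.
  - destruct (taylor_eps Hp Hq Heps) as [d [Hd H]]; exists d; split; [easy|].
    intros h Hh; rewrite !HG', !HG.
    specialize (H C0 h); rewrite Cmod_C0 in H; specialize (H Hd Hh).
    replace (p + C0)%cx with p in H by ring.
    rewrite Rplus_0_l in H; eapply Rle_trans; [|exact H].
    apply Req_le; f_equal; ring.
  - exists 1; split; [lra|]; intros h _; rewrite !HG', !HG.
    replace (_ - _)%cx with C0 by ring.
    rewrite Cmod_C0; apply Rmult_le_pos; [lra|apply Cmod_ge0].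
Qed.
End Differentiability.

(** * Bounds with unspecified constants *)

Lemma gbound_le K K' C C' s : 0 <= K <= K' -> C <= C' -> gbound K C s -> gbound K' C' s.
Proof.
  intros HK HC H t Ht; apply (geo2_leC (K := K') ltac:(lra) HC).
  apply (geo2_le (K := K)); [lra|lra|now apply H].
Qed.

Definition gbounded (K : R) (s : SS) : Prop := exists C, gbound K C s.

Lemma gbounded_le K K' s : 0 <= K <= K' -> gbounded K s -> gbounded K' s.
Proof. intros HK [C H]; exists C; now apply gbound_le with (3 := H); [|lra]. Qed.

Lemma gbounded_add K a b : gbounded K a -> gbounded K b -> gbounded K (a + b)%cr.
Proof.
  intros [C H] [D H']; exists (C + D); intros t Ht; exact (geo2_add (H t Ht) (H' t Ht)).
Qed.

Lemma gbounded_sub K a b : gbounded K a -> gbounded K b -> gbounded K (a - b)%cr.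
Proof.
  intros [C H] [D H']; exists (C + D); intros t Ht; exact (geo2_sub (H t Ht) (H' t Ht)).
Qed.

Lemma gbounded_opp K a : gbounded K a -> gbounded K (- a)%cr.
Proof. intros [C H]; exists C; intros t Ht; exact (geo2_opp (H t Ht)). Qed.

Lemma gbounded_mul K a b : 0 <= K -> gbounded K a -> gbounded K b -> gbounded (2 * K) (a * b)%cr.
Proof.
  intros HK [C H] [D H']; exists (C * D); intros t Ht; rewrite at_mul.
  exact (geo2_mul HK (H t Ht) (H' t Ht)).
Qed.

Lemma gbound_dp K C a : 0 <= K -> gbound K C a -> gbound (2 * K) (C * K) (dp a).
Proof. intros HK H t Ht; rewrite at_dp; exact (geo2_dp HK (H t Ht)). Qed.

Lemma gbound_dq K C a : 0 <= K -> gbound K C a -> gbound (2 * K) (C * K) (dq a).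
Proof. intros HK H t Ht; rewrite at_dq; exact (geo2_dq HK (H t Ht)). Qed.

Lemma gbounded_dp K a : 0 <= K -> gbounded K a -> gbounded (2 * K) (dp a).
Proof. intros HK [C H]; exists (C * K); now apply gbound_dp. Qed.

Lemma gbounded_dq K a : 0 <= K -> gbounded K a -> gbounded (2 * K) (dq a).
Proof. intros HK [C H]; exists (C * K); now apply gbound_dq. Qed.

Lemma gbounded_omega_s K omega : 0 <= K -> gbounded K (omega_s omega).
Proof.
  intros HK; exists (Cmod (RtoC omega)); intros t Ht i.
  destruct i as [|i].
  - rewrite Rmult_1_r; intros j.
    replace (at_t (omega_s omega) t O j) with (@cst Cr (RtoC omega) j) by now destruct j.
    now apply geo_cst.
  - intros j; change (Cmod C0 <= Cmod (RtoC omega) * K ^ S i * K ^ j); rewrite Cmod_C0.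
    apply Rmult_le_pos; [apply Rmult_le_pos; [apply Cmod_ge0|]|]; now apply pow_le.
Qed.

Lemma ev_wedge K p q t a b c d : 0 <= K -> 2 * K * Cmod p <= 1 / 2 -> 2 * K * Cmod q <= 1 / 2 ->
  0 <= t -> gbounded K a -> gbounded K b -> gbounded K c -> gbounded K d ->
  ev2 (at_t (a * b - c * d)%cr t) p q =
  wedge (ev2 (at_t a t) p q) (ev2 (at_t b t) p q) (ev2 (at_t c t) p q) (ev2 (at_t d t) p q).
Proof.
  intros HK Hp Hq Ht [A HA] [B HB] [C HC] [D HD].
  assert (HK2 : 0 <= 2 * K) by lra.
  unfold wedge; rewrite <- (ev2_mul HK Hp Hq (HA t Ht) (HB t Ht)),
    <- (ev2_mul HK Hp Hq (HC t Ht) (HD t Ht)), <- !at_mul.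
  assert (H1 : geo2 (2 * K) (A * B) (at_t (a * b)%cr t)).
  { rewrite at_mul; exact (geo2_mul HK (HA t Ht) (HB t Ht)). }
  assert (H2 : geo2 (2 * K) (C * D) (at_t (c * d)%cr t)).
  { rewrite at_mul; exact (geo2_mul HK (HC t Ht) (HD t Ht)). }
  exact (ev2_sub HK2 Hp Hq H1 H2).
Qed.

(** F is present only through its coefficients: the last clause accepts any limit l of the Taylor
    series at (x, y), so the values of F enter after the formal part is finished. W is the eta-free
    part of the momentum component. *)
Lemma formal_normal_form omega beta G L (f : nat -> nat -> Fn) :
  0 < beta -> 2 * beta <= omega -> 1 <= L -> (forall i j, ccont (f i j)) ->
  (forall i j t, 0 <= t -> Cmod (f i j t) <= G * (L ^ i * L ^ j) * exp (- beta * t)) ->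
  (forall i j, (i + j <= 2)%nat -> f i j = fun _ => C0) ->
  exists (U V W TU TV : SS) (K C : R), 1 <= K /\ 0 <= C /\
  (val 1 U /\ val 1 V /\ val 1 W) /\
  (gbound K C U /\ gbound K C V /\ gbound K C W /\ gbound K C TU /\ gbound K C TV) /\
  ((forall i j t, cder (U i j) t (TU i j t)) /\ (forall i j t, cder (V i j) t (TV i j t))) /\
  ((dp U * dq V - dq U * dp V)%cr = (1 : SS)%cr /\
   (dp V * TU - TV * dp U)%cr = dp W /\ (dq V * TU - TV * dq U)%cr = dq W) /\
  (forall p q t l, 0 <= t -> 2 * K * Cmod p <= 1 / 2 -> 2 * K * Cmod q <= 1 / 2 ->
     let x := ev2 (at_t U t) p q in let y := ev2 (at_t V t) p q in
     Cconv (taylor_partial f x y t) l ->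
     ev2 (at_t W t) p q = (RtoC omega * (p * q) - RtoC omega * (x * y) - l)%cx).
Proof.
  intros Hb Hob HL Hfc Hfb Hf0.
  assert (Ho : 0 < omega) by lra.
  destruct (series_solution Hb Hob HL Hfc Hfb Hf0) as
    [u [v [K [C [HK [Hu2 [Hv2 [[HdU HdV] [[Hu0 Hv0] [[Bu Bv]
      [[BU [BV [GP GQ]]] [GF GS]]]]]]]]]]]].
  assert (HK0 : 0 < K) by lra.
  assert (HC : 0 <= C) by exact (wbound_nonneg HK0 Bu).
  assert (Hdec : forall s, wbound K beta C s -> decays beta s).
  { intros s Hs i j; exists (C * wt2 K i j); intros t Ht; now apply Hs. }
  assert (J := jacobian_one Ho Hb Hu2 Hv2 HdU HdV Hu0 Hv0 (Hdec u Bu) (Hdec v Bv)).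
  assert (Ep := canonical_p Ho Hb Hu2 Hv2 HdU HdV Hu0 Hv0 (Hdec u Bu) (Hdec v Bv)).
  assert (Eq := canonical_q Ho Hb Hu2 Hv2 HdU HdV Hu0 Hv0 (Hdec u Bu) (Hdec v Bv)).
  assert (D1 := isX_time (isX_U HdU)); assert (D2 := isX_time (isX_V HdV)).
  destruct (val_UV Hu2 Hv2) as [VU VV].
  set (U := (var_p Fn + u)%cr) in *; set (V := (var_q Fn + v)%cr) in *.
  set (W := energy omega f u v) in *; set (T1 := TU omega f u v) in *.
  set (T2 := TV omega f u v) in *.
  assert (GU : gbounded K U) by (exists C; exact (wbound_gbound HK0 (Rle_refl 0) BU)).
  assert (GV : gbounded K V) by (exists C; exact (wbound_gbound HK0 (Rle_refl 0) BV)).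
  assert (GXp : gbounded K (var_p Fn)) by (eexists; exact (wbound_gbound HK0 (Rle_refl 0) (wbound_var_p HK0))).
  assert (GXq : gbounded K (var_q Fn)) by (eexists; exact (wbound_gbound HK0 (Rle_refl 0) (wbound_var_q HK0))).
  assert (Gom : gbounded K (omega_s omega)) by (apply gbounded_omega_s; lra).
  assert (M2 : forall a b, gbounded K a -> gbounded K b -> gbounded (2 * K) (a * b)%cr)
    by (intros; apply gbounded_mul; auto; lra).
  assert (M4 : forall a b, gbounded (2 * K) a -> gbounded (2 * K) b -> gbounded (4 * K) (a * b)%cr).
  { intros a b Ha Hb'; replace (4 * K) with (2 * (2 * K)) by ring; apply gbounded_mul; auto; lra. }
  assert (L12 : forall a, gbounded K a -> gbounded (2 * K) a) by (intros a; apply gbounded_le; lra).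
  assert (L14 : forall a, gbounded K a -> gbounded (4 * K) a) by (intros a; apply gbounded_le; lra).
  assert (L24 : forall a, gbounded (2 * K) a -> gbounded (4 * K) a) by (intros a; apply gbounded_le; lra).
  assert (Dp2 : forall a, gbounded K a -> gbounded (2 * K) (dp a)) by (intros; apply gbounded_dp; auto; lra).
  assert (Dq2 : forall a, gbounded K a -> gbounded (2 * K) (dq a)) by (intros; apply gbounded_dq; auto; lra).
  assert (GcF : gbounded K (comp f U V)) by (now exists C).
  assert (GcP : gbounded K (comp (gp f) U V)) by (now exists C).
  assert (GcQ : gbounded K (comp (gq f) U V)) by (now exists C).
  assert (GW : gbounded (4 * K) W).
  { unfold W, energy; fold U; fold V.
    apply gbounded_sub; [apply gbounded_sub; [apply M4|apply M4]|]; auto. }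
  assert (GT1 : gbounded (4 * K) T1).
  { unfold T1, TU, XU; fold U; fold V.
    apply gbounded_add; [apply gbounded_sub; [apply gbounded_sub; [apply gbounded_opp|]|apply M4]|apply M4]; auto. }
  assert (GT2 : gbounded (4 * K) T2).
  { unfold T2, TV, XV; fold U; fold V.
    apply gbounded_add; [apply gbounded_sub; [apply gbounded_add|apply M4]|apply M4]; auto. }
  apply L14 in GU as GU4; apply L14 in GV as GV4.
  destruct GU4 as [c1 G1]; destruct GV4 as [c2 G2]; destruct GW as [c3 G3].
  destruct GT1 as [c4 G4]; destruct GT2 as [c5 G5].
  set (c := Rabs c1 + Rabs c2 + Rabs c3 + Rabs c4 + Rabs c5).
  assert (Hc : c1 <= c /\ c2 <= c /\ c3 <= c /\ c4 <= c /\ c5 <= c /\ 0 <= c).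
  { pose proof (Rabs_pos c1); pose proof (Rabs_pos c2); pose proof (Rabs_pos c3).
    pose proof (Rabs_pos c4); pose proof (Rabs_pos c5).
    pose proof (Rle_abs c1); pose proof (Rle_abs c2); pose proof (Rle_abs c3).
    pose proof (Rle_abs c4); pose proof (Rle_abs c5); unfold c; lra. }
  destruct Hc as [Hc1 [Hc2 [Hc3 [Hc4 [Hc5 Hc0]]]]].
  (* The rate 4 K accounts for two nested products, as in omega p q, or for a derivative followed by
     a product. *)
  exists U, V, W, T1, T2, (4 * K), c.
  split; [lra|split; [easy|split; [|split; [|split; [|split]]]]].
  - split; [exact VU|split; [exact VV|]].
    unfold W, energy; fold U; fold V; apply val_sub; [apply val_sub|].
    + apply val_mulr, val_var_q.
    + apply val_mulr, VV.
    + apply val_comp; [exact VU|exact VV|]; intros a b H; apply Hf0; lia.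
  - repeat match goal with |- _ /\ _ => split end;
      (eapply gbound_le; [|..|eassumption]; lra).
  - split; [exact D1|exact D2].
  - auto.
  - intros p q t l Ht Hp Hq x y Hl.
    assert (Hz : forall z k, 0 <= k <= 8 * K -> 2 * (4 * K) * Cmod z <= 1 / 2 ->
      k * Cmod z <= 1 / 2).
    { intros z k Hk H; pose proof (Cmod_ge0 z); nra. }
    assert (HK1 : 0 <= K) by lra; assert (HK2 : 0 <= 2 * K) by lra.
    assert (HK4 : 0 <= 4 * K) by lra.
    assert (P1 := Hz p K ltac:(lra) Hp); assert (Q1 := Hz q K ltac:(lra) Hq).
    assert (P2 := Hz p (2 * K) ltac:(lra) Hp); assert (Q2 := Hz q (2 * K) ltac:(lra) Hq).
    assert (P4 := Hz p (2 * (2 * K)) ltac:(lra) Hp); assert (Q4 := Hz q (2 * (2 * K)) ltac:(lra) Hq).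
    assert (P4' := Hz p (4 * K) ltac:(lra) Hp); assert (Q4' := Hz q (4 * K) ltac:(lra) Hq).
    (* The n-th truncation and the composition differ by a series of order n + 1; [geo2_val] with mu
       = 1/2 converts this into an error of size 2^(-n). *)
    assert (El : l = ev2 (at_t (comp f U V) t) p q).
    { apply (Cconv_unique (B := 16 * (2 * C)) Hl); intros n.
      assert (E := ev_csum HK0 P2 Q2 Ht BU BV f n); fold x in E; fold y in E.
      rewrite <- E, <- (ev2_sub HK1 P1 Q1 (GS n t Ht) (GF t Ht)).
      assert (Vn : val (S n) (at_t (csum f U V n) t - at_t (comp f U V) t : S2 Cr)%cr).
      { intros i j Hij; exact (f_equal (fun z => z t) (csum_comp f (N := n) VU VV Hij)). }
      assert (Gd := geo2_val (mu := 1 / 2) HK1 ltac:(lra)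
        (geo2_sub (GS n t Ht) (GF t Ht)) (val_le (Nat.le_succ_diag_r n) Vn)).
      replace (K / (1 / 2)) with (2 * K) in Gd by field.
      assert (Bd := ev2_bound HK2 P2 Q2 Gd).
      replace (16 * (2 * C) * (1 / 2) ^ n) with (16 * ((C + C) * (1 / 2) ^ n)) by ring.
      exact Bd. }
    assert (MUL : forall a b, gbounded K a -> gbounded K b ->
      ev2 (at_t (a * b)%cr t) p q = (ev2 (at_t a t) p q * ev2 (at_t b t) p q)%cx).
    { intros a b [ca Ha] [cb Hb']; rewrite at_mul; apply (ev2_mul HK1 P2 Q2 (Ha t Ht) (Hb' t Ht)). }
    assert (MUL2 : forall a b, gbounded (2 * K) a -> gbounded K b ->
      ev2 (at_t (a * b)%cr t) p q = (ev2 (at_t a t) p q * ev2 (at_t b t) p q)%cx).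
    { intros a b [ca Ha] Gb; destruct (L12 b Gb) as [cb Hb']; rewrite at_mul.
      apply (ev2_mul HK2 P4 Q4 (Ha t Ht) (Hb' t Ht)). }
    assert (SUB : forall a b, gbounded (4 * K) a -> gbounded (4 * K) b ->
      ev2 (at_t (a - b)%cr t) p q = (ev2 (at_t a t) p q - ev2 (at_t b t) p q)%cx).
    { intros a b [ca Ha] [cb Hb'].
      exact (ev2_sub HK4 P4' Q4' (Ha t Ht) (Hb' t Ht)). }
    unfold W, energy; fold U; fold V.
    rewrite SUB, SUB, MUL2, MUL, MUL2, MUL; auto; try (apply gbounded_sub; apply M4; auto).
    fold x; fold y; rewrite El.
    rewrite (ev2_var_p q t HK0 P1), (ev2_var_q p t HK0 Q1).
    unfold omega_s; rewrite ev2_inj; ring.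
Qed.

(** * Coefficient data from the hypotheses, and choice of the radii *)

(** At m = [Rmax 0 t] the difference quotients are bounded, so increments of g from m are at most
    linear, and s -> [Rmax 0 s] does not increase distances. Freezing g to the left of 0 makes this
    a two-sided statement. *)
Lemma C1_Rplus_continuous (g : R -> R) t : C1_Rplus g -> continuous (fun s => g (Rmax 0 s)) t.
Proof.
  intros [g' [Hd _]].
  set (m := Rmax 0 t); assert (Hm : 0 <= m) by apply Rmax_l.
  destruct (Hd m Hm 1 Rlt_0_1) as [d [Hd0 H]].
  set (A := Rabs (g' m) + 1).
  assert (HA : 0 < A) by (unfold A; pose proof (Rabs_pos (g' m)); lra).
  assert (Hlip : forall s, Rabs (s - t) < d -> Rabs (g (Rmax 0 s) - g m) <= A * Rabs (s - t)).
  { intros s Hs.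
    set (h := Rmax 0 s - m).
    assert (Hh : Rabs h <= Rabs (s - t)).
    { unfold h, m, Rmax; destruct (Rle_dec 0 s), (Rle_dec 0 t);
        unfold Rabs; repeat destruct Rcase_abs; lra. }
    replace (Rmax 0 s) with (m + h) by (unfold h; ring).
    destruct (Req_dec h 0) as [->|Hne].
    - rewrite Rplus_0_r; replace (g m - g m) with 0 by ring; rewrite Rabs_R0.
      apply Rmult_le_pos; [lra|apply Rabs_pos].
    - assert (Hmh : 0 <= m + h) by (unfold h; replace (m + (Rmax 0 s - m)) with (Rmax 0 s) by ring; apply Rmax_l).
      assert (Q := H h Hne Hmh ltac:(lra)).
      assert (Q' : Rabs ((g (m + h) - g m) / h) <= A).
      { replace ((g (m + h) - g m) / h) with ((g (m + h) - g m) / h - g' m + g' m) by ring.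
        eapply Rle_trans; [apply Rabs_triang|]; unfold A; lra. }
      replace (g (m + h) - g m) with ((g (m + h) - g m) / h * h) by (field; easy).
      rewrite Rabs_mult; apply Rmult_le_compat; auto using Rabs_pos. }
  intros P [eps HP].
  assert (Hpos : 0 < Rmin d (eps / A)).
  { apply Rmin_glb_lt; [easy|]; apply Rdiv_lt_0_compat; [apply cond_pos|easy]. }
  exists (mkposreal _ Hpos); intros s Hs; apply HP.
  change (Rabs (s - t) < Rmin d (eps / A)) in Hs.
  change (Rabs (g (Rmax 0 s) - g m) < eps).
  eapply Rle_lt_trans; [apply Hlip, (Rlt_le_trans _ _ _ Hs), Rmin_l|].
  assert (Hs2 : Rabs (s - t) < eps / A) by (apply (Rlt_le_trans _ _ _ Hs), Rmin_r).
  apply (Rmult_lt_compat_l A) in Hs2; [|easy].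
  replace (A * (eps / A)) with (pos eps) in Hs2 by (field; lra); exact Hs2.
Qed.

Lemma sum_f_R0_term (w : nat -> R) i N : (forall k, 0 <= w k) -> (i <= N)%nat ->
  w i <= sum_f_R0 w N.
Proof.
  intros Hw H; induction H as [|N H IH].
  - destruct i as [|i]; simpl; [lra|].
    assert (0 <= sum_f_R0 w i) by (now apply cond_pos_sum); lra.
  - simpl; specialize (Hw (S N)); lra.
Qed.

(** A single term of a nonnegative sum is at most the sum; the result is a Cauchy estimate with rate
    1 / rho. *)
Lemma taylor_norm_coef f rho t B i j : 0 < rho -> taylor_norm_le f rho t B ->
  Cmod (f i j t) <= B * ((/ rho) ^ i * (/ rho) ^ j).
Proof.
  intros Hrho H; specialize (H (i + j)%nat); unfold norm_partial in H.
  assert (Hpos : forall a b, 0 <= Cmod (f a b t) * rho ^ (a + b)).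
  { intros a b; apply Rmult_le_pos; [apply Cmod_ge0|apply pow_le; lra]. }
  assert (H1 := sum_f_R0_term (w := fun b => Cmod (f i b t) * rho ^ (i + b)) (i := j)
    (N := (i + j)%nat) (Hpos i) ltac:(lia)).
  assert (H2 := sum_f_R0_term (w := fun a => sum_f_R0 (fun b => Cmod (f a b t) * rho ^ (a + b))
    (i + j)) (i := i) (N := (i + j)%nat)
    (fun a => cond_pos_sum _ _ (Hpos a)) ltac:(lia)).
  cbv beta in H1, H2.
  rewrite <- pow_add, pow_inv.
  assert (Hp : 0 < rho ^ (i + j)) by (now apply pow_lt).
  apply (Rle_div_r (Cmod (f i j t)) B (rho ^ (i + j)) Hp); lra.
Qed.

(** [ev2_bound] alone gives 16 C; the missing constant term gains the factor mu on a polydisc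
    smaller by mu. *)
Lemma val_small K C mu r (s : SS) p q t : 0 <= K -> 0 < mu <= 1 -> K / mu * r <= 1 / 2 ->
  Cmod p <= r -> Cmod q <= r -> 0 <= t -> gbound K C s -> val 1 s ->
  Cmod (ev2 (at_t s t) p q) <= 16 * C * mu.
Proof.
  intros HK Hmu Hr Hp Hq Ht Hs Hv.
  assert (HKm : 0 <= K / mu) by (apply Rdiv_le_0_compat; lra).
  assert (V : val 1 (at_t s t)).
  { intros i j Hij; exact (f_equal (fun z => z t) (Hv i j Hij)). }
  assert (G := geo2_val HK Hmu (Hs t Ht) V).
  replace (16 * C * mu) with (16 * (C * mu ^ 1)) by ring.
  apply (ev2_bound HKm) with (3 := G); (eapply Rle_trans; [|exact Hr]);
    now apply Rmult_le_compat_l.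
Qed.

Theorem theorem2
  (omega R0 : R) (F : Cx -> Cx -> R -> Cx) (f : nat -> nat -> R -> Cx)
  (Homega : 0 < omega <= 1)
  (HR : 0 < R0 <= 1 / 2)
  (* F(.,.,t) continuous on Q_R, holomorphic in its interior *)
  (HFcont : forall t, 0 <= t -> cont_on_Q R0 (fun p q => F p q t))
  (HFhol : forall t, 0 <= t -> forall p q, Qint R0 p q -> Cdiff2 (fun p q => F p q t) p q)
  (* F real for real (p,q) *)
  (HFreal : forall t, 0 <= t -> forall x y, Qdom R0 (RtoC x) (RtoC y) ->
              Cim (F (RtoC x) (RtoC y) t) = 0)
  (* Taylor expansion F = sum f_a(t) p^a1 q^a2 on Q_R *)
  (HFtaylor : forall t, 0 <= t -> forall p q, Qdom R0 p q ->
              Cconv (taylor_partial f p q t) (F p q t))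
  (* f_a = 0 for |a| <= 2 *)
  (Hf012 : forall i j t, (i + j <= 2)%nat -> f i j t = C0)
  (* Re f_a, Im f_a in Cx^1(R^+) *)
  (HfC1 : forall i j, C1_Rplus (fun t => Cre (f i j t)) /\ C1_Rplus (fun t => Cim (f i j t)))
  (* slow-decay hypothesis *)
  (Hdecay : exists MF a, 1 <= MF /\ 0 < a /\
              forall t, 0 <= t -> taylor_norm_le f R0 t (MF * exp (- a * t))) :
  exists (Rs Rz : R) (M : C3 -> R -> C3),
    0 < Rs /\ Rs < Rz /\ Rz <= R0 ^ 4 /\
    (* M(., t) : D_{R*} -> D_{R0hat} *)
    (forall x t, 0 <= t -> Ddom Rs x -> Ddom Rz (M x t)) /\
    (* analytic on D_{R*} for every t *)
    (forall t, 0 <= t ->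
       analytic_on_D Rs (fun x => compP M x t) /\
       analytic_on_D Rs (fun x => compQ M x t) /\
       analytic_on_D Rs (fun x => compE M x t)) /\
    (* canonical in the extended phase space, t unchanged *)
    canonical_on Rs M /\
    (* H o M_S = omega p q + eta *)
    (forall x t, 0 <= t -> Ddom Rs x ->
       Ham omega F (M x t) t =
       (let '(p, q, e) := x in Cplus (Cmult (RtoC omega) (Cmult p q)) e)).
Proof.
  destruct Hdecay as [MF [a [HMF [Ha Hd]]]].
  (* The decay rate may exceed omega; lowering it to omega / 2 secures the gap needed by the scalar
     equations. *)
  set (beta := Rmin a (omega / 2)).
  assert (Hb : 0 < beta) by (apply Rmin_glb_lt; lra).
  assert (Hba : beta <= a) by apply Rmin_l.
  assert (Hbo : 2 * beta <= omega) by (pose proof (Rmin_r a (omega / 2)); fold beta in H; lra).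
  (* Freezing f for t < 0 makes all coefficients differentiable on the whole line, so that
     one-sided derivatives at t = 0 never occur. *)
  set (f' := fun i j t => f i j (Rmax 0 t)).
  assert (HL : 1 <= / R0) by (rewrite <- Rinv_1; apply Rinv_le_contravar; lra).
  assert (Ef : forall t, 0 <= t -> forall i j, f' i j t = f i j t).
  { intros t Ht i j; unfold f'; now rewrite Rmax_right. }
  assert (Hfc : forall i j, ccont (f' i j)).
  { intros i j t; destruct (HfC1 i j) as [H1 H2]; split.
    - exact (C1_Rplus_continuous (t := t) H1).
    - exact (C1_Rplus_continuous (t := t) H2). }
  assert (Hfb : forall i j t, 0 <= t ->
    Cmod (f' i j t) <= MF * ((/ R0) ^ i * (/ R0) ^ j) * exp (- beta * t)).
  { intros i j t Ht; rewrite Ef by easy.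
    eapply Rle_trans; [exact (taylor_norm_coef i j (proj1 HR) (Hd t Ht))|].
    replace (MF * exp (- a * t) * ((/ R0) ^ i * (/ R0) ^ j))
      with (MF * ((/ R0) ^ i * (/ R0) ^ j) * exp (- a * t)) by ring.
    apply Rmult_le_compat_l.
    - apply Rmult_le_pos; [lra|]; apply Rmult_le_pos; apply pow_le; lra.
    - destruct (Rle_lt_or_eq_dec (- a * t) (- beta * t)) as [H|H]; [nra| |rewrite H; lra].
      left; now apply exp_increasing. }
  assert (Hf0 : forall i j, (i + j <= 2)%nat -> f' i j = fun _ => C0).
  { intros i j H; apply functional_extensionality; intros t; now apply Hf012. }
  destruct (formal_normal_form Hb Hbo HL Hfc Hfb Hf0) as
    [U [V [W [TU [TV [K [C [HK [HC [[VU [VV VW]] [[GU [GV [GW [GTU GTV]]]]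
      [[DU DV] [[J [Cp Cq]] HW]]]]]]]]]]]]].
  set (Rz := R0 ^ 4).
  assert (HRz : 0 < Rz <= R0).
  { split; [apply pow_lt; lra|]; unfold Rz.
    assert (R0 * R0 <= R0 * 1) by (apply Rmult_le_compat_l; lra).
    assert (0 <= R0 * R0) by nra.
    replace (R0 ^ 4) with (R0 * R0 * (R0 * R0)) by ring; nra. }
  (* Gives 16 C mu <= Rz / 2: U, V and the eta-free part of the momentum then take at most half of
     the target radius. *)
  set (mu := Rz / (32 * (C + 1))).
  assert (Hmu : 0 < mu <= 1).
  { unfold mu; split; [apply Rdiv_lt_0_compat; lra|].
    apply Rle_div_l; [lra|]; lra. }
  assert (HCmu : 16 * C * mu <= Rz / 2).
  { assert (E : 32 * (C + 1) * mu = Rz) by (unfold mu; field; lra); nra. }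
  (* Serves two needs: K r / mu = Rz / 16 <= 1/2 for [val_small], and 8 K r <= 1/2, which covers the
     growth rates met below. *)
  set (r := Rz * mu / (16 * K)).
  assert (Hr0 : 0 < r) by (apply Rdiv_lt_0_compat; nra).
  assert (EK : 16 * K * r = Rz * mu) by (unfold r; field; lra).
  assert (HK0 : 0 <= K) by lra.
  assert (HKr : 8 * K * r <= 1 / 2) by nra.
  assert (HrR : r <= Rz / 16).
  { assert (16 * r * 1 <= 16 * r * K) by (apply Rmult_le_compat_l; lra).
    assert (Rz * mu <= Rz * 1) by (apply Rmult_le_compat_l; lra); lra. }
  assert (Hmur : K / mu * r <= 1 / 2).
  { replace (K / mu * r) with (Rz / 16) by (unfold r; field; lra); lra. }
  assert (Hz : forall z k, Cmod z <= r -> 0 <= k <= 8 -> k * K * Cmod z <= 1 / 2).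
  { intros z k Hzr Hk; apply Rle_trans with (8 * K * r); [|easy].
    apply Rmult_le_compat; [nra|apply Cmod_ge0|nra|easy]. }
  assert (SM : forall s p q t, gbound K C s -> val 1 s -> 0 <= t -> Cmod p <= r -> Cmod q <= r ->
    Cmod (ev2 (at_t s t) p q) <= Rz / 2).
  { intros s p q t Gs Vs Ht Hp Hq; eapply Rle_trans; [|exact HCmu].
    now apply (val_small HK0 Hmu Hmur). }
  destruct (ev2_taylor HK0 (ltac:(nra) : 4 * K * r <= 1 / 2) HC) as [B [HB HT]].
  assert (BD1 : forall s p q t, gbound K C s -> 0 <= t -> Cmod p <= r -> Cmod q <= r ->
    Cmod (ev2 (dp (at_t s t)) p q) <= 16 * (C * K) /\
    Cmod (ev2 (dq (at_t s t)) p q) <= 16 * (C * K)).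
  { intros s p q t Gs Ht Hp Hq.
    assert (HK2 : 0 <= 2 * K) by lra.
    assert (P := Hz p 2 Hp ltac:(lra)); assert (Q := Hz q 2 Hq ltac:(lra)).
    split; apply (ev2_bound HK2 P Q); [apply geo2_dp|apply geo2_dq]; auto. }
  set (M := fun (x : C3) (t : R) => let '(p, q, e) := x in
    (ev2 (at_t U t) p q, ev2 (at_t V t) p q, (e + ev2 (at_t W t) p q)%cx) : C3).
  (* Here k is the derivative in eta: 0 for P and Q, 1 for the momentum. *)
  assert (AN : forall (s : SS) k (G : C3 -> R -> Cx), gbound K C s ->
    (forall p q e t, G (p, q, e) t = (ev2 (at_t s t) p q + k * e)%cx) ->
    (forall t, 0 <= t -> analytic_on_D r (fun x => G x t)) /\
    (forall p q e t, 0 <= t -> Dint r (p, q, e) ->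
       dP_p G (p, q, e) t (ev2 (at_t (dp s) t) p q) /\
       dP_q G (p, q, e) t (ev2 (at_t (dq s) t) p q) /\ dP_e G (p, q, e) t k)).
  { intros s k G Gs HG; split.
    - intros t Ht.
      apply (@G_analytic r B (16 * (C * K)) (ev2 (at_t s t)) (ev2 (dp (at_t s t)))
        (ev2 (dq (at_t s t))) k (fun x => G x t) HB).
      + intros; apply HG.
      + intros; now apply HT; [apply Gs|..].
      + intros; now apply BD1.
    - intros p q e t Ht Hx; rewrite at_dp, at_dq.
      apply (@G_partials r B (ev2 (at_t s t)) (ev2 (dp (at_t s t)))
        (ev2 (dq (at_t s t))) k (fun x => G x t) HB); auto. }
  destruct (AN U C0 (compP M) GU) as [AP DP].
  { intros; change (compP M (p, q, e) t) with (ev2 (at_t U t) p q); ring. }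
  destruct (AN V C0 (compQ M) GV) as [AQ DQ].
  { intros; change (compQ M (p, q, e) t) with (ev2 (at_t V t) p q); ring. }
  destruct (AN W C1 (compE M) GW) as [AE DE].
  { intros; change (compE M (p, q, e) t) with (e + ev2 (at_t W t) p q)%cx; ring. }
  clear AN.
  exists r, Rz, M.
  split; [exact Hr0|split; [lra|split; [apply Rle_refl|split; [|split; [|split]]]]].
  - intros [[p q] e] t Ht [Hp [Hq He]].
    assert (B1 := SM U p q t GU VU Ht Hp Hq); assert (B2 := SM V p q t GV VV Ht Hp Hq).
    assert (B3 := SM W p q t GW VW Ht Hp Hq).
    split; [lra|split; [lra|]].
    change (Rabs (snd e + snd (ev2 (at_t W t) p q)) <= Rz).
    eapply Rle_trans; [apply Rabs_triang|].
    assert (B4 := Cmod_snd (ev2 (at_t W t) p q)); unfold Cim in He; lra.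
  - intros t Ht; auto.
  - intros [[p q] e] t Hx Ht.
    destruct (DP p q e t Ht Hx) as [Pp [Pq Pe]].
    destruct (DQ p q e t Ht Hx) as [Qp [Qq Qe]].
    destruct (DE p q e t Ht Hx) as [Ep [Eq Ee]].
    destruct Hx as [Hp [Hq He]]; apply Rlt_le in Hp; apply Rlt_le in Hq.
    assert (P1 : Cmod p <= 1) by lra; assert (Q1 : Cmod q <= 1) by lra.
    assert (PK : K * Cmod p <= 1 / 2) by (pose proof (Hz p 1 Hp ltac:(lra)); lra).
    assert (QK : K * Cmod q <= 1 / 2) by (pose proof (Hz q 1 Hq ltac:(lra)); lra).
    assert (HK2 : 0 <= 2 * K) by lra.
    assert (PK4 : 2 * (2 * K) * Cmod p <= 1 / 2)
      by (pose proof (Hz p 4 Hp ltac:(lra)); lra).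
    assert (QK4 : 2 * (2 * K) * Cmod q <= 1 / 2)
      by (pose proof (Hz q 4 Hq ltac:(lra)); lra).
    assert (EU : gbounded K U) by now exists C.
    assert (EV : gbounded K V) by now exists C.
    assert (ETU : gbounded (2 * K) TU) by (apply gbounded_le with K; [lra|now exists C]).
    assert (ETV : gbounded (2 * K) TV) by (apply gbounded_le with K; [lra|now exists C]).
    assert (WJ := ev_wedge HK2 PK4 QK4 Ht (gbounded_dp HK0 EU) (gbounded_dq HK0 EV)
      (gbounded_dq HK0 EU) (gbounded_dp HK0 EV)).
    rewrite J, ev2_one in WJ.
    assert (Wp := ev_wedge HK2 PK4 QK4 Ht (gbounded_dp HK0 EV) ETU ETV (gbounded_dp HK0 EU)).
    rewrite Cp in Wp.
    assert (Wq := ev_wedge HK2 PK4 QK4 Ht (gbounded_dq HK0 EV) ETU ETV (gbounded_dq HK0 EU)).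
    rewrite Cq in Wq.
    exists (ev2 (at_t (dp U) t) p q), (ev2 (at_t (dq U) t) p q), C0, (ev2 (at_t TU t) p q).
    exists (ev2 (at_t (dp V) t) p q), (ev2 (at_t (dq V) t) p q), C0, (ev2 (at_t TV t) p q).
    exists (ev2 (at_t (dp W) t) p q), (ev2 (at_t (dq W) t) p q), C1.
    split; [exact Pp|split; [exact Pq|split; [exact Pe|split]]].
    { intros eps Heps; exact (ev2_dt HK0 PK QK P1 Q1 GU GTU DU Ht Heps). }
    split; [exact Qp|split; [exact Qq|split; [exact Qe|split]]].
    { intros eps Heps; exact (ev2_dt HK0 PK QK P1 Q1 GV GTV DV Ht Heps). }
    split; [exact Ep|split; [exact Eq|split; [exact Ee|]]].
    (* P and Q do not depend on eta and the momentum has eta-derivative 1, so the three relations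
       with deta are trivial; the others are the evaluated series identities. *)
    rewrite Wp, Wq; unfold wedge in *.
    repeat split; try ring; now rewrite WJ.
  - intros [[p q] e] t Ht [Hp [Hq He]].
    (* The Taylor series of F is summed at the image point, which lies in the polydisc of radius R0
       because Rz <= R0. *)
    assert (Hx : Qdom R0 (ev2 (at_t U t) p q) (ev2 (at_t V t) p q)).
    { assert (B1 := SM U p q t GU VU Ht Hp Hq); assert (B2 := SM V p q t GV VV Ht Hp Hq).
      split; lra. }
    assert (Hl := HFtaylor t Ht _ _ Hx).
    assert (EW := HW p q t (F (ev2 (at_t U t) p q) (ev2 (at_t V t) p q) t) Ht
      (Hz p 2 Hp ltac:(lra)) (Hz q 2 Hq ltac:(lra))).
    cbv zeta in EW; unfold Ham, M; rewrite EW; [ring|].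
    intros eps Heps; destruct (Hl eps Heps) as [N HN]; exists N; intros n Hn.
    replace (taylor_partial f' _ _ t n) with
      (taylor_partial f (ev2 (at_t U t) p q) (ev2 (at_t V t) p q) t n); [now apply HN|].
    unfold taylor_partial; apply Csum_ext; intros i; apply Csum_ext; intros j.
    now rewrite Ef.
Qed.
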